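(* Let $d\ge1$, $\sigma=0$, $\sigma_0>0$, $\alpha>0$, $W(x)=\alpha|x|^2/2$ for $x\in\mathbb{R}^d$, and let $V:\mathbb{R}^d\to\mathbb{R}$ be twice differentiable such that: (i) there exists a function $\kappa:[0,+\infty)\to\mathbb{R}$ such that $(\nabla V(x)-\nabla V(y))\cdot(x-y)\ge\kappa(|x-y|)\,|x-y|^2$ for all $x,y\in\mathbb{R}^d$, with $\limsup_{r\to+\infty}\kappa(r)>0$ and $\int_0^1r\,\kappa^-(r)\,\mathrm{d}r<\infty$, where $\kappa^-=\max(0,-\kappa)$; (ii) $\nabla V$ is Lipschitz continuous with constant $L_V>0$. Then there exists at least one invariant measure $\bar P$ for the process $(m_t)_{t\ge0}$, and this measure is supported by Dirac masses. More precisely, $$\bar P(\mathrm{d}m)=\int_{\mathbb{R}^d}\delta_{\delta_a}(\mathrm{d}m)\,\mu_0(\mathrm{d}a)$$ is an invariant measure, where $\mu_0$ is the probability measure on $\mathbb{R}^d$ which admits a density proportional to $\exp(-2V/\sigma_0^2)$.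
   Context: Probabilistic setting: $(\Omega^0,\mathcal{F}^0,\mathbb{F}^0=(\mathcal F^0_t)_{t\ge0},\mathbb{P}^0)$ is a filtered probability space carrying a $d$-dimensional $\mathbb{F}^0$-Brownian motion $B^0$ (the common noise), $(\Omega^1,\mathcal{F}^1,\mathbb{F}^1,\mathbb{P}^1)$ is another filtered probability space, and $(\Omega,\mathcal{F},\mathbb{F},\mathbb{P})$ is the completed product space with $\Omega=\Omega^0\times\Omega^1$ and $\mathbb F$ the right-continuous augmentation of $(\mathcal F^0_t\otimes\mathcal F^1_t)_{t\ge0}$. For an $\mathcal{F}^0_0$-measurable random probability measure $m_0$ whose law belongs to $\mathcal{P}_2(\mathcal{P}_2(\mathbb{R}^d))$, and $X_0$ on $\Omega$ with $\mathcal{L}(X_0|\mathcal{F}^0_0)=m_0$ a.s., the process $(m_t)_{t\ge0}$ is $m_t=\mathcal{L}(X_t|\mathcal{F}^0_t)$, where $X$ solves $\mathrm{d}X_t=-\nabla V(X_t)\,\mathrm{d}t-\nabla W*m_t(X_t)\,\mathrm{d}t+\sigma_0\,\mathrm{d}B^0_t$ with initial value $X_0$. Equivalently, $(m_t)$ is the weak solution of $$\mathrm{d}_tm_t=\nabla\cdot\Big(\tfrac{\sigma_0^2}{2}\nabla m_t+m_t\big(\nabla V+\alpha(\cdot-\mu_1(m_t))\big)\Big)\mathrm{d}t-\sigma_0\nabla m_t\cdot\mathrm{d}B^0_t,\qquad\mu_1(m)=\int_{\mathbb{R}^d}x\,m(\mathrm{d}x).$$ $\mathcal{P}_2(\mathbb{R}^d)$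 is the set of Borel probability measures with finite second moment, with the $2$-Wasserstein distance $\mathrm{d}_2^{\mathbb{R}^d}$, and $\mathcal{P}_2(\mathcal{P}_2(\mathbb{R}^d))$ is the set of Borel probability measures on this metric space with finite second moment. Invariant measure: $\bar P\in\mathcal{P}_2(\mathcal{P}_2(\mathbb{R}^d))$ is an invariant measure for $(m_t)_{t\ge0}$ if, when $m_0$ has law $\bar P$, one has $\mathbb{E}_{\mathbb{P}^0}[\phi(m_t)]=\int\phi(m)\,\bar P(\mathrm{d}m)$ for all $t>0$ and all continuous bounded $\phi:\mathcal{P}_2(\mathbb{R}^d)\to\mathbb{R}$. *)

(* Defs.v *)
From HB Require Import structures.
From mathcomp Require Import all_boot all_order all_algebra.
From mathcomp Require Import all_classical all_reals all_analysis.
From mathcomp Require Import measurable_realfun.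

Set Implicit Arguments.
Unset Strict Implicit.
Unset Printing Implicit Defensive.

Import Order.TTheory GRing.Theory Num.Theory.
Import numFieldNormedType.Exports.

Local Open Scope classical_set_scope.
Local Open Scope ring_scope.

(* Borel sigma-algebra of R^n *)
HB.instance Definition _ (R : realType) (n : nat) :=
  @isMeasurable.Build (sigma_display (@open 'rV[R]_n)) 'rV[R]_n
    <<s (@open 'rV[R]_n) >> (@sigma_algebra0 _ setT _)
    (@sigma_algebraC _ _) (@sigma_algebra_bigcup _ setT _).

Section lebesgue_rV.
Context {R : realType}.

Lemma open_measurable_rV n (U : set 'rV[R]_n) : open U -> measurable U.
Proof. exact: sub_sigma_algebra. Qed.

Lemma measurable_coord n (i : 'I_n) :
  measurable_fun [set: 'rV[R]_n] (fun v : 'rV[R]_n => v 0 i).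
Proof.
apply: (measurability _ (RGenOInfty.measurableE R)) => _ [_ [a ->] <-].
rewrite setTI; apply: open_measurable_rV.
apply: open_comp => [v _|]; first exact: coord_continuous.
exact: interval_open.
Qed.

Lemma measurable_fun_rV d (T : measurableType d) n (f : T -> 'rV[R]_n) :
  (forall i, measurable_fun setT (fun t => f t 0 i)) -> measurable_fun setT f.
Proof.
move=> mf.
apply: (@measurability _ _ _ _ setT f (@open 'rV[R]_n)) => // _ [U oU <-].
rewrite setTI.
pose Bx (p : 'rV[rat]_n * nat) : set 'rV[R]_n :=
  [set y | forall i, ball (ratr (p.1 0 i) : R) p.2.+1%:R^-1 (y 0 i)].
have -> : U = \bigcup_(p in [set p | Bx p `<=` U]) Bx p.
  rewrite eqEsubset; split => [x Ux|x [p pU]]; last exact: pU.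
  have /nbhs_ballP [e /= e0 eU] : nbhs x U by exact: open_nbhs_nbhs.
  pose k := Num.truncn (2 / e).
  have ke : k.+1%:R^-1 < e / 2.
    rewrite -[ltRHS]invrK ltf_pV2 ?posrE ?invr_gt0 ?divr_gt0// invf_div.
    exact: truncnS_gt.
  have /choice [q qP] : forall i : 'I_n, exists q : rat,
      ball (x 0 i) k.+1%:R^-1 (ratr q : R).
    move=> i; have k0 : 0 < k.+1%:R^-1 :> R by rewrite invr_gt0 ltr0n.
    have [y [/= xq [q _ qE]]] := @dense_rat R (ball (x 0 i) k.+1%:R^-1)
      (ex_intro _ (x 0 i) (ballxx _ k0)) (ball_open _ _).
    by exists q; rewrite qE.
  exists (\row_i q i, k) => /=.
    move=> y yB; apply: eU; split => // i j; rewrite (ord1 i).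
    have := yB j; rewrite /= mxE => yj.
    apply: le_ball; last exact: ball_triangle (qP j) yj.
    by rewrite [leRHS]splitr lerD// ltW.
  by move=> i; rewrite /= mxE; apply: ball_sym; exact: qP.
rewrite preimage_bigcup bigcup_mkcond.
apply: countable_bigcupT_measurable => // p; case: ifPn => // _.
rewrite (_ : _ @^-1` _ =
  \bigcap_(i in [set: 'I_n]) (fun t => f t 0 i) @^-1` ball (ratr (p.1 0 i) : R) p.2.+1%:R^-1).
  apply: fin_bigcap_measurable => // i _.
  rewrite -[X in measurable X]setTI; apply: mf => //.
  by apply: open_measurable; exact: ball_open.
by rewrite eqEsubset; split=> t /= H; [move=> i _|move=> i]; exact: H.
Qed.

Definition rV_cons n (p : R * 'rV[R]_n) : 'rV[R]_n.+1 :=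
  \row_i (if unlift ord0 i is Some j then p.2 0 j else p.1).

Definition rV_uncons n (v : 'rV[R]_n.+1) : R * 'rV[R]_n :=
  (v 0 ord0, \row_j v 0 (lift ord0 j)).

Lemma rV_consK n : cancel (@rV_cons n) (@rV_uncons n).
Proof.
move=> [x v]; rewrite /rV_uncons mxE unlift_none; congr pair.
by apply/rowP => j; rewrite !mxE liftK.
Qed.

Lemma measurable_rV_cons n : measurable_fun setT (@rV_cons n).
Proof.
apply: measurable_fun_rV => i; rewrite /rV_cons.
under eq_fun do rewrite mxE.
case: unliftP => [j _|_]; last exact: measurable_fst.
by apply: (measurableT_comp (measurable_coord j)); exact: measurable_snd.
Qed.

HB.instance Definition _ n :=
  isMeasurableFun.Build _ _ _ _ (@rV_cons n) (@measurable_rV_cons n).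

Lemma measurable_rV_uncons n : measurable_fun setT (@rV_uncons n).
Proof.
apply: measurable_fun_pair; first exact: measurable_coord.
apply: measurable_fun_rV => i; under eq_fun do rewrite mxE.
exact: measurable_coord.
Qed.

Section lebesgue_cons.
Context n (mu : {sigma_finite_measure set 'rV[R]_n -> \bar R}).

Definition lebesgue_cons : set 'rV[R]_n.+1 -> \bar R :=
  pushforward (@lebesgue_measure R \x mu)%E (@rV_cons n).

Let lebesgue_cons0 : lebesgue_cons set0 = 0%E.
Proof. rewrite /lebesgue_cons; apply: measure0; exact: measurable_rV_cons. Qed.

Let lebesgue_cons_ge0 A : (0 <= lebesgue_cons A)%E.
Proof. rewrite /lebesgue_cons; apply: measure_ge0; exact: measurable_rV_cons. Qed.

Let lebesgue_cons_sigma_additive : semi_sigma_additive lebesgue_cons.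
Proof. rewrite /lebesgue_cons; apply: measure_semi_sigma_additive; exact: measurable_rV_cons. Qed.

HB.instance Definition _ := isMeasure.Build _ _ _ lebesgue_cons
  lebesgue_cons0 lebesgue_cons_ge0 lebesgue_cons_sigma_additive.

Let lebesgue_cons_sigma_finite : sigma_finite setT lebesgue_cons.
Proof.
have /sigma_finiteP[F [FT ndF Foo]] := sigma_finiteT (@lebesgue_measure R).
have /sigma_finiteP[G [GT ndG Goo]] := sigma_finiteT mu.
exists (fun k => @rV_uncons n @^-1` (F k `*` G k)).
  rewrite -preimage_bigcup -(@preimage_setT _ _ (@rV_uncons n)).
  congr (_ @^-1` _); rewrite predeqE => -[x v]; split=> // _.
  have [i _ Fi] : (\bigcup_i F i) x by rewrite -FT.
  have [j _ Gj] : (\bigcup_i G i) v by rewrite -GT.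
  exists (maxn i j) => //; split => /=.
  - by move: x Fi; exact/subsetPset/ndF/leq_maxl.
  - by move: v Gj; exact/subsetPset/ndG/leq_maxr.
move=> k; have [mF Fk] := Foo k; have [mG Gk] := Goo k.
split; first by rewrite -[X in measurable X]setTI;
  apply: measurable_rV_uncons => //; exact: measurableX.
rewrite /lebesgue_cons /pushforward -comp_preimage.
rewrite (_ : _ \o _ = id); last by apply/funext => p /=; rewrite rV_consK.
by rewrite product_measure1E// lte_mul_pinfty// ge0_fin_numE.
Qed.

HB.instance Definition _ :=
  Measure_isSigmaFinite.Build _ _ _ lebesgue_cons lebesgue_cons_sigma_finite.

End lebesgue_cons.

(* R^0 is a point, and lambda_{n+1} is the product of the Lebesgue measure of
   the line (first coordinate) and lambda_n (remaining coordinates) *)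
Fixpoint lebesgue_rV n : {sigma_finite_measure set 'rV[R]_n -> \bar R} :=
  if n is n'.+1 then lebesgue_cons (lebesgue_rV n')
  else dirac (0 : 'rV[R]_0).

End lebesgue_rV.

Section euclidean.
Context {R : realType} {d : nat}.
Implicit Types (x y : 'rV[R]_d) (f : 'rV[R]_d -> R).

Definition dotv x y : R := \sum_i x 0 i * y 0 i.

(* the library's norm on 'rV[R]_d is the sup norm; it induces the same topology
   and the same notion of differentiability *)
Definition enorm x : R := Num.sqrt (dotv x x).

Definition grad f x : 'rV[R]_d := \row_i 'D_(delta_mx 0 i) f x.

Lemma measurable_enorm : measurable_fun setT enorm.
Proof.
apply: (measurableT_comp (continuous_measurable_fun (@sqrt_continuous R))).
apply: measurable_sum => i.
by apply: measurable_funM; exact: measurable_coord.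
Qed.

End euclidean.

Section wasserstein.
Context (R : realType) (d : nat).
Local Notation E := 'rV[R]_d.

Record P2 := MkP2 {
  P2_prob :> probability E R ;
  P2_moment : (\int[P2_prob]_x (enorm x ^+ 2)%:E < +oo)%E }.

Definition coupling (m n : probability E R) : set (probability (E * E)%type R) :=
  [set pi | forall A : set E, measurable A ->
    pi (A `*` setT) = m A /\ pi (setT `*` A) = n A].

Definition W2 (m n : P2) : R :=
  Num.sqrt (fine (ereal_inf
    [set (\int[pi]_z (enorm (z.1 - z.2) ^+ 2)%:E)%E | pi in coupling m n])).

Fact dirac_moment (a : E) :
  (\int[dirac a]_x (enorm x ^+ 2)%:E < +oo)%E.
Proof.
rewrite integral_dirac//; first by rewrite diracT mul1e ltry.
by apply/measurable_EFinP/measurable_funX; exact: measurable_enorm.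
Qed.

Definition diracP2 (a : E) : P2 := @MkP2 (dirac a) (dirac_moment a).

(* Two elements of P2 that agree on Borel sets but differ, as functions, on
   other sets are at W2-distance 0; they are not separated by the topology and
   the sigma-algebra below. *)
HB.instance Definition _ := gen_eqMixin P2.
HB.instance Definition _ := gen_choiceMixin P2.
HB.instance Definition _ := isPointed.Build P2 (diracP2 0).

Definition W2_open : set (set P2) :=
  [set U | forall m, U m ->
    exists2 e : R, 0 < e & forall n, W2 m n < e -> U n].

Let W2_openT : W2_open setT.
Proof. by move=> m _; exists 1. Qed.

Let W2_openI : setI_closed W2_open.
Proof.
move=> U U' oU oU' m [/oU[e e0 eU] /oU'[e' e'0 eU']].
exists (Num.min e e'); first by rewrite lt_min e0.
by move=> n; rewrite lt_min => /andP[/eU Un /eU'].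
Qed.

Let W2_open_bigU (I : Type) (f : I -> set P2) :
  (forall i, W2_open (f i)) -> W2_open (\bigcup_i f i).
Proof.
move=> of_ m [i _ /of_[e e0 ef]].
by exists e => // n /ef fn; exists i.
Qed.

HB.instance Definition _ :=
  isOpenTopological.Build P2 W2_openT W2_openI W2_open_bigU.

(* Borel sigma-algebra of the W2-topology *)
HB.instance Definition _ :=
  @isMeasurable.Build (sigma_display (@open P2)) P2
    <<s (@open P2) >> (@sigma_algebra0 _ setT _)
    (@sigma_algebraC _ _) (@sigma_algebra_bigcup _ setT _).

Definition P2P2 (P : probability P2 R) : Prop :=
  (\int[P]_m (W2 m (diracP2 0) ^+ 2)%:E < +oo)%E.

End wasserstein.

Section common_noise.
Context {R : realType} {d : nat}.
Local Notation E := 'rV[R]_d.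
Context {d0 d1 : measure_display} {T0 : measurableType d0}
  {T1 : measurableType d1} (P0 : probability T0 R) (P1 : probability T1 R).

Definition measurable_wrt {dU} {T : Type} {U : measurableType dU}
    (G : set (set T)) (f : T -> U) : Prop :=
  forall A, measurable A -> G (f @^-1` A).

(* time is [0, +oo[; only the values at t >= 0 matter *)
Definition filtration {dT} {T : measurableType dT} (F : R -> set (set T)) :=
  (forall t, 0 <= t -> sigma_algebra setT (F t) /\ F t `<=` measurable) /\
  (forall s t, 0 <= s -> s <= t -> F s `<=` F t).

Record brownian (F0 : R -> set (set T0)) (B : R -> T0 -> E) : Prop := {
  brownian_adapted : forall t, 0 <= t -> measurable_wrt (F0 t) (B t) ;
  brownian0 : {ae P0, forall w, B 0 w = 0} ;
  brownian_cont :
    {ae P0, forall w, {within `[0, +oo[, continuous (fun t => B t w)}} ;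
  (* given F0 s, the coordinates of B t - B s are independent N(0, t - s) *)
  brownian_incr : forall s t, 0 <= s -> s < t ->
    forall (G : set T0) (A : 'I_d -> set R), F0 s G ->
      (forall i, measurable (A i)) ->
      P0 (G `&` [set w | forall i, A i ((B t w - B s w) 0 i)]) =
      (P0 G * \prod_i normal_prob 0 (Num.sqrt (t - s)) (A i))%E }.

Definition product_filtration (F0 : R -> set (set T0)) (F1 : R -> set (set T1))
    (t : R) : set (set (T0 * T1)) :=
  [set A `*` B | A in F0 t & B in F1 t].

(* right-continuous augmentation of F0 t (x) F1 t *)
Definition aug_filtration (F0 : R -> set (set T0)) (F1 : R -> set (set T1))
    (t : R) : set (set (T0 * T1)) :=
  \bigcap_(s in [set s | t < s])
    <<s product_filtration F0 F1 s `|` (P0 \x P1)%E.-negligible >>.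

(* m is a version of the conditional law of Y given the sub-sigma-algebra G of
   T0, identified with the sets A `*` setT, A in G. The random variable Y is
   only measurable for the completion, on which the completed product
   probability is the outer measure. *)
Definition cond_law (G : set (set T0)) (Y : T0 * T1 -> E) (m : T0 -> P2 R d) :=
  measurable_wrt G m /\
  forall A (B : set E), G A -> measurable B ->
    ((P0 \x P1)%E^*)%mu ((A `*` setT) `&` Y @^-1` B) =
    (\int[P0]_(w in A) m w B)%E.

Definition grad_conv (W : E -> R) (m : P2 R d) (x : E) : E :=
  \row_i Rintegral m setT (fun y : E => grad W (x - y) 0 i).

Definition drift (V W : E -> R) (m : P2 R d) (x : E) : E :=
  - grad V x - grad_conv W m x.

Record solution (F0 : R -> set (set T0)) (F1 : R -> set (set T1))
    (B : R -> T0 -> E) (V W : E -> R) (sigma0 : R)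
    (X : R -> T0 * T1 -> E) (m : R -> T0 -> P2 R d) : Prop := {
  solution_adapted :
    forall t, 0 <= t -> measurable_wrt (aug_filtration F0 F1 t) (X t) ;
  solution_cont : {ae (P0 \x P1)%E, forall w,
    {within `[0, +oo[, continuous (fun t => X t w)}} ;
  solution_law : forall t, 0 <= t -> cond_law (F0 t) (X t) (m t) ;
  solution_law_cont :
    {ae P0, forall w, {within `[0, +oo[, continuous (fun t => m t w)}} ;
  (* the noise is additive, so that the stochastic integral is sigma0 *: B t *)
  solution_sde : {ae (P0 \x P1)%E, forall w, forall t, 0 <= t -> forall i,
    let b s := drift V W (m s w.1) (X s w) 0 i in
    lebesgue_measure.-integrable `[0, t] (EFin \o b) /\
    X t w 0 i = X 0 w 0 i + Rintegral lebesgue_measure `[0, t] b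
                + sigma0 * B t w.1 0 i } }.

End common_noise.

Definition invariant_measure {R : realType} {d : nat} (V W : 'rV[R]_d -> R)
    (sigma0 : R) (Pbar : probability (P2 R d) R) : Prop :=
  P2P2 Pbar /\
  forall (d0 d1 : measure_display) (T0 : measurableType d0)
    (T1 : measurableType d1) (P0 : probability T0 R) (P1 : probability T1 R)
    (F0 : R -> set (set T0)) (F1 : R -> set (set T1)) (B : R -> T0 -> 'rV[R]_d)
    (X : R -> T0 * T1 -> 'rV[R]_d) (m : R -> T0 -> P2 R d),
    filtration F0 -> filtration F1 -> brownian P0 F0 B ->
    solution P0 P1 F0 F1 B V W sigma0 X m ->
    (forall A, measurable A -> P0 (m 0 @^-1` A) = Pbar A) ->
    forall (t : R) (phi : P2 R d -> R), 0 < t -> continuous phi ->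
      (exists M : R, forall n, `|phi n| <= M) ->
      ('E_P0[phi \o m t] = \int[Pbar]_n (phi n)%:E)%E.

(* probability measure with Lebesgue density proportional to
   exp (- 2 V / sigma0 ^ 2); c is the inverse of the normalising constant *)
Definition gibbs {R : realType} {d : nat} (V : 'rV[R]_d -> R) (sigma0 : R)
    (mu0 : probability 'rV[R]_d R) : Prop :=
  exists2 c : R, 0 < c & forall A, measurable A ->
    mu0 A = (\int[lebesgue_rV d]_(x in A)
      (c * expR (- (2 * V x / sigma0 ^+ 2)))%:E)%E.

(* equality on Borel sets only, so that this is a Borel set of P2 *)
Definition dirac_measures {R : realType} {d : nat} : set (P2 R d) :=
  [set m | exists a, forall A, measurable A -> m A = \d_a A].

(* Main.v *)
Require Import Defs.
From HB Require Import structures.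
From mathcomp Require Import all_boot all_order all_algebra.
From mathcomp Require Import all_classical all_reals all_analysis.
From mathcomp Require Import measurable_realfun ring lra.

Set Implicit Arguments.
Unset Strict Implicit.
Unset Printing Implicit Defensive.

Import Order.TTheory GRing.Theory Num.Theory.
Import numFieldNormedType.Exports.

Local Open Scope classical_set_scope.
Local Open Scope ring_scope.

(* Proof idea. Since [m 0] is almost surely a Dirac mass, X_0 is a function of
   the common noise, and X_t is the limit of an Euler scheme driven by X_0,
   t |-> m_t and B only; hence X_t = Z_t with Z_t measurable for F0_t, and
   m_t = delta_{Z_t}. The mean-field force alpha (X_t - mean m_t) then vanishes,
   so that Z solves dZ = - grad V(Z) dt + sigma0 dB with initial law mu0, and it
   remains to see that mu0 is invariant for this Langevin equation. Let rho be
   the density of mu0 and q the transition density of one Euler step of length h.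
   Then rho(y) q(y, x) = rho(x) q(x, y) exp (- D(x, y)), where D is the error of
   the trapezoid rule for V(y) - V(x) plus terms of the same order. From
   exp (- D) >= 1 - |D|, one step raises the integral of a test function with
   values in [0, 1] by at most E|D|. As grad V is Lipschitz and differentiable,
   E|D| = o(h) by dominated convergence, and the errors of the t / h steps add up
   to o(1). This gives one inequality for continuous test functions psi, and the
   reverse one follows by taking 1 - psi. *)

(** * Lebesgue and Gaussian integrals on R^n *)

(** The conclusion concerns every solution, on every space, with [X t] measurable only for a
    completed filtration. As the noise is additive, the equation is an integral equation along each
    path, so one deterministic theorem on the Euler scheme is used twice: with s |-> alpha mean (m
    s) as a given forcing, to show that X_t depends on the common noise alone, and without forcing,
    to find its law. In between, the interaction must vanish at all times at once, while conditional
    laws are known up to a null set for each time; rational times and continuity of the paths bridge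
    this gap. Likewise, being a Dirac mass is tested on half-spaces with rational thresholds, so
    that countably many almost sure statements suffice. The second derivatives of V need not be
    continuous. The expansion of the trapezoid rule is therefore made at one point at a time,
    without uniformity, and the Lipschitz constant supplies the domination. Propagating an
    inequality instead of an approximate identity has a reason: the lower bound 1 - |D| of exp (- D)
    involves D itself and not its exponential, so that second moments of mu0 and of the noise are
    enough. *)

Section density.
Local Open Scope ereal_scope.
Context d (T : measurableType d) (R : realType).
Variables (mu : {measure set T -> \bar R}) (f : T -> R).
Hypotheses (mf : measurable_fun setT f) (f0 : forall x, (0 <= f x)%R).

(** The two proofs are arguments so that the measure structure can be attached to the term
    itself. *)
Definition density_measure of measurable_fun setT f & (forall x, 0 <= f x)%R :=
  fun A : set T => \int[mu]_(x in A) (f x)%:E.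

Local Notation nu := (density_measure mf f0).

Let nu0 : nu set0 = 0.
Proof. exact: integral_set0. Qed.

Let nu_ge0 A : 0 <= nu A.
Proof. by apply: integral_ge0 => x _; rewrite lee_fin. Qed.

Let nu_sigma_additive : semi_sigma_additive nu.
Proof.
move=> F mF tF mUF; rewrite /density_measure ge0_integral_bigcup//; last 2 first.
- exact/measurable_funTS/measurable_EFinP.
- by move=> x _; rewrite lee_fin.
by apply: is_cvg_ereal_nneg_natsum_cond => n _ _; exact: nu_ge0.
Qed.

HB.instance Definition _ := isMeasure.Build _ _ _ nu nu0 nu_ge0 nu_sigma_additive.

Import HBNNSimple.

(** By monotone convergence along simple functions on both sides, it is enough to treat indicators,
    where the claim is the definition of the density. *)
Lemma ge0_integral_density (g : T -> \bar R) : measurable_fun setT g ->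
  (forall x, 0 <= g x) -> \int[nu]_x g x = \int[mu]_x (g x * (f x)%:E).
Proof.
move=> mg g0.
pose g_ := nnsfun_approx measurableT mg.
have gcvg x : (EFin \o g_^~ x) @ \oo --> g x by exact: cvg_nnsfun_approx.
have mgf n : measurable_fun setT (fun x => (g_ n x)%:E * (f x)%:E).
  by apply/measurable_EFinP/measurable_funM.
transitivity (limn (fun n => \int[nu]_x (g_ n x)%:E)).
  rewrite -monotone_convergence//.
  - by apply: eq_integral => x _; apply/esym/cvg_lim => //; exact: gcvg.
  - by move=> n; exact/measurable_EFinP/measurable_funP.
  - by move=> n x _; rewrite lee_fin.
  - by move=> x _ m n mn; rewrite lee_fin; exact/lefP/nd_nnsfun_approx.
transitivity (limn (fun n => \int[mu]_x ((g_ n x)%:E * (f x)%:E))); last first.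
  rewrite -monotone_convergence//.
  - apply: eq_integral => x _; apply/cvg_lim => //.
    by apply: cvgeZr => //; exact: gcvg.
  - by move=> n x _; rewrite lee_fin mulr_ge0.
  - move=> x _ m n mn; rewrite lee_fin ler_wpM2r//.
    exact/lefP/nd_nnsfun_approx.
congr (limn _); apply/funext => n.
transitivity (\sum_(k \in range (g_ n))
    \int[nu]_x (k * \1_(g_ n @^-1` [set k]) x)%:E).
  under eq_integral do rewrite fimfunE -fsumEFin//.
  rewrite ge0_integral_fsum//.
  - by move=> y; exact/measurable_EFinP/measurable_funM.
  - by move=> y x _; rewrite nnfun_muleindic_ge0.
transitivity (\sum_(k \in range (g_ n))
    \int[mu]_x (k * \1_(g_ n @^-1` [set k]) x * f x)%:E); last first.
  rewrite -ge0_integral_fsum//.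
  - apply: eq_integral => x _; rewrite fsumEFin// -EFinM; congr EFin.
    by rewrite [in RHS]fimfunE mulr_fsuml.
  - by move=> y; apply/measurable_EFinP; do 2! apply: measurable_funM => //.
  - by move=> y x _; rewrite EFinM mule_ge0// ?nnfun_muleindic_ge0 ?lee_fin.
apply: eq_fsbigr => r _; rewrite integralZl_indic_nnsfun// integral_indic//=.
have [r0|r0] := ltP r 0%R.
  rewrite preimage_nnfun0// setIT measure0 mule0.
  by under eq_integral do rewrite indic0 mulr0 mul0r; rewrite integral0.
under eq_integral do rewrite -mulrA EFinM.
rewrite ge0_integralZl//; last 2 first.
- exact/measurable_EFinP/measurable_funM.
- by move=> x _; rewrite lee_fin mulr_ge0.
congr *%E; rewrite /density_measure setIT [LHS]integral_mkcond.
apply: eq_integral => x _.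
by rewrite /patch indicE; case: ifPn => xr; rewrite ?mul1r ?mul0r.
Qed.

End density.

Section lebesgue_affine.
Context {R : realType}.
Local Notation mu := (@lebesgue_measure R).

Lemma measurable_affine (s b : R) : measurable_fun setT (fun x : R => s * x + b).
Proof. by apply: measurable_funD => //; apply: measurable_funM. Qed.

(** The image of Lebesgue measure under x |-> s x + b, multiplied by s, gives every interval its
    length, and this characterises Lebesgue measure. *)
Lemma ge0_integral_affine (s b : R) (f : R -> \bar R) : 0 < s ->
  measurable_fun setT f -> (forall x, 0 <= f x)%E ->
  (s%:E * \int[mu]_x f (s * x + b)%R = \int[mu]_x f x)%E.
Proof.
move=> s0 mf f0; pose phi (x : measurableTypeR R) : measurableTypeR R := s * x + b.
have mphi : measurable_fun setT phi by exact: measurable_affine.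
pose P : {measure set (measurableTypeR R) -> \bar R} :=
  measure_function_pushforward__canonical__measure_function_Measure mu mphi.
pose nu := mscale (NngNum (ltW s0)) P.
rewrite [RHS](eq_measure_integral nu) => [|A mA _].
  rewrite ge0_integral_mscale//=.
  rewrite (ge0_integral_pushforward mphi)//.
apply: lebesgue_measure_unique => // _ [[u v] _ <-].
transitivity (s%:E * mu (phi @^-1` `]u, v]%classic))%E; last by [].
rewrite (_ : _ @^-1` _ = `](u - b) / s, (v - b) / s]%classic); last first.
  apply/seteqP; split => x /=; rewrite !in_itv/= /phi.
    by rewrite ltr_pdivrMr// ler_pdivlMr// [x * s]mulrC ltrBlDr lerBrDr.
  by rewrite ltr_pdivrMr// ler_pdivlMr// [x * s]mulrC ltrBlDr lerBrDr.
rewrite !lebesgue_measure_itv/= !lte_fin ltr_pM2r ?invr_gt0// ltrD2r.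
case: ifP => _; last by rewrite mule0.
rewrite -!EFinB -EFinM; congr EFin; rewrite -mulrBl mulrCA divff ?gt_eqF// mulr1.
by rewrite opprB addrA subrK.
Qed.

End lebesgue_affine.

Section lebesgue_rV_integral.
Context {R : realType}.
Local Notation mu := (@lebesgue_measure R).

Lemma measurable_scale_rV n (s : R) (b : 'rV[R]_n) :
  measurable_fun setT (fun v : 'rV[R]_n => s *: v + b).
Proof.
apply: measurable_fun_rV => i.
under eq_fun do rewrite !mxE.
by apply: (measurableT_comp (measurable_affine _ _)); exact: measurable_coord.
Qed.

Lemma integral_lebesgue_rV0 (f : 'rV[R]_0 -> \bar R) : measurable_fun setT f ->
  (\int[lebesgue_rV 0]_v f v = f 0%R)%E.
Proof. by move=> mf; rewrite /= integral_dirac// diracT mul1e. Qed.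

Lemma ge0_integral_lebesgue_rVS n (f : 'rV[R]_n.+1 -> \bar R) :
  measurable_fun setT f -> (forall v, 0 <= f v)%E ->
  (\int[lebesgue_rV n.+1]_v f v =
   \int[mu]_x \int[lebesgue_rV n]_v f (rV_cons (x, v)))%E.
Proof.
move=> mf f0.
have mc : measurable_fun setT
    (@rV_cons R n : measurableTypeR R * 'rV[R]_n -> 'rV[R]_n.+1).
  exact: measurable_rV_cons.
transitivity (\int[mu \x lebesgue_rV n]_p f (rV_cons p))%E.
  have := ge0_integral_pushforward mc (mu \x lebesgue_rV n)%E measurableT mf
    (fun v _ => f0 v).
  by rewrite preimage_setT.
rewrite fubini_tonelli1//.
by apply: measurableT_comp => //; exact: measurable_rV_cons.
Qed.

Lemma measurable_lebesgue_rVS n (f : 'rV[R]_n.+1 -> \bar R) :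
  measurable_fun setT f -> (forall v, 0 <= f v)%E ->
  measurable_fun setT (fun x => \int[lebesgue_rV n]_v f (rV_cons (x, v)))%E.
Proof.
move=> mf f0.
apply: (measurable_fun_fubini_tonelli_F (f \o @rV_cons R n)) => //=.
by apply: measurableT_comp => //; exact: measurable_rV_cons.
Qed.

(** Change of variables with Jacobian s^n. The recursive form of [lebesgue_rV] allows one coordinate
    to be treated at a time. *)
Lemma ge0_integral_scale_rV n (s : R) (b : 'rV[R]_n) (f : 'rV[R]_n -> \bar R) :
  0 < s -> measurable_fun setT f -> (forall v, 0 <= f v)%E ->
  ((s ^+ n)%:E * \int[lebesgue_rV n]_v f (s *: v + b)%R =
   \int[lebesgue_rV n]_v f v)%E.
Proof.
move=> s0; elim: n b f => [|n IH] b f mf f0.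
  rewrite !integral_lebesgue_rV0//.
    by rewrite expr0 mul1e; congr f; apply/rowP; case.
  by apply: (measurableT_comp mf); exact: measurable_scale_rV.
have mfs : measurable_fun setT (fun v : 'rV[R]_n.+1 => f (s *: v + b)).
  by apply: (measurableT_comp mf); exact: measurable_scale_rV.
rewrite !ge0_integral_lebesgue_rVS// exprSr mulrC EFinM -muleA.
rewrite -[RHS](ge0_integral_affine (b 0 ord0) s0)//; last 2 first.
- exact: (measurable_lebesgue_rVS mf f0).
- by move=> x; apply: integral_ge0.
congr *%E.
rewrite -ge0_integralZl//; last 3 first.
- exact: (measurable_lebesgue_rVS mfs (fun v => f0 _)).
- by move=> x _; apply: integral_ge0.
- by rewrite lee_fin exprn_ge0// ltW.
apply: eq_integral => x _.
pose b' : 'rV[R]_n := \row_j b 0 (lift ord0 j).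
rewrite -[RHS](IH b')//; last first.
  apply: (measurableT_comp mf); apply: (measurableT_comp (@measurable_rV_cons R n)).
  exact: measurable_pair1.
congr *%E; apply: eq_integral => v _; congr f.
apply/rowP => i; rewrite !mxE/=.
by case: unliftP => [j ->|->]; rewrite ?mxE.
Qed.

Lemma ge0_integral_prod_rV n (f : 'I_n -> R -> R) :
  (forall i, measurable_fun setT (f i)) -> (forall i x, 0 <= f i x) ->
  (\int[lebesgue_rV n]_v (\prod_i f i (v 0 i))%:E =
   \prod_i \int[mu]_x (f i x)%:E)%E.
Proof.
elim: n f => [|n IH] f mf f0.
  rewrite integral_lebesgue_rV0.
    by rewrite !big_ord0.
  by under eq_fun do rewrite big_ord0; exact: measurable_cst.
have mp m (g : 'I_m -> R -> R) : (forall i, measurable_fun setT (g i)) ->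
  measurable_fun setT (fun v : 'rV[R]_m => (\prod_i g i (v 0 i))%:E).
  move=> mg; apply/measurable_EFinP; apply: measurable_prod => i _.
  by apply: (measurableT_comp (mg i)); exact: measurable_coord.
rewrite ge0_integral_lebesgue_rVS//; last 2 first.
- exact: mp.
- by move=> v; rewrite lee_fin prodr_ge0.
pose f' i := f (lift ord0 i).
transitivity (\int[mu]_x ((f ord0 x)%:E * \prod_i \int[mu]_x (f' i x)%:E))%E.
  apply: eq_integral => x _; rewrite -IH; [|by move=> i; exact: mf|by move=> i; exact: f0].
  rewrite -ge0_integralZl//; last 3 first.
  - by apply: (mp n f') => i; exact: mf.
  - by move=> v _; rewrite lee_fin prodr_ge0// => i _; exact: f0.
  - by rewrite lee_fin.
  apply: eq_integral => v _; rewrite big_ord_recl /= mxE unlift_none EFinM.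
  by congr (_ * _%:E)%E; apply: eq_bigr => i _; rewrite mxE liftK.
rewrite [LHS]ge0_integralZr//; first by rewrite big_ord_recl.
- by apply/measurable_EFinP; exact: (mf ord0).
- by move=> x _; rewrite lee_fin.
- by apply: prode_ge0 => i _; apply: integral_ge0 => x _; rewrite lee_fin; exact: f0.
Qed.

End lebesgue_rV_integral.

Definition to_mfun d d' (T : measurableType d) (T' : measurableType d')
    (f : T -> T') (mf : measurable_fun setT f) : {mfun T >-> T'} :=
  HB.pack f (isMeasurableFun.Build _ _ _ _ f mf).

Section boxes.
Context {R : realType} {n : nat}.
Local Notation E := 'rV[R]_n.

Definition box (A : 'I_n -> set R) : set E := [set v | forall i, A i (v 0 i)].

Definition boxes : set (set E) :=
  [set B | exists2 A, (forall i, measurable (A i)) & B = box A].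

Lemma measurable_box (A : 'I_n -> set R) :
  (forall i, measurable (A i)) -> measurable (box A).
Proof.
move=> mA.
rewrite (_ : box A = \bigcap_(i in [set: 'I_n]) (fun v => v 0 i) @^-1` A i).
  apply: fin_bigcap_measurable => // i _.
  by rewrite -[X in measurable X]setTI; apply: measurable_coord.
by apply/seteqP; split=> v /= H; [move=> i _|move=> i]; exact: H.
Qed.

(** For the inclusion of the Borel sets, the identity is measurable from the sigma-algebra of boxes
    because its coordinates are: a condition on coordinate i is a box with all other sides equal to
    the line. *)
Lemma measurable_rV_boxes : @measurable _ E = <<s boxes >>.
Proof.
apply/seteqP; split; last first.
  apply: smallest_sub; first exact: sigma_algebra_measurable.
  by move=> _ [A mA ->]; exact: measurable_box.
move=> A mA.
pose id' : g_sigma_algebraType boxes -> E := id.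
suff mid : measurable_fun setT id'.
  by have := mid measurableT A mA; rewrite setTI.
apply: measurable_fun_rV => i _ B mB; rewrite setTI.
apply: sub_sigma_algebra; exists (fun j => if j == i then B else setT).
  by move=> j; case: ifP.
apply/seteqP; split => v /= H; last by have := H i; rewrite eqxx.
by move=> j; case: eqP => [->|//].
Qed.

(** Boxes form a pi-system that generates the Borel sets and contains the whole space. The law of a
    Brownian increment is prescribed on boxes only, whence the need for this. *)
Lemma rV_measure_unique (m1 m2 : {measure set E -> \bar R}) :
  (m1 setT < +oo)%E ->
  (forall A, (forall i, measurable (A i)) -> m1 (box A) = m2 (box A)) ->
  forall B, measurable B -> m1 B = m2 B.
Proof.
move=> m1oo m12.
have bT : box (fun _ => setT) = setT by apply/seteqP; split.
apply: (measure_unique boxes (fun=> setT)) => //.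
- exact: measurable_rV_boxes.
- move=> _ _ [A mA ->] [B mB ->]; exists (fun i => A i `&` B i).
    by move=> i; exact: measurableI.
  apply/seteqP; split => v /=; first by move=> [Av Bv] i; split.
  by move=> ABv; split => i; have [] := ABv i.
- by move=> _; exists (fun _ => setT).
- exact: bigcup_const.
- by move=> _ [A mA ->]; exact: m12.
Qed.

End boxes.

(** * The standard Gaussian measure *)

Section gauss.
Context {R : realType}.
Local Notation mu := (@lebesgue_measure R).

Definition gauss_pdf n (z : 'rV[R]_n) : R := \prod_i normal_pdf 0 1 (z 0 i).

Lemma gauss_pdf_ge0 n (z : 'rV[R]_n) : 0 <= gauss_pdf z.
Proof. by apply: prodr_ge0 => i _; exact: normal_pdf_ge0. Qed.

Lemma measurable_gauss_pdf n : measurable_fun setT (@gauss_pdf n).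
Proof.
apply: measurable_prod => i _.
by apply: (measurableT_comp (measurable_normal_pdf _ _)); exact: measurable_coord.
Qed.

Definition gauss n : set 'rV[R]_n -> \bar R :=
  density_measure (lebesgue_rV n) (@measurable_gauss_pdf n) (@gauss_pdf_ge0 n).

HB.instance Definition _ n := Measure.on (@gauss n).

Lemma gauss_setT n : @gauss n setT = 1%E.
Proof.
rewrite /gauss /density_measure /gauss_pdf
  (ge0_integral_prod_rV (f := fun=> normal_pdf 0 1)).
- by rewrite big1// => i _; exact: integral_normal_pdf.
- by move=> i; exact: measurable_normal_pdf.
- by move=> i x; exact: normal_pdf_ge0.
Qed.

HB.instance Definition _ n :=
  Measure_isProbability.Build _ _ _ (@gauss n) (@gauss_setT n).

Lemma normal_pdf_scale (s x : R) : 0 < s ->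
  s * normal_pdf 0 s (s * x) = normal_pdf 0 1 x.
Proof.
move=> s0; rewrite !normal_pdfE ?gt_eqF//.
rewrite /normal_peak /normal_fun !subr0.
rewrite expr1n mul1r mulrA; congr (_ * _).
  rewrite -mulrnAr sqrtrM ?sqr_ge0// sqrtr_sqr gtr0_norm// invfM mulrA.
  by rewrite divff ?gt_eqF// mul1r.
congr expR; rewrite exprMn -[s ^+ 2 *+ 2]mulr_natr invfM; field.
by rewrite gt_eqF.
Qed.

(** Identifies the law of s z, for z standard Gaussian, with that of a Brownian increment over a
    time s^2. *)
Lemma gauss_box n (s : R) (A : 'I_n -> set R) : 0 < s ->
  (forall i, measurable (A i)) ->
  gauss (( *:%R s) @^-1` box A) = (\prod_i normal_prob 0 s (A i))%E.
Proof.
move=> s0 mA; rewrite /gauss /density_measure integral_mkcond.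
transitivity (\int[lebesgue_rV n]_z
    (\prod_i (\1_(A i) (s * z 0 i) * normal_pdf 0 1 (z 0 i)))%:E)%E.
  apply: eq_integral => z _; rewrite big_split/= /patch.
  case: ifPn => zA.
    rewrite big1 ?mul1r// => i _; rewrite indicE mem_set//.
    by move/set_mem : zA => /(_ i); rewrite mxE.
  have : ~ forall i, A i (s * z 0 i).
    move=> H; move/negP : zA; apply; rewrite inE => i; rewrite mxE; exact: H.
  move=> /existsNP[i Ai].
  by rewrite (bigD1 i)//= indicE memNset// !mul0r.
rewrite (ge0_integral_prod_rV (f := fun i x => \1_(A i) (s * x) * normal_pdf 0 1 x)).
- apply: eq_bigr => i _; rewrite /normal_prob [RHS]integral_mkcond.
  rewrite -[RHS](ge0_integral_affine 0 s0); last 2 first.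
  + apply/(measurable_restrictT _ (mA i)); apply: measurable_funTS.
    by apply/measurable_EFinP; exact: measurable_normal_pdf.
  + by move=> x; apply: erestrict_ge0 => y _; rewrite lee_fin normal_pdf_ge0.
  rewrite -ge0_integralZl//; last 3 first.
  + apply: (measurableT_comp _ (measurable_affine s 0)).
    apply/(measurable_restrictT _ (mA i)); apply: measurable_funTS.
    by apply/measurable_EFinP; exact: measurable_normal_pdf.
  + by move=> x _; apply: erestrict_ge0 => y _; rewrite lee_fin normal_pdf_ge0.
  + by rewrite lee_fin ltW.
  apply: eq_integral => x _; rewrite addr0 patchE indicE.
  by case: ifPn => _; rewrite ?mul0r ?mule0// mul1r -EFinM normal_pdf_scale.
- move=> i; apply: measurable_funM; last exact: measurable_normal_pdf.
  rewrite (_ : (fun x => _) = (\1_(A i) : R -> R) \o ( *%R s)) //.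
  by apply: measurableT_comp; [exact: measurable_indic|exact: measurable_funM].
- by move=> i x; rewrite mulr_ge0// normal_pdf_ge0.
Qed.

End gauss.

Section euclid.
Context {R : realType} {d : nat}.
Implicit Types x y z : 'rV[R]_d.

Lemma dotvC x y : dotv x y = dotv y x.
Proof. by apply: eq_bigr => i _; rewrite mulrC. Qed.

Lemma dotvDl x y z : dotv (x + y) z = dotv x z + dotv y z.
Proof. by rewrite -big_split; apply: eq_bigr => i _; rewrite mxE mulrDl. Qed.

Lemma dotvZl (a : R) x y : dotv (a *: x) y = a * dotv x y.
Proof. by rewrite mulr_sumr; apply: eq_bigr => i _; rewrite mxE mulrA. Qed.

Lemma dotvDr x y z : dotv z (x + y) = dotv z x + dotv z y.
Proof. by rewrite dotvC dotvDl !(dotvC z). Qed.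

Lemma dotvZr (a : R) x y : dotv x (a *: y) = a * dotv x y.
Proof. by rewrite dotvC dotvZl (dotvC y). Qed.

Lemma dotvNl x y : dotv (- x) y = - dotv x y.
Proof. by rewrite -scaleN1r dotvZl mulN1r. Qed.

Lemma dotvNr x y : dotv x (- y) = - dotv x y.
Proof. by rewrite dotvC dotvNl dotvC. Qed.

Lemma dotv_ge0 x : 0 <= dotv x x.
Proof. by apply: sumr_ge0 => i _; rewrite -expr2 sqr_ge0. Qed.

Lemma enorm_ge0 x : 0 <= enorm x.
Proof. exact: sqrtr_ge0. Qed.

Lemma sqr_enorm x : enorm x ^+ 2 = dotv x x.
Proof. by rewrite sqr_sqrtr// dotv_ge0. Qed.

Lemma enormZ (a : R) x : enorm (a *: x) = `|a| * enorm x.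
Proof.
by rewrite /enorm dotvZl dotvZr mulrA -expr2 sqrtrM ?sqr_ge0// sqrtr_sqr.
Qed.

Lemma enormN x : enorm (- x) = enorm x.
Proof. by rewrite -scaleN1r enormZ normrN1 mul1r. Qed.

Lemma enorm0 : enorm (0 : 'rV[R]_d) = 0.
Proof. by rewrite -(scale0r (0 : 'rV[R]_d)) enormZ normr0 mul0r. Qed.

Lemma coord_le_enorm x i : `|x 0 i| <= enorm x.
Proof.
rewrite -sqrtr_sqr ler_sqrt ?dotv_ge0// /dotv (bigD1 i)//= -expr2 lerDl.
by apply: sumr_ge0 => j _; rewrite -expr2 sqr_ge0.
Qed.

Lemma enorm_eq0 x : enorm x = 0 -> x = 0.
Proof.
move=> x0; apply/rowP => i; rewrite mxE; apply/eqP.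
by rewrite -normr_le0 -x0 coord_le_enorm.
Qed.

Lemma dotv_sub x y : dotv (x - y) (x - y) = dotv x x - dotv x y *+ 2 + dotv y y.
Proof.
rewrite dotvDl !dotvDr !dotvNl !dotvNr opprK (dotvC y x) mulr2n opprD.
by rewrite !addrA.
Qed.

(** Cauchy-Schwarz, by expanding the squared norm of |y| x - |x| y. *)
Lemma dotv_le_enorm x y : dotv x y <= enorm x * enorm y.
Proof.
have [/enorm_eq0->|x0] := eqVneq (enorm x) 0.
  by rewrite -(scale0r (0 : 'rV_d)) dotvZl mul0r mulr_ge0// enorm_ge0.
have [/enorm_eq0->|y0] := eqVneq (enorm y) 0.
  by rewrite -(scale0r (0 : 'rV_d)) dotvZr mul0r mulr_ge0// enorm_ge0.
have xp : 0 < enorm x by rewrite lt_neqAle eq_sym x0 enorm_ge0.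
have yp : 0 < enorm y by rewrite lt_neqAle eq_sym y0 enorm_ge0.
have := dotv_ge0 (enorm y *: x - enorm x *: y).
rewrite dotv_sub !dotvZl !dotvZr -!sqr_enorm => H.
have xy : 0 < enorm x * enorm y by rewrite mulr_gt0.
rewrite -(ler_pM2l xy); nra.
Qed.

Lemma abs_dotv_le x y : `|dotv x y| <= enorm x * enorm y.
Proof.
rewrite ler_norml dotv_le_enorm andbT lerNl -dotvNl.
by rewrite (le_trans (dotv_le_enorm _ _))// enormN.
Qed.

Lemma sqr_enormD x y : enorm (x + y) ^+ 2 <= 2 * enorm x ^+ 2 + 2 * enorm y ^+ 2.
Proof.
rewrite !sqr_enorm; have := dotv_ge0 (x - y); rewrite dotv_sub.
by rewrite dotvDl !dotvDr (dotvC y x); lra.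
Qed.

Lemma enormD x y : enorm (x + y) <= enorm x + enorm y.
Proof.
rewrite -(@ler_pXn2r _ 2)// ?nnegrE ?enorm_ge0 ?addr_ge0 ?enorm_ge0//.
rewrite sqrrD !sqr_enorm dotvDl !dotvDr (dotvC y x) addrA lerD2r -addrA lerD2l.
by have := dotv_le_enorm x y; lra.
Qed.

Lemma coord_le_norm x i : `|x 0 i| <= `|x|.
Proof.
by rewrite [leRHS]mx_normrE; apply: (le_bigmax _ (fun ij => `|x ij.1 ij.2|) (0, i)).
Qed.

Lemma norm_le_coord x (c : R) : 0 <= c -> (forall i, `|x 0 i| <= c) -> `|x| <= c.
Proof.
move=> c0 xc; rewrite [leLHS]mx_normrE; apply: bigmax_le => // -[i j] _ /=.
by rewrite (ord1 i).
Qed.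

Lemma norm_le_enorm x : `|x| <= enorm x.
Proof. by apply: norm_le_coord (enorm_ge0 x) _ => i; exact: coord_le_enorm. Qed.

Lemma dotv_le_norm x : dotv x x <= d%:R * `|x| ^+ 2.
Proof.
rewrite mulr_natl -[X in _ *+ X]card_ord -sumr_const ler_sum// => i _.
rewrite -expr2 -[leLHS]real_normK ?num_real// ler_pXn2r ?nnegrE//.
exact: coord_le_norm.
Qed.

Lemma enorm_le_norm x : enorm x <= d%:R * `|x|.
Proof.
rewrite -(@ler_pXn2r _ 2)// ?nnegrE ?enorm_ge0 ?mulr_ge0//.
rewrite sqr_enorm (le_trans (dotv_le_norm x))// exprMn ler_wpM2r ?sqr_ge0//.
by rewrite -natrX ler_nat; case: d => // n; rewrite leq_pmulr.
Qed.

End euclid.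

Lemma continuous_measurable_rV (R : realType) n m (f : 'rV[R]_n -> 'rV[R]_m) :
  continuous f -> measurable_fun setT f.
Proof.
move=> cf; apply: (@measurability _ _ _ _ setT f (@open 'rV[R]_m)) => // _ [U oU <-].
by rewrite setTI; apply: open_measurable_rV; apply: open_comp => // x _; exact: cf.
Qed.

Lemma continuous_measurable_rV1 (R : realType) n (f : 'rV[R]_n -> R) :
  continuous f -> measurable_fun setT f.
Proof.
move=> cf; apply: (measurability _ (RGenOInfty.measurableE R)) => _ [_ [a ->] <-].
rewrite setTI; apply: open_measurable_rV.
apply: open_comp => [v _|]; [exact: cf|exact: interval_open].
Qed.

Section gauss_moments.
Context {R : realType}.
Local Notation mu := (@lebesgue_measure R).

Lemma integral_expRNsqr_lty (c : R) : 0 < c ->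
  (\int[mu]_x (expR (- (c * x ^+ 2)))%:E < +oo)%E.
Proof.
(* With this standard deviation the normal density is a multiple of exp (- c x^2), and its integral
   is known. *)
move=> c0; pose s := Num.sqrt (2 * c)^-1.
have c20 : 0 < (2 * c)^-1 by rewrite invr_gt0 mulr_gt0.
have s0 : s != 0 by rewrite gt_eqF// sqrtr_gt0.
under eq_integral => x _.
  rewrite (_ : expR _ = (normal_peak s)^-1 * normal_pdf 0 s x); last first.
    rewrite normal_pdfE// mulrA mulVf ?mul1r ?gt_eqF ?normal_peak_gt0//.
    rewrite /normal_fun subr0 sqr_sqrtr ?ltW//; congr expR.
    by rewrite -[X in _ / X]mulr_natr invfM invrK; field.
  rewrite EFinM.
  over.
rewrite ge0_integralZl//.
- by rewrite integral_normal_pdf mule1 ltry.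
- by apply/measurable_EFinP; exact: measurable_normal_pdf.
- by move=> x _; rewrite lee_fin normal_pdf_ge0.
- by rewrite lee_fin invr_ge0 normal_peak_ge0.
Qed.

Lemma expR_dotv n (c : R) (v : 'rV[R]_n) :
  expR (- (c * dotv v v)) = \prod_i expR (- (c * v 0 i ^+ 2)).
Proof.
rewrite -expR_sum; congr expR; rewrite sumrN mulr_sumr.
by congr (- _); apply: eq_bigr => i _; rewrite expr2.
Qed.

Lemma integral_expRNdotv_lty n (c : R) : 0 < c ->
  (\int[lebesgue_rV n]_v (expR (- (c * dotv v v)))%:E < +oo)%E.
Proof.
move=> c0; under eq_integral do rewrite expR_dotv.
rewrite (ge0_integral_prod_rV (f := fun=> fun x => expR (- (c * x ^+ 2)))).
- rewrite -ge0_fin_numE; last first.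
    by apply: prode_ge0 => i _; apply: integral_ge0 => x _; rewrite lee_fin expR_ge0.
  apply: prode_fin_num => i _; rewrite ge0_fin_numE.
    exact: integral_expRNsqr_lty.
  by apply: integral_ge0 => x _; rewrite lee_fin expR_ge0.
- move=> i; apply: (@measurableT_comp _ _ _ _ _ _ (@expR R)) => //.
  by apply: measurableT_comp => //; apply: measurable_funM => //; exact: exprn_measurable.
- by move=> i x; exact: expR_ge0.
Qed.

Lemma gauss_pdfE n (z : 'rV[R]_n) :
  gauss_pdf z = normal_peak 1 ^+ n * expR (- (2^-1 * dotv z z)).
Proof.
rewrite /gauss_pdf expR_dotv.
transitivity (\prod_(i < n) (normal_peak 1 * expR (- (2^-1 * z 0 i ^+ 2)))).
  apply: eq_bigr => i _; rewrite normal_pdfE ?oner_eq0//; congr (_ * expR _).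
  by rewrite subr0 expr1n; field.
by rewrite big_split/= prodr_const card_ord.
Qed.

Lemma measurable_dotv n : measurable_fun setT (fun z : 'rV[R]_n => dotv z z).
Proof. by apply: measurable_sum => i; apply: measurable_funM; exact: measurable_coord. Qed.

(** Half of the exponent absorbs the polynomial factor, since v exp (- v) <= 1. Second moments of
    Gaussian-like densities then reduce to their total mass. *)
Lemma dotv_expR_le n (c : R) (z : 'rV[R]_n) : 0 < c ->
  dotv z z * expR (- (c * dotv z z)) <= (2 / c) * expR (- (c / 2 * dotv z z)).
Proof.
move=> c0.
have -> : - (c * dotv z z) = - (c / 2 * dotv z z) + - (c / 2 * dotv z z) by field.
rewrite expRD mulrA ler_wpM2r ?expR_ge0// expRN ler_pdivrMr ?expR_gt0//.
rewrite -ler_pdivrMl ?divr_gt0// invf_div.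
by rewrite (le_trans _ (expR_ge1Dx _))// lerDr.
Qed.

Lemma integral_gauss n (f : 'rV[R]_n -> \bar R) : measurable_fun setT f ->
  (forall z, 0 <= f z)%E ->
  (\int[@gauss R n]_z f z = \int[lebesgue_rV n]_z (f z * (gauss_pdf z)%:E))%E.
Proof. by move=> mf f0; rewrite ge0_integral_density. Qed.

Lemma measurable_expRNdotv n (c : R) :
  measurable_fun setT (fun z : 'rV[R]_n => expR (- (c * dotv z z))).
Proof.
apply: (@measurableT_comp _ _ _ _ _ _ (@expR R)) => //; apply: measurableT_comp => //.
by apply: measurable_funM => //; exact: measurable_dotv.
Qed.

Lemma gauss_moment n : (\int[@gauss R n]_z (dotv z z)%:E < +oo)%E.
Proof.
rewrite integral_gauss; last 2 first.
- by apply/measurable_EFinP; exact: measurable_dotv.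
- by move=> z; rewrite lee_fin dotv_ge0.
have K0 : 0 <= normal_peak (1 : R) ^+ n by rewrite exprn_ge0// normal_peak_ge0.
(* [dotv_expR_le] with c = 1/2 gives the factor 2 / c = 4 and leaves the exponent c / 2 = 1/4. *)
pose C : R := normal_peak 1 ^+ n * 4.
apply: (@le_lt_trans _ _ (\int[lebesgue_rV n]_z
    (C%:E * (expR (- (4^-1 * dotv z z)))%:E))%E).
  apply: ge0_le_integral => //.
  - by move=> z _; rewrite -EFinM lee_fin mulr_ge0 ?dotv_ge0 ?gauss_pdf_ge0.
  - apply/measurable_EFinP/measurable_funM; first exact: measurable_dotv.
    exact: measurable_gauss_pdf.
  - by apply/measurable_EFinP/measurable_funM => //; exact: measurable_expRNdotv.
  - move=> z _; rewrite -!EFinM lee_fin gauss_pdfE mulrCA /C -mulrA ler_wpM2l//.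
    have h : (0 : R) < 2^-1 by rewrite invr_gt0.
    rewrite (le_trans (dotv_expR_le z h))// invrK -natrM.
    by rewrite (_ : 2^-1 / 2 = 4^-1 :> R)//; field.
have C0 : (0 <= C%:E)%E by rewrite lee_fin mulr_ge0.
rewrite ge0_integralZl//.
- by rewrite lte_mul_pinfty ?integral_expRNdotv_lty ?invr_gt0.
- by apply/measurable_EFinP; exact: measurable_expRNdotv.
Qed.

End gauss_moments.

(** * Independence of the Brownian increments *)

Section joint_law.
Context {R : realType} {n : nat} {d0 : measure_display} {T0 : measurableType d0}.
Variable P0 : probability T0 R.
Local Notation E := 'rV[R]_n.

(** Freezing: D is independent of F with the law of s z, so it may be integrated out with the
    F-measurable variable Z held fixed. The pair (Z, D) has a product law because it has the product
    form on rectangles, and Tonelli concludes. *)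
Lemma ge0_integral_joint_law (F : set (set T0)) (s : R) (Z D : T0 -> E) :
  0 < s -> F `<=` measurable -> measurable_wrt F Z -> measurable_fun setT D ->
  (forall (G : set T0) (A : 'I_n -> set R), F G -> (forall i, measurable (A i)) ->
    P0 (G `&` [set w | forall i, A i (D w 0 i)]) =
    (P0 G * \prod_i normal_prob 0 s (A i))%E) ->
  forall f : E * E -> \bar R, measurable_fun setT f -> (forall p, 0 <= f p)%E ->
  (\int[P0]_w f (Z w, D w) = \int[P0]_w \int[@gauss R n]_z f (Z w, s *: z)%R)%E.
Proof.
move=> s0 FM FZ mD PD f mf f0.
have mZ : measurable_fun setT Z.
  by move=> _ B mB; rewrite setTI; apply: FM; exact: FZ.
have ms : measurable_fun setT ( *:%R s : E -> E).
  by apply: continuous_measurable_rV; exact: scaler_continuous.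
pose Zm := to_mfun mZ; pose sm := to_mfun ms.
pose PZ := distribution P0 Zm; pose PG := distribution (@gauss R n) sm.
(* With G fixed, both sides are finite measures in B that agree on boxes, so that they agree on all
   Borel sets. *)
have PDB G B : F G -> measurable B -> P0 (G `&` D @^-1` B) = (P0 G * PG B)%E.
  move=> FG mB.
  have mG := FM _ FG.
  pose m1 : {measure set E -> \bar R} :=
    measure_function_pushforward__canonical__measure_function_Measure
      (mrestr P0 mG) mD.
  have PG0 : 0 <= fine (P0 G) by rewrite fine_ge0.
  pose m2 : {measure set E -> \bar R} := mscale (NngNum PG0) PG.
  have m1E C : m1 C = P0 (G `&` D @^-1` C) by rewrite setIC.
  have m2E C : m2 C = (P0 G * PG C)%E.
    by rewrite -[P0 G in RHS]fineK ?fin_num_measure.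
  rewrite -m1E -m2E; apply: rV_measure_unique => //.
    by rewrite m1E (le_lt_trans (probability_le1 _ _)) ?ltry// preimage_setT setIT.
  move=> A mA; rewrite m1E m2E PD//; congr (_ * _)%E.
  by rewrite -gauss_box.
have mZD : measurable_fun setT (fun w => (Z w, D w)) by exact: measurable_fun_pair.
pose ZD := to_mfun mZD.
transitivity (\int[distribution P0 ZD]_p f p)%E.
  by rewrite ge0_integral_distribution.
transitivity (\int[PZ \x PG]_p f p)%E.
  apply: eq_measure_integral => X mX _; apply/esym.
  apply: product_measure_unique => // A B mA mB.
  rewrite -PDB//; exact: FZ.
rewrite fubini_tonelli1//.
have mF : measurable_fun setT (fubini_F PG f).
  exact: (measurable_fun_fubini_tonelli_F f mf f0).
have F0 x : (0 <= fubini_F PG f x)%E by apply: integral_ge0.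
transitivity (\int[P0]_w fubini_F PG f (Z w))%E.
  exact: (@ge0_integral_distribution _ _ _ _ _ P0 Zm (fubini_F PG f) mF F0).
apply: eq_integral => w _.
exact: (@ge0_integral_distribution _ _ _ _ _ (@gauss R n) sm
  (fun y => f (Z w, y)) (measurableT_comp mf (measurable_pair1 (Z w))) (fun=> f0 _)).
Qed.

End joint_law.

(** * The potential and its Gibbs measure *)

Section line_calculus.
Context {R : realType} {d : nat}.
Implicit Types (V : 'rV[R]_d -> R) (x y u : 'rV[R]_d).

Lemma derive_dotv_grad V x u : differentiable V x -> 'D_u V x = dotv (grad V x) u.
Proof.
move=> dV; rewrite deriveE// [in LHS](row_sum_delta u) linear_sum/=.
by apply: eq_bigr => i _; rewrite linearZ/= mxE deriveE// mulrC.
Qed.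

Lemma is_derive_line V x u (s : R) : (forall x, differentiable V x) ->
  is_derive s 1 (fun s => V (x + s *: u)) (dotv (grad V (x + s *: u)) u).
Proof.
move=> dV.
have E : (fun h : R => h^-1 *: ((fun s => V (x + s *: u)) (h *: 1 + s) - V (x + s *: u))) =
         (fun h : R => h^-1 *: (V (h *: u + (x + s *: u)) - V (x + s *: u))).
  apply/funext => h; congr (_ *: (V _ - _)).
  by rewrite [h *: 1]mulr1 scalerDl addrCA.
have dVu := @diff_derivable _ _ _ _ _ u (dV (x + s *: u)).
apply: DeriveDef.
  by rewrite /derivable E; exact: dVu.
by rewrite -derive_dotv_grad// /derive E.
Qed.

End line_calculus.

Section potential.
Context {R : realType} {d : nat} (V : 'rV[R]_d -> R) (LV : R).
Implicit Types x y u : 'rV[R]_d.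
Hypotheses (dV : forall x, differentiable V x)
  (LV0 : 0 <= LV)
  (VL : forall x y, enorm (grad V x - grad V y) <= LV * enorm (x - y)).

Definition trapezoid_error x y : R :=
  V y - V x - 2^-1 * dotv (grad V x + grad V y) (y - x).

(* [trapezoid_error x (x + u)] is the increment over [0, 1] of
   [V (x + s u) - s grad V x . u - (s ^ 2 / 2) (grad V (x + u) - grad V x) . u] *)
Lemma trapezoid_errorE x u : exists2 c : R, 0 <= c <= 1 &
  trapezoid_error x (x + u) =
  dotv (grad V (x + c *: u) - grad V x) u - c * dotv (grad V (x + u) - grad V x) u.
Proof.
set a := dotv (grad V x) u; set b := dotv (grad V (x + u) - grad V x) u.
pose F (s : R) : R := V (x + s *: u) - s * a - s ^+ 2 / 2 * b.
pose dF (s : R) : R := dotv (grad V (x + s *: u)) u - a - s * b.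
have isF (s : R) : is_derive s 1 F (dF s).
  have := is_derive_line x u s dV => isV.
  by apply: is_derive_eq; rewrite /dF /GRing.scale/=; field.
have cF : {within `[0, 1], continuous F}.
  apply: derivable_within_continuous => s _; exact: (@ex_derive _ _ _ _ _ _ _ (isF s)).
have [c cI] := MVT_segment ler01 (fun s _ => isF s) cF.
rewrite subr0 mulr1 => Fc; exists c; first by move: cI; rewrite in_itv.
transitivity (F 1 - F 0); last by rewrite Fc /dF dotvDl dotvNl.
rewrite /F /trapezoid_error scale1r scale0r addr0 (addrC x u) addrK.
rewrite /b (addrC x u) !dotvDl !dotvNl -/a; lra.
Qed.

Lemma trapezoid_error_le x u :
  `|trapezoid_error x (x + u)| <= 2 * LV * enorm u ^+ 2.
Proof.
have [c /andP[c0 c1] ->] := trapezoid_errorE x u.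
have gu (s : R) : 0 <= s <= 1 ->
    `|dotv (grad V (x + s *: u) - grad V x) u| <= LV * enorm u ^+ 2.
  move=> /andP[s0 s1]; rewrite (le_trans (abs_dotv_le _ _))//.
  rewrite expr2 mulrA ler_wpM2r ?enorm_ge0//.
  rewrite (le_trans (VL _ _))// [x + _]addrC addrK enormZ ler_wpM2l//.
  by rewrite ger0_norm// ler_piMl ?enorm_ge0.
rewrite (le_trans (ler_normB _ _))// -mulrA mulrDl mul1r lerD//.
  by apply: gu; rewrite c0.
rewrite normrM (ger0_norm c0) (le_trans (ler_piMl _ c1))//.
by have := gu 1; rewrite scale1r; apply; rewrite ler01 lexx.
Qed.

Hypothesis dgV : forall x, differentiable (grad V) x.

(** In [trapezoid_errorE], the linear parts H (c u) . u and c H u . u, with H the derivative of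
    [grad V] at x, cancel. What is left are the remainders of the first-order expansion of [grad V]
    at x, of order o(|u|), paired with u. *)
Lemma trapezoid_error_peano x (e : R) : 0 < e -> exists2 r : R, 0 < r &
  forall u, enorm u < r -> `|trapezoid_error x (x + u)| <= e * enorm u ^+ 2.
Proof.
move=> e0; pose H := 'd (grad V) x.
pose rest u := grad V (x + u) - grad V x - H u.
have [r r0 rP] : exists2 r : R, 0 < r &
    forall u, enorm u < r -> enorm (rest u) <= e / 2 * enorm u.
  (* The expansion is stated in the sup norm, and the return to [enorm] costs a factor at most d;
     [d.+1] stays invertible for d = 0. The half leaves room for the two remainders. *)
  pose e' := d.+1%:R^-1 * (e / 2).
  have e'0 : 0 < e' by rewrite mulr_gt0 ?invr_gt0 ?divr_gt0.
  have /eqaddoP/(_ _ e'0) := diff_locally (dgV x).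
  move=> /nbhs_norm0P[r /= r0 rP]; exists r => // u ur.
  have {}rP : `|rest u| <= e' * `|u|.
    have := rP u (le_lt_trans (norm_le_enorm u) ur).
    by rewrite /= !fctE/= opprD addrA [u + x]addrC.
  rewrite (le_trans (enorm_le_norm _))//.
  rewrite (@le_trans _ _ (d.+1%:R * (e' * `|u|)))//.
    by rewrite ler_pM// ler_nat.
  rewrite /e' !mulrA divff ?pnatr_eq0// mul1r.
  by rewrite ler_wpM2l ?norm_le_enorm// divr_ge0// ltW.
exists r => // u ur.
have [c /andP[c0 c1] ->] := trapezoid_errorE x u.
have -> : dotv (grad V (x + c *: u) - grad V x) u - c * dotv (grad V (x + u) - grad V x) u
    = dotv (rest (c *: u)) u - c * dotv (rest u) u.
  have HZ : H (c *: u) = c *: H u by exact: linearZ.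
  rewrite /rest (dotvDl _ (- H (c *: u))) (dotvDl _ (- H u)) !dotvNl HZ dotvZl.
  by ring.
have cu : enorm (c *: u) <= enorm u.
  by rewrite enormZ ger0_norm// ler_piMl ?enorm_ge0.
rewrite (le_trans (ler_normB _ _))// normrM (ger0_norm c0).
have h1 : `|dotv (rest (c *: u)) u| <= e / 2 * enorm u ^+ 2.
  rewrite (le_trans (abs_dotv_le _ _))// expr2 mulrA ler_wpM2r ?enorm_ge0//.
  rewrite (le_trans (rP _ (le_lt_trans cu ur)))// ler_wpM2l//.
  by rewrite divr_ge0// ltW.
have h2 : c * `|dotv (rest u) u| <= e / 2 * enorm u ^+ 2.
  rewrite (le_trans (ler_piMl _ c1))// (le_trans (abs_dotv_le _ _))//.
  by rewrite expr2 mulrA ler_wpM2r ?enorm_ge0// rP.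
by rewrite (le_trans (lerD h1 h2))// -mulrDl -splitr.
Qed.

Lemma enorm_grad_le x : enorm (grad V x) <= enorm (grad V 0) + LV * enorm x.
Proof.
have := VL x 0; rewrite subr0 => H.
have := enormD (grad V x - grad V 0) (grad V 0); rewrite subrK => H2.
by rewrite (le_trans H2)// addrC lerD2l.
Qed.

Lemma grad_continuous : continuous (grad V).
Proof. by move=> x; exact/differentiable_continuous/dgV. Qed.

Lemma potential_continuous : continuous V.
Proof. by move=> x; exact/differentiable_continuous/dV. Qed.

End potential.

Section coercivity.
Context {R : realType} {d : nat} (V : 'rV[R]_d -> R) (LV r0 k0 : R).
Hypotheses (dV : forall x, differentiable V x) (LV0 : 0 <= LV)
  (VL : forall x y, enorm (grad V x - grad V y) <= LV * enorm (x - y))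
  (r00 : 0 < r0) (k00 : 0 < k0)
  (Vk : forall x y, enorm (x - y) = r0 ->
     k0 * r0 ^+ 2 <= dotv (grad V x - grad V y) (x - y)).

(* Strict monotonicity of [grad V] at the single distance [r0] propagates along
   a ray to all multiples of [r0], and the Lipschitz bound fills the gaps. *)
Lemma radial_derivative_ge u (s : R) : enorm u = 1 -> 0 <= s ->
  k0 * s - (enorm (grad V 0) + (k0 + LV) * r0) <= dotv (grad V (s *: u)) u.
Proof.
move=> u1 s0; pose p (s : R) := dotv (grad V (s *: u)) u.
have p0 : - enorm (grad V 0) <= p 0.
  rewrite /p scale0r; have := abs_dotv_le (grad V 0) u.
  by rewrite u1 mulr1 ler_norml => /andP[].
have pS (a : R) : p a + k0 * r0 <= p (a + r0).
  have E : (a + r0) *: u - a *: u = r0 *: u by rewrite scalerDl addrAC subrr add0r.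
  have := @Vk ((a + r0) *: u) (a *: u); rewrite E enormZ gtr0_norm// u1 mulr1.
  move=> /(_ erefl); rewrite dotvZr expr2 mulrCA ler_pM2l// dotvDl dotvNl -/(p _) -/(p _).
  by rewrite lerBrDr addrC.
have pL (a b : R) : 0 <= b -> p a - LV * b <= p (a + b).
  move=> b0; have E : (a + b) *: u - a *: u = b *: u by rewrite scalerDl addrAC subrr add0r.
  have := abs_dotv_le (grad V ((a + b) *: u) - grad V (a *: u)) u.
  rewrite u1 mulr1 dotvDl dotvNl -/(p _) -/(p _) => H.
  have := le_trans H (VL _ _); rewrite E enormZ (ger0_norm b0) u1 mulr1 ler_norml.
  by move=> /andP[+ _]; lra.
have pn (n : nat) : p 0 + n%:R * (k0 * r0) <= p (n%:R * r0).
  elim: n => [|n IH]; first by rewrite !mul0r addr0.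
  rewrite -natr1 !mulrDl !mul1r addrA (le_trans _ (pS _))// lerD2r//.
(* Number of full steps of length r0 in s; the remaining length, below r0, is covered by the
   Lipschitz bound. *)
pose n := Num.truncn (s / r0).
have /andP[n1 n2] : n%:R * r0 <= s < n.+1%:R * r0.
  by rewrite -ler_pdivlMr// -ltr_pdivrMr// truncn_itv// divr_ge0// ltW.
have := pL (n%:R * r0) (s - n%:R * r0); rewrite subr_ge0 => /(_ n1).
rewrite [n%:R * r0 + _]addrC subrK => H.
have Hn := pn n.
have sr : s - n%:R * r0 <= r0 by move: n2; rewrite -natr1 mulrDl mul1r; lra.
have : LV * (s - n%:R * r0) <= LV * r0 by rewrite ler_wpM2l.
have : k0 * s <= k0 * (n%:R * r0 + r0) by rewrite ler_wpM2l ?ltW//; lra.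
move=> H1 H2; rewrite -/(p s); nra.
Qed.

(** Integrating [radial_derivative_ge] along the ray gives V x >= V 0 + k0/2 |x|^2 - c |x|, and c
    |x| <= k0/4 |x|^2 + c^2/k0 by completing the square; the constant C is read off from this. The
    bound makes the Gibbs weight integrable. *)
Lemma potential_ge : exists C : R, forall x, k0 / 4 * enorm x ^+ 2 - C <= V x.
Proof.
pose c := enorm (grad V 0) + (k0 + LV) * r0.
exists (c ^+ 2 / k0 - V 0) => x.
have [x0|x0] := eqVneq (enorm x) 0.
  rewrite (enorm_eq0 x0) enorm0 expr0n mulr0 sub0r opprB gerBl.
  by rewrite divr_ge0 ?sqr_ge0// ltW.
pose u := (enorm x)^-1 *: x.
have xp : 0 < enorm x by rewrite lt_neqAle eq_sym x0 enorm_ge0.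
have u1 : enorm u = 1 by rewrite enormZ ger0_norm ?invr_ge0 ?enorm_ge0// mulVf.
have xu : x = 0 + enorm x *: u by rewrite add0r scalerA divff// scale1r.
pose F (s : R) := V (0 + s *: u) - k0 / 2 * s ^+ 2 + c * s.
pose dF (s : R) := dotv (grad V (0 + s *: u)) u - k0 * s + c.
have isF (s : R) : is_derive s 1 F (dF s).
  have := is_derive_line 0 u s dV => isV.
  by apply: is_derive_eq; rewrite /dF /GRing.scale/=; field.
have cF : {within `[0, enorm x], continuous F}.
  apply: derivable_within_continuous => s _; exact: (@ex_derive _ _ _ _ _ _ _ (isF s)).
have [s sI] := MVT_segment (ltW xp) (fun s _ => isF s) cF.
have s0 : 0 <= s by move: sI; rewrite in_itv/= => /andP[].
have := radial_derivative_ge u1 s0; rewrite -/c => H.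
have dF0 : 0 <= dF s by rewrite /dF add0r; lra.
rewrite subr0 => E.
have : 0 <= F (enorm x) - F 0 by rewrite E mulr_ge0 ?enorm_ge0.
rewrite /F -xu scale0r addr0 expr0n/= !mulr0 subr0 addr0 subr_ge0.
move=> H1.
have : 0 <= (k0 * enorm x / 2 - c) ^+ 2 / k0 by rewrite divr_ge0 ?sqr_ge0// ltW.
rewrite (_ : _ / k0 = k0 / 4 * enorm x ^+ 2 - c * enorm x + c ^+ 2 / k0).
  by move: H1; lra.
by field; rewrite gt_eqF.
Qed.

End coercivity.

Section gibbs_measure.
Context {R : realType} {d : nat} (V : 'rV[R]_d -> R) (sigma0 : R).
Local Notation E := 'rV[R]_d.
Local Notation leb := (@lebesgue_rV R d).
Hypotheses (cV : continuous V) (s0 : 0 < sigma0).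

Definition gibbs_weight (x : E) : R := expR (- (2 * V x / sigma0 ^+ 2)).

Lemma gibbs_weight_gt0 x : 0 < gibbs_weight x.
Proof. exact: expR_gt0. Qed.

Lemma measurable_gibbs_weight : measurable_fun setT gibbs_weight.
Proof.
apply: (@measurableT_comp _ _ _ _ _ _ (@expR R)) => //.
apply: measurableT_comp => //; apply: measurable_funM => //.
by apply: measurable_funM => //; exact: continuous_measurable_rV1.
Qed.

Lemma gibbs_integral (mu0 : probability E R) : gibbs V sigma0 mu0 ->
  exists2 c : R, 0 < c & forall f : E -> \bar R, measurable_fun setT f ->
    (forall x, 0 <= f x)%E ->
    (\int[mu0]_x f x = \int[leb]_x (f x * (c * gibbs_weight x)%:E))%E.
Proof.
move=> [c c0 muE]; exists c => // f mf f0.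
have mc : measurable_fun setT (fun x => c * gibbs_weight x).
  by apply: measurable_funM => //; exact: measurable_gibbs_weight.
have cg x : 0 <= c * gibbs_weight x by rewrite mulr_ge0// ltW// gibbs_weight_gt0.
rewrite -(ge0_integral_density leb mc cg)//.
apply: eq_measure_integral => A mA _; exact: (muE A mA).
Qed.

Variables (k C : R).
Hypotheses (k0 : 0 < k) (Vk : forall x, k * enorm x ^+ 2 - C <= V x).

Let K : R := expR (2 * C / sigma0 ^+ 2).
Let b : R := 2 * k / sigma0 ^+ 2.

Let b0 : 0 < b.
Proof. by rewrite divr_gt0 ?mulr_gt0 ?exprn_gt0. Qed.

Let weight_le x : gibbs_weight x <= K * expR (- (b * dotv x x)).
Proof.
rewrite /K -expRD ler_expR -sqr_enorm /b.
have -> : 2 * C / sigma0 ^+ 2 + - (2 * k / sigma0 ^+ 2 * enorm x ^+ 2) =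
  - (2 * (k * enorm x ^+ 2 - C) / sigma0 ^+ 2) by field; rewrite gt_eqF.
by rewrite lerN2 ler_wpM2r ?invr_ge0 ?sqr_ge0// ler_wpM2l.
Qed.

Lemma integral_gibbs_weight_lty : (\int[leb]_x (gibbs_weight x)%:E < +oo)%E.
Proof.
apply: (@le_lt_trans _ _ (\int[leb]_x (K%:E * (expR (- (b * dotv x x)))%:E))%E).
  apply: ge0_le_integral => //.
  - by move=> x _; rewrite lee_fin ltW ?gibbs_weight_gt0.
  - by apply/measurable_EFinP; exact: measurable_gibbs_weight.
  - apply/measurable_EFinP; apply: measurable_funM => //.
    exact: measurable_expRNdotv.
  - by move=> x _; rewrite -EFinM lee_fin; exact: weight_le.
have C0 : (0 <= K%:E)%E by rewrite lee_fin expR_ge0.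
rewrite ge0_integralZl//.
- by rewrite lte_mul_pinfty ?integral_expRNdotv_lty.
- by apply/measurable_EFinP; exact: measurable_expRNdotv.
Qed.

(** If the integral were zero, the positive weight would vanish almost everywhere, so Lebesgue
    measure would be zero; but [gauss] has a Lebesgue density and mass 1. *)
Lemma integral_gibbs_weight_gt0 : (0 < \int[leb]_x (gibbs_weight x)%:E)%E.
Proof.
rewrite lt_neqAle integral_ge0 ?andbT; last first.
  by move=> x _; rewrite lee_fin ltW ?gibbs_weight_gt0.
apply/negP => /eqP/esym W0.
have : (\int[leb]_x `|(gibbs_weight x)%:E| = 0)%E.
  by rewrite -[RHS]W0; apply: eq_integral => x _; rewrite gee0_abs// lee_fin ltW// gibbs_weight_gt0.
have mw : measurable_fun setT (EFin \o gibbs_weight).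
  by apply/measurable_EFinP; exact: measurable_gibbs_weight.
move=> /(ae_eq_integral_abs leb measurableT mw) W.
have /= : @gauss R d setT = 0%E.
  rewrite /gauss /density_measure.
  rewrite -(integral0 leb setT); apply: ae_eq_integral => //.
    by apply/measurable_EFinP; exact: measurable_gauss_pdf.
  apply: filterS W => x /= /(_ Logic.I) [] /eqP.
  by rewrite gt_eqF// gibbs_weight_gt0.
by rewrite probability_setT => /eqP; rewrite onee_eq0.
Qed.

Lemma gibbs_exists : exists mu0 : probability E R, gibbs V sigma0 mu0.
Proof.
pose Z := fine (\int[leb]_x (gibbs_weight x)%:E)%E.
have Zfin : (\int[leb]_x (gibbs_weight x)%:E)%E \is a fin_num.
  by rewrite ge0_fin_numE ?ltW ?integral_gibbs_weight_gt0// integral_gibbs_weight_lty.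
have Z0 : 0 < Z by rewrite fine_gt0// integral_gibbs_weight_gt0 integral_gibbs_weight_lty.
have mc : measurable_fun setT (fun x => Z^-1 * gibbs_weight x).
  by apply: measurable_funM => //; exact: measurable_gibbs_weight.
have cg x : 0 <= Z^-1 * gibbs_weight x.
  by rewrite mulr_ge0// ltW ?invr_gt0// gibbs_weight_gt0.
pose m := density_measure leb mc cg.
have mT : m setT = 1%E.
  rewrite /m /density_measure; under eq_integral do rewrite EFinM.
  rewrite ge0_integralZl//.
  - by rewrite -(fineK Zfin) -EFinM mulVf// gt_eqF.
  - by apply/measurable_EFinP; exact: measurable_gibbs_weight.
  - by move=> x _; rewrite lee_fin ltW// gibbs_weight_gt0.
  - by rewrite lee_fin invr_ge0 ltW.
pose mu0 : probability E R := HB.pack m (Measure_isProbability.Build _ _ _ m mT).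
by exists mu0, Z^-1 => //; rewrite invr_gt0.
Qed.

Lemma gibbs_moment (mu0 : probability E R) : gibbs V sigma0 mu0 ->
  (\int[mu0]_x (dotv x x)%:E < +oo)%E.
Proof.
move=> /gibbs_integral[c c0 ->]; last 2 first.
- by apply/measurable_EFinP; exact: measurable_dotv.
- by move=> x; rewrite lee_fin dotv_ge0.
pose K' : R := c * K * (2 / b).
have K'0 : (0 <= K'%:E)%E.
  by rewrite lee_fin !mulr_ge0 ?expR_ge0 ?invr_ge0// ?ltW.
apply: (@le_lt_trans _ _ (\int[leb]_x (K'%:E * (expR (- (b / 2 * dotv x x)))%:E))%E).
  apply: ge0_le_integral => //.
  - move=> x _; rewrite -EFinM lee_fin !mulr_ge0 ?dotv_ge0//; first exact: ltW.
    by rewrite ltW// gibbs_weight_gt0.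
  - apply/measurable_EFinP; apply: measurable_funM; first exact: measurable_dotv.
    by apply: measurable_funM => //; exact: measurable_gibbs_weight.
  - apply/measurable_EFinP; apply: measurable_funM => //.
    exact: measurable_expRNdotv.
  - move=> x _; rewrite -!EFinM lee_fin /K' mulrCA -!mulrA ler_wpM2l ?(ltW c0)//.
    rewrite (@le_trans _ _ (dotv x x * (K * expR (- (b * dotv x x)))))//.
      by rewrite ler_wpM2l ?dotv_ge0.
    rewrite mulrCA ler_wpM2l ?expR_ge0//.
    by rewrite (le_trans (dotv_expR_le _ b0))// /b -!mulrA.
rewrite ge0_integralZl//.
- by rewrite lte_mul_pinfty ?integral_expRNdotv_lty// divr_gt0.
- by apply/measurable_EFinP; exact: measurable_expRNdotv.
Qed.

End gibbs_measure.

(** * Approximate detailed balance of the Euler step *)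

Section euler_step.
Context {R : realType} {d : nat} (V : 'rV[R]_d -> R) (sigma0 : R).
Local Notation E := 'rV[R]_d.
Local Notation leb := (@lebesgue_rV R d).
Hypotheses (dV : forall x, differentiable V x)
  (dgV : forall x, differentiable (grad V) x) (s0 : 0 < sigma0).

Definition euler_step (h : R) (x z : E) : E :=
  x - h *: grad V x + (sigma0 * Num.sqrt h) *: z.

(* minus the logarithm of the Metropolis-Hastings ratio of the Euler proposal, with
   the second-order terms of [V] gathered in the trapezoid error *)
Definition balance_error (h : R) (x y : E) : R :=
  2 / sigma0 ^+ 2 * trapezoid_error V x y -
  h / (2 * sigma0 ^+ 2) *
    (dotv (grad V x) (grad V x) - dotv (grad V y) (grad V y)).

Let mV : measurable_fun setT V.
Proof. by apply: continuous_measurable_rV1; exact: potential_continuous. Qed.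

Let mg : measurable_fun setT (grad V).
Proof. by apply: continuous_measurable_rV; exact: grad_continuous. Qed.

Let measurable_dotv2 d0 (T : measurableType d0) (f g : T -> E) :
  measurable_fun setT f -> measurable_fun setT g ->
  measurable_fun setT (fun t => dotv (f t) (g t)).
Proof.
move=> mf mg'; apply: measurable_sum => i; apply: measurable_funM.
  exact: (measurableT_comp (measurable_coord i) mf).
exact: (measurableT_comp (measurable_coord i) mg').
Qed.

Lemma measurable_rV_add d0 (T : measurableType d0) (f g : T -> E) :
  measurable_fun setT f -> measurable_fun setT g ->
  measurable_fun setT (fun t => f t + g t).
Proof.
move=> mf mg'; apply: measurable_fun_rV => i; under eq_fun do rewrite mxE.
apply: measurable_funD.
  exact: (measurableT_comp (measurable_coord i) mf).
exact: (measurableT_comp (measurable_coord i) mg').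
Qed.

Lemma measurable_rV_scale d0 (T : measurableType d0) (a : R) (f : T -> E) :
  measurable_fun setT f -> measurable_fun setT (fun t => a *: f t).
Proof.
move=> mf; apply: measurable_fun_rV => i; under eq_fun do rewrite mxE.
apply: measurable_funM => //.
exact: (measurableT_comp (measurable_coord i) mf).
Qed.

Lemma measurable_rV_opp d0 (T : measurableType d0) (f : T -> E) :
  measurable_fun setT f -> measurable_fun setT (fun t => - f t).
Proof. by move=> /(measurable_rV_scale (-1)); under eq_fun do rewrite scaleN1r. Qed.

Lemma measurable_euler_step h :
  measurable_fun setT (fun p : E * E => euler_step h p.1 p.2).
Proof.
apply: measurable_rV_add; last by apply: measurable_rV_scale; exact: measurable_snd.
apply: measurable_rV_add; first exact: measurable_fst.
apply/measurable_rV_opp/measurable_rV_scale.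
exact: (measurableT_comp mg measurable_fst).
Qed.

Lemma measurable_balance_error h :
  measurable_fun setT (fun p : E * E => balance_error h p.1 p.2).
Proof.
have mg1 : measurable_fun setT (fun p : E * E => grad V p.1).
  exact: (measurableT_comp mg measurable_fst).
have mg2 : measurable_fun setT (fun p : E * E => grad V p.2).
  exact: (measurableT_comp mg measurable_snd).
apply: measurable_funB; apply: measurable_funM => //; last first.
  by apply: measurable_funB; exact: measurable_dotv2.
apply: measurable_funB; first apply: measurable_funB.
- exact: (measurableT_comp mV measurable_snd).
- exact: (measurableT_comp mV measurable_fst).
apply: measurable_funM => //; apply: measurable_dotv2.
  exact: measurable_rV_add.
apply: measurable_rV_add; first exact: measurable_snd.
by apply: measurable_rV_opp; exact: measurable_fst.
Qed.

Variables (mu0 : probability E R) (h : R).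
Hypotheses (mu0V : gibbs V sigma0 mu0) (h0 : 0 < h).

Let s := sigma0 * Num.sqrt h.

Let sp : 0 < s.
Proof. by rewrite mulr_gt0// sqrtr_gt0. Qed.

(** Transition density of the Euler step from x: the Gaussian with mean x - h grad V x and
    covariance s^2 I. *)
Let prop (x y : E) : R :=
  (s ^+ d)^-1 * gauss_pdf (s^-1 *: (y - (x - h *: grad V x))).

Let prop_ge0 x y : 0 <= prop x y.
Proof. by rewrite mulr_ge0 ?gauss_pdf_ge0// invr_ge0 exprn_ge0// ltW. Qed.

Let measurable_prop : measurable_fun setT (fun p : E * E => prop p.1 p.2).
Proof.
apply: measurable_funM => //.
apply: (measurableT_comp (@measurable_gauss_pdf R d)); apply: measurable_rV_scale.
apply: measurable_rV_add; first exact: measurable_snd.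
apply/measurable_rV_opp/measurable_rV_add; first exact: measurable_fst.
apply/measurable_rV_opp/measurable_rV_scale.
exact: (measurableT_comp mg measurable_fst).
Qed.

Let integral_step (x : E) (k : E -> \bar R) : measurable_fun setT k ->
  (forall y, 0 <= k y)%E ->
  (\int[@gauss R d]_z k (euler_step h x z) = \int[leb]_y (k y * (prop x y)%:E))%E.
Proof.
move=> mk k0; rewrite integral_gauss//; last first.
  apply: (measurableT_comp mk).
  exact: (measurableT_comp (measurable_euler_step h) (measurable_pair1 x)).
have mkp : measurable_fun setT (fun y => (k y * (prop x y)%:E)%E).
  apply: emeasurable_funM => //; apply/measurable_EFinP.
  exact: (measurableT_comp measurable_prop (measurable_pair1 x)).
rewrite -[RHS](ge0_integral_scale_rV (x - h *: grad V x) sp)//; last first.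
  by move=> y; rewrite mule_ge0// lee_fin.
pose F v := (k (s *: v + (x - h *: grad V x))%R *
  (prop x (s *: v + (x - h *: grad V x))%R)%:E)%E.
rewrite -(@ge0_integralZl _ _ _ leb setT measurableT F); last 3 first.
- exact: (measurableT_comp mkp (measurable_scale_rV _ _)).
- by move=> y _; rewrite mule_ge0// lee_fin.
- by rewrite lee_fin exprn_ge0// ltW.
apply: eq_integral => z _.
rewrite /F /euler_step -/s [s *: z + _]addrC muleCA -EFinM; congr (_ * _%:E)%E.
rewrite /prop mulrA mulfV ?mul1r; last by rewrite expf_neq0// gt_eqF.
by rewrite addrAC subrr add0r scalerA mulVf ?scale1r// gt_eqF.
Qed.

(** Write u = y - x. In the logarithm of the ratio the two terms |u|^2 cancel, the cross terms (grad
    V x + grad V y) . u complete V y - V x to the trapezoid error, and the squared gradients remain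
    with a factor h. *)
Let balance x y :
  gibbs_weight V sigma0 y * prop y x =
  gibbs_weight V sigma0 x * prop x y * expR (- balance_error h x y).
Proof.
pose u := y - x.
pose w (g v : E) := s^-1 *: (h *: g + v).
have dw g v : dotv (w g v) (w g v) = (sigma0 ^+ 2 * h)^-1 *
    (h ^+ 2 * dotv g g + 2 * h * dotv g v + dotv v v).
  have -> : sigma0 ^+ 2 * h = s ^+ 2 by rewrite exprMn sqr_sqrtr// ltW.
  rewrite /w dotvZl dotvZr mulrA -invfM -expr2; congr (_ * _).
  by rewrite dotvDl !dotvDr !dotvZl !dotvZr (dotvC v g); ring.
have -> : prop y x = (s ^+ d)^-1 * gauss_pdf (w (grad V y) (- u)).
  rewrite /prop; congr (_ * gauss_pdf (_ *: _)).
  by rewrite /u !opprB addrC addrA addrAC.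
have -> : prop x y = (s ^+ d)^-1 * gauss_pdf (w (grad V x) u).
  rewrite /prop; congr (_ * gauss_pdf (_ *: _)).
  by rewrite /u opprB addrC addrA addrAC.
have -> : balance_error h x y = 2 / sigma0 ^+ 2 *
     (V y - V x - 2^-1 * (dotv (grad V x) u + dotv (grad V y) u)) -
     h / (2 * sigma0 ^+ 2) *
    (dotv (grad V x) (grad V x) - dotv (grad V y) (grad V y)).
  by rewrite /balance_error /trapezoid_error dotvDl.
have := dw (grad V y) (- u); rewrite dotvNr dotvNl dotvNr opprK.
have := dw (grad V x) u.
rewrite /gibbs_weight.
move: (w (grad V y) (- u)) (w (grad V x) u) => w2 w1 d1 d2.
have -> := gauss_pdfE w1; have -> := gauss_pdfE w2; rewrite d1 d2.
move: (dotv u u) (dotv (grad V x) u) (dotv (grad V y) u) (V x) (V y)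
  (dotv (grad V x) (grad V x)) (dotv (grad V y) (grad V y))
  (s ^+ d)^-1 (normal_peak (1 : R) ^+ d) {d1 d2} => uu xu yu Vx Vy gx gy K K'.
have aux (a b a' b' e : R) :
    a * b = a' * b' * e -> a * (K * (K' * b)) = a' * (K * (K' * b')) * e.
  by move=> H; transitivity (K * K' * (a * b)); [ring|rewrite H; ring].
apply: aux; rewrite -!expRD; congr expR.
by field; rewrite !gt_eqF.
Qed.

Lemma one_step_le (f : E -> R) : measurable_fun setT f ->
  (forall x, 0 <= f x <= 1) ->
  (\int[mu0]_x \int[@gauss R d]_z (f (euler_step h x z))%:E <=
   \int[mu0]_x (f x)%:E +
   \int[mu0]_x \int[@gauss R d]_z `|balance_error h x (euler_step h x z)|%:E)%E.
Proof.
move=> mf f01.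
have f0 x : 0 <= f x by case/andP: (f01 x).
have [c c0 cE] := gibbs_integral (potential_continuous dV) mu0V.
pose rho x := c * gibbs_weight V sigma0 x.
have rho0 x : 0 <= rho x by rewrite mulr_ge0// ltW// gibbs_weight_gt0.
have mrho : measurable_fun setT rho.
  apply: measurable_funM => //; apply: measurable_gibbs_weight.
  exact: potential_continuous.
pose a (x y : E) := rho x * prop x y.
have a0 x y : 0 <= a x y by rewrite mulr_ge0.
have ma : measurable_fun setT (fun p : E * E => a p.1 p.2).
  by apply: measurable_funM => //; exact: (measurableT_comp mrho measurable_fst).
(* Under mu0, the pair of a point and its Euler step has the density [a]. *)
have pair_integral (k : E * E -> R) : measurable_fun setT k -> (forall p, 0 <= k p) ->
  (\int[mu0]_x \int[@gauss R d]_z (k (x, euler_step h x z))%:E =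
   \int[leb]_x \int[leb]_y (k (x, y) * a x y)%:E)%E.
  move=> mk k0.
  have mkx x : measurable_fun setT (fun y => (k (x, y))%:E).
    by apply/measurable_EFinP; exact: (measurableT_comp mk (measurable_pair1 x)).
  have mkp : measurable_fun setT (fun p : E * E => (k p * prop p.1 p.2)%:E).
    by apply/measurable_EFinP; exact: measurable_funM.
  under eq_integral => x _ do rewrite (integral_step x (mkx x) (fun y => k0 _)).
  rewrite cE; last 2 first.
  - by apply: (measurable_fun_fubini_tonelli_F _ mkp) => p; rewrite lee_fin mulr_ge0.
  - by move=> x; apply: integral_ge0 => y _; rewrite mule_ge0// lee_fin.
  apply: eq_integral => x _; rewrite muleC -ge0_integralZl//; last 3 first.
  - exact: (measurableT_comp mkp (measurable_pair1 x)).
  - by move=> y _; rewrite mule_ge0// lee_fin.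
  - by rewrite lee_fin; exact: rho0.
  by apply: eq_integral => y _; rewrite -!EFinM mulrCA.
have mfs : measurable_fun setT (fun p : E * E => f p.2).
  exact: (measurableT_comp mf measurable_snd).
have mff : measurable_fun setT (fun p : E * E => f p.1).
  exact: (measurableT_comp mf measurable_fst).
have mabs : measurable_fun setT (fun p : E * E => `|balance_error h p.1 p.2|).
  by apply: measurableT_comp => //; exact: measurable_balance_error.
rewrite (pair_integral (fun p => f p.2))//.
rewrite (pair_integral (fun p => `|balance_error h p.1 p.2|))//.
(* As [prop y] has total mass 1, an extra variable x may be integrated in for free. After exchanging
   the order of integration, both sides are double integrals of f y, against a x y and a y x, which
   [balance] compares pointwise. *)
have -> : (\int[mu0]_x (f x)%:E = \int[leb]_x \int[leb]_y (f y * a y x)%:E)%E.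
  have mfa : measurable_fun setT (fun p : E * E => (f p.1 * a p.1 p.2)%:E).
    by apply/measurable_EFinP; exact: measurable_funM.
  rewrite -(fubini_tonelli (fun p : E * E => (f p.1 * a p.1 p.2)%:E))//; last first.
    by move=> p; rewrite lee_fin mulr_ge0.
  rewrite -(pair_integral (fun p => f p.1))//.
  apply: eq_integral => x _; transitivity ((f x)%:E * @gauss R d setT)%E.
    by rewrite probability_setT mule1.
  by rewrite -integral_cst.
have m1 : measurable_fun setT (fun p : E * E => (f p.2 * a p.2 p.1)%:E).
  have mswap : measurable_fun setT (fun p : E * E => (p.2, p.1)).
    by apply: measurable_fun_pair; [exact: measurable_snd|exact: measurable_fst].
  apply/measurable_EFinP; apply: measurable_funM; first exact: mfs.
  exact: (measurableT_comp ma mswap).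
have m2 : measurable_fun setT
    (fun p : E * E => (`|balance_error h p.1 p.2| * a p.1 p.2)%:E).
  by apply/measurable_EFinP; apply: measurable_funM; [exact: mabs|exact: ma].
have m3 : measurable_fun setT (fun p : E * E => (f p.2 * a p.1 p.2)%:E).
  by apply/measurable_EFinP; apply: measurable_funM; [exact: mfs|exact: ma].
rewrite -ge0_integralD//; last 4 first.
- by move=> x _; apply: integral_ge0 => y _; rewrite lee_fin mulr_ge0.
- by apply: (measurable_fun_fubini_tonelli_F _ m1) => p; rewrite lee_fin mulr_ge0.
- by move=> x _; apply: integral_ge0 => y _; rewrite lee_fin mulr_ge0.
- by apply: (measurable_fun_fubini_tonelli_F _ m2) => p; rewrite lee_fin mulr_ge0.
apply: ge0_le_integral => //.
- by move=> x _; apply: integral_ge0 => y _; rewrite lee_fin mulr_ge0.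
- by apply: (measurable_fun_fubini_tonelli_F _ m3) => p; rewrite lee_fin mulr_ge0.
- apply: emeasurable_funD; first by apply: (measurable_fun_fubini_tonelli_F _ m1) => p; rewrite lee_fin mulr_ge0.
  by apply: (measurable_fun_fubini_tonelli_F _ m2) => p; rewrite lee_fin mulr_ge0.
move=> x _; rewrite -ge0_integralD//; last 4 first.
- by move=> y _; rewrite lee_fin mulr_ge0.
- exact: (measurableT_comp m1 (measurable_pair1 x)).
- by move=> y _; rewrite lee_fin mulr_ge0.
- exact: (measurableT_comp m2 (measurable_pair1 x)).
apply: ge0_le_integral => //.
- by move=> y _; rewrite lee_fin mulr_ge0.
- exact: (measurableT_comp m3 (measurable_pair1 x)).
- apply: emeasurable_funD; first exact: (measurableT_comp m1 (measurable_pair1 x)).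
  exact: (measurableT_comp m2 (measurable_pair1 x)).
move=> y _; rewrite -EFinD lee_fin.
have -> : a y x = a x y * expR (- balance_error h x y).
  by rewrite /a /rho -mulrA (balance x y) !mulrA.
set D := balance_error h x y.
have /andP[fy0 fy1] := f01 y.
have e1 : 1 - `|D| <= expR (- D).
  rewrite (le_trans _ (expR_ge1Dx _))// lerD2l lerN2; exact: ler_norm.
have aD : f y * a x y * (1 - `|D|) <= f y * a x y * expR (- D).
  by rewrite ler_wpM2l// mulr_ge0.
have : f y * (`|D| * a x y) <= `|D| * a x y by rewrite ler_piMl// mulr_ge0.
by move: aD; rewrite mulrBr mulr1 !mulrA; lra.
Qed.

End euler_step.

Lemma eq_ler (R : numDomainType) (x y : R) : x = y -> x <= y.
Proof. by move=> ->. Qed.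

Ltac nonneg := repeat first
  [ done | exact: ltW | exact: sqr_ge0 | exact: enorm_ge0 | exact: normr_ge0
  | apply: addr_ge0 | apply: mulr_ge0 | rewrite invr_ge0 ].

(** * The balance error is of smaller order than the step *)

Section balance_limit.
Context {R : realType} {d : nat} (V : 'rV[R]_d -> R) (sigma0 LV t : R).
Local Notation E := 'rV[R]_d.
Hypotheses (dV : forall x, differentiable V x)
  (dgV : forall x, differentiable (grad V) x) (s0 : 0 < sigma0) (LV0 : 0 <= LV)
  (VL : forall x y, enorm (grad V x - grad V y) <= LV * enorm (x - y)) (t0 : 0 < t).

Let i2 : R := sigma0 ^- 2.

Let i20 : 0 <= i2.
Proof. by rewrite invr_ge0 sqr_ge0. Qed.

Lemma balance_error_le (h : R) (x u : E) : 0 <= h ->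
  `|balance_error V sigma0 h x (x + u)| <=
  2 * i2 * `|trapezoid_error V x (x + u)| +
  h / 2 * i2 * (LV * enorm u * (2 * enorm (grad V x) + LV * enorm u)).
Proof.
move=> h0; rewrite /balance_error (le_trans (ler_normB _ _))//.
rewrite lerD//.
  by rewrite normrM ger0_norm// mulr_ge0.
rewrite normrM ger0_norm ?mulr_ge0 ?invr_ge0 ?mulr_ge0 ?sqr_ge0 ?(ltW s0)//.
rewrite invfM [h * (2^-1 * _)]mulrA -/i2 ler_wpM2l ?mulr_ge0//.
set g := grad V x; set g' := grad V (x + u).
have -> : dotv g g - dotv g' g' = dotv (g - g') (g + g').
  by rewrite dotvDl !dotvDr !dotvNl (dotvC g' g); ring.
have gg : enorm (g - g') <= LV * enorm u.
  by rewrite (le_trans (VL _ _))// opprD addrA subrr add0r enormN.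
rewrite (le_trans (abs_dotv_le _ _))// ler_pM ?enorm_ge0//.
(* Written in this way, the sum involves the gradient at the starting point x and the Lipschitz
   difference alone. *)
have -> : g + g' = g + g - (g - g') by rewrite opprB [g' - g]addrC addrA addrK.
rewrite (le_trans (enormD _ _))// enormN lerD//.
by rewrite (le_trans (enormD _ _))// mulr_natl mulr2n.
Qed.

(** [h * M x z] bounds the squared length of an Euler increment; using h <= t for one factor of h^2
    makes M independent of h. *)
Let M (x z : E) : R := 2 * t * enorm (grad V x) ^+ 2 + 2 * sigma0 ^+ 2 * enorm z ^+ 2.

Let M0 x z : 0 <= M x z.
Proof. by rewrite addr_ge0// !mulr_ge0 ?enorm_ge0 ?(ltW t0) ?(ltW s0). Qed.

Let incr (h : R) (x z : E) : E := - (h *: grad V x) + (sigma0 * Num.sqrt h) *: z.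

Let incrE h x z : euler_step V sigma0 h x z = x + incr h x z.
Proof. by rewrite /euler_step addrA. Qed.

Let incr_le h x z : 0 < h <= t -> enorm (incr h x z) ^+ 2 <= h * M x z.
Proof.
move=> /andP[h0 ht]; rewrite (le_trans (sqr_enormD _ _))// enormN !enormZ !exprMn.
rewrite !real_normK ?num_real// exprMn (sqr_sqrtr (ltW h0)).
rewrite /M mulrDr lerD//; last by apply: eq_ler; ring.
have -> : h * (2 * t * enorm (grad V x) ^+ 2) = 2 * (h * t * enorm (grad V x) ^+ 2) by ring.
by rewrite ler_wpM2l// ler_wpM2r ?sqr_ge0// expr2 ler_wpM2l// ltW.
Qed.

(** [c1] and [c2] are the coefficients of |grad V x|^2 and |z|^2 after expanding M in 4 i2 LV M +
    i2/2 (LV (t M + |grad V x|^2) + LV^2 t M), a bound of |D| / h valid for all h <= t. *)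
Let c1 : R := 4 * i2 * LV * (2 * t) + 2^-1 * i2 * (LV * (t * (2 * t) + 1) + LV ^+ 2 * (t * (2 * t))).
Let c2 : R := 4 * i2 * LV * (2 * sigma0 ^+ 2) +
  2^-1 * i2 * (LV * (t * (2 * sigma0 ^+ 2)) + LV ^+ 2 * (t * (2 * sigma0 ^+ 2))).

Let c10 : 0 <= c1.
Proof.
by rewrite /c1; nonneg.
Qed.

Let c20 : 0 <= c2.
Proof.
by rewrite /c2; nonneg.
Qed.

(** The domination: the bound is linear in h, so that n+1 steps of length t / (n+1) cost at most t
    times a quadratic function of grad V x and z. *)
Let balance_error_bound h x z : 0 < h <= t ->
  `|balance_error V sigma0 h x (euler_step V sigma0 h x z)| <=
  h * (c1 * enorm (grad V x) ^+ 2 + c2 * enorm z ^+ 2).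
Proof.
move=> /andP[h0 ht]; rewrite incrE (le_trans (balance_error_le _ _ (ltW h0)))//.
have := @incr_le h x z; rewrite h0 ht => /(_ isT).
set u := incr h x z; set e := enorm u; set g := enorm (grad V x) => eM.
have e0 : 0 <= e by exact: enorm_ge0.
have := trapezoid_error_le dV LV0 VL x u; rewrite -/e.
set T := `|_| => Te.
have eM2 : e ^+ 2 <= t * M x z by rewrite (le_trans eM)// ler_wpM2r.
have h1 : 2 * i2 * T <= h * (4 * i2 * LV * M x z).
  rewrite (@le_trans _ _ (2 * i2 * (2 * LV * (h * M x z))))//.
    rewrite ler_wpM2l ?mulr_ge0// (le_trans Te)// ler_wpM2l ?mulr_ge0//.
  by apply: eq_ler; ring.
have h2 : LV * e * (2 * g + LV * e) <= LV * (t * M x z + g ^+ 2) + LV ^+ 2 * (t * M x z).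
  rewrite (_ : LV * e * _ = LV * (2 * e * g) + LV ^+ 2 * e ^+ 2); last by ring.
  rewrite lerD ?ler_wpM2l ?sqr_ge0//.
  by have := sqr_ge0 (e - g); rewrite sqrrB; lra.
rewrite (le_trans (lerD h1 (ler_wpM2l _ h2)))//.
  by rewrite !mulr_ge0// ltW.
apply: eq_ler.
by rewrite /c1 /c2 /M -/g; field.
Qed.

(** Pointwise limit: for fixed x and z the increment has length of order sqrt h, so the trapezoid
    error is o(h), and the squared gradients contribute h times a quantity that tends to 0. *)
Let balance_error_cvg x z :
  (n.+1%:R * `|balance_error V sigma0 (t / n.+1%:R) x
      (euler_step V sigma0 (t / n.+1%:R) x z)|) @[n --> \oo] --> (0 : R).
Proof.
apply/cvgrPdist_le => e e0.
pose g := enorm (grad V x).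
have g0 : 0 <= g by exact: enorm_ge0.
(* K1 and K2 are the factors of the two contributions to the error, each of which is allotted e / 2;
   adding 1 makes them positive divisors. *)
pose K1 := t * (2 * i2) * M x z + 1.
have K10 : 0 < K1.
  by rewrite ltr_pwDr//; nonneg.
pose K2 := t / 2 * i2 * (LV * (2 * g + LV)) + 1.
have K20 : 0 < K2.
  by rewrite ltr_pwDr//; nonneg.
have e10 : 0 < e / 2 / K1 by rewrite !divr_gt0.
have e20 : 0 < e / 2 / K2 by rewrite !divr_gt0.
have [r r0 rP] := trapezoid_error_peano dV dgV x e10.
(* Bound on the increment u: below r for the Peano estimate, below 1 to replace LV |u| by LV in one
   factor, below the last term to make the remaining factor |u| small. *)
pose eta := Num.min r (Num.min 1 (e / 2 / K2)).
have eta0 : 0 < eta by rewrite !lt_min r0 ltr01.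
near=> n.
pose h := t / n.+1%:R.
have h0 : 0 < h <= t.
  by rewrite divr_gt0//= ler_pdivrMr// ler_peMr ?(ltW t0) ?ler1n.
have ueta : enorm (incr h x z) < eta.
  rewrite -(@ltr_pXn2r _ 2)// ?nnegrE ?enorm_ge0 ?ltW//.
  rewrite (le_lt_trans (incr_le x z h0))// /h mulrAC ltr_pdivrMr//.
  rewrite -ltr_pdivrMl ?exprn_gt0// (lt_trans (truncnS_gt _))// ltr_nat ltnS.
  by near: n; exact: nbhs_infty_gt.
move: ueta; rewrite !lt_min => /and3P[ur u1 uK].
rewrite -/h sub0r normrN ger0_norm ?mulr_ge0// incrE.
set u := incr _ _ _ in ur u1 uK *.
have hn : n.+1%:R = t / h :> R by rewrite /h invf_div mulrCA divff ?mulr1// gt_eqF.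
have /andP[h00 _] := h0.
rewrite [X in X * _]hn mulrAC ler_pdivrMr//.
rewrite (@le_trans _ _ (t * (2 * i2 * (e / 2 / K1 * (h * M x z)) +
    h / 2 * i2 * (LV * enorm u * (2 * g + LV)))))//.
  rewrite ler_wpM2l ?(ltW t0)// (le_trans (balance_error_le _ _ (ltW h00)))//.
  apply: lerD.
    apply: ler_wpM2l; first by nonneg.
    by rewrite (le_trans (rP _ ur))// ler_wpM2l ?(ltW e10)// incr_le.
  apply: ler_wpM2l; first by nonneg.
  apply: ler_wpM2l; first by nonneg.
  by rewrite lerD2l ler_piMr// ltW.
have a1 : e / 2 / K1 * (t * (2 * i2) * M x z) <= e / 2.
  rewrite -mulrA ler_piMr ?divr_ge0 ?(ltW e0)// ler_pdivrMl// mulr1 /K1.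
  by rewrite lerDl.
have a2 : enorm u * (t / 2 * i2 * (LV * (2 * g + LV))) <= e / 2.
  rewrite (@le_trans _ _ (e / 2 / K2 * (t / 2 * i2 * (LV * (2 * g + LV)))))//.
    by rewrite ler_wpM2r ?(ltW uK)//; nonneg.
  rewrite -mulrA ler_piMr ?divr_ge0 ?(ltW e0)// ler_pdivrMl// mulr1 /K2.
  by rewrite lerDl.
have : h * (e / 2 / K1 * (t * (2 * i2) * M x z) +
   enorm u * (t / 2 * i2 * (LV * (2 * g + LV)))) <= h * e.
  by rewrite ler_wpM2l ?(ltW h00)//; lra.
by rewrite [e * h]mulrC; apply: le_trans; apply: eq_ler; ring.
Unshelve. all: by end_near. Qed.

Variable mu0 : probability E R.
Hypothesis mu0_moment : (\int[mu0]_x (dotv x x)%:E < +oo)%E.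

(** The accumulated expected error of n+1 steps under mu0, by dominated convergence on the product
    of mu0 and [gauss]. *)
Lemma balance_error_cvg0 :
  (n.+1%:R%:E * \int[mu0]_x \int[@gauss R d]_z
    `|balance_error V sigma0 (t / n.+1%:R) x
        (euler_step V sigma0 (t / n.+1%:R) x z)|%:E)%E @[n --> \oo] --> 0%E.
Proof.
pose f_ n (p : E * E) := (n.+1%:R * `|balance_error V sigma0 (t / n.+1%:R) p.1
        (euler_step V sigma0 (t / n.+1%:R) p.1 p.2)|)%:E.
have f_0 n p : (0 <= f_ n p)%E by rewrite lee_fin mulr_ge0.
have mab n : measurable_fun setT (fun p : E * E => `|balance_error V sigma0
    (t / n.+1%:R) p.1 (euler_step V sigma0 (t / n.+1%:R) p.1 p.2)|).
  apply: measurableT_comp => //.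
  have mp : measurable_fun setT (fun p : E * E =>
      (p.1, euler_step V sigma0 (t / n.+1%:R) p.1 p.2)).
    apply: measurable_fun_pair; first exact: measurable_fst.
    exact: measurable_euler_step.
  exact: (measurableT_comp (measurable_balance_error sigma0 dV dgV _) mp).
have mf n : measurable_fun setT (f_ n).
  by apply/measurable_EFinP; apply: measurable_funM.
(* Sum of the coefficients left in [balance_error_bound] after |grad V x|^2 <= 2 |grad V 0|^2 + 2
   LV^2 |x|^2; hence the dominating function t K (1 + |x|^2 + |z|^2), integrable by the second
   moments. *)
pose K := c1 * (2 * enorm (grad V 0) ^+ 2) + c1 * (2 * LV ^+ 2) + c2.
have K0 : 0 <= t * K.
  by rewrite /K; nonneg.
pose G (p : E * E) := ((t * K) * (1 + dotv p.1 p.1 + dotv p.2 p.2))%:E.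
have G0 p : (0 <= G p)%E by rewrite lee_fin mulr_ge0// !addr_ge0 ?dotv_ge0.
have mG : measurable_fun setT G.
  apply/measurable_EFinP; apply: measurable_funM => //; apply: measurable_funD.
    apply: measurable_funD => //.
    exact: (measurableT_comp (@measurable_dotv R d) measurable_fst).
  exact: (measurableT_comp (@measurable_dotv R d) measurable_snd).
have mdz : measurable_fun setT (fun z : E => (dotv z z)%:E).
  by apply/measurable_EFinP; exact: measurable_dotv.
have GE : (\int[mu0 \x @gauss R d]_p G p < +oo)%E.
  rewrite fubini_tonelli1//.
  pose mZ := fine (\int[@gauss R d]_z (dotv z z)%:E).
  have mZE : (\int[@gauss R d]_z (dotv z z)%:E = mZ%:E)%E.
    by rewrite fineK// ge0_fin_numE ?gauss_moment// integral_ge0// => z _; rewrite lee_fin dotv_ge0.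
  have mZ0 : 0 <= mZ by rewrite fine_ge0// integral_ge0// => z _; rewrite lee_fin dotv_ge0.
  have E1 x : (fubini_F (@gauss R d) G x = ((t * K) * (1 + mZ))%:E + (t * K)%:E * (dotv x x)%:E)%E.
    rewrite /fubini_F /G/=.
    under eq_integral do rewrite EFinM EFinD.
    rewrite ge0_integralZl//; last 2 first.
    - by apply: emeasurable_funD.
    - by move=> z _; rewrite adde_ge0// lee_fin ?addr_ge0 ?dotv_ge0.
    rewrite ge0_integralD//; last 2 first.
    - by move=> z _; rewrite lee_fin addr_ge0 ?dotv_ge0.
    - by move=> z _; rewrite lee_fin dotv_ge0.
    have -> : (\int[@gauss R d]_z (1 + dotv x x)%:E = (1 + dotv x x)%:E * @gauss R d setT)%E.
      by rewrite -integral_cst.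
    rewrite gauss_setT mule1 mZE.
    transitivity ((t * K) * (1 + dotv x x + mZ))%:E => //.
    by transitivity ((t * K) * (1 + mZ) + (t * K) * dotv x x)%:E => //; congr EFin; ring.
  under eq_integral do rewrite E1.
  rewrite ge0_integralD//; last 3 first.
  - by move=> x _; rewrite lee_fin mulr_ge0// addr_ge0.
  - by move=> x _; rewrite mule_ge0// lee_fin dotv_ge0.
  - by apply: emeasurable_funM.
  rewrite ge0_integralZl//; last by move=> x _; rewrite lee_fin dotv_ge0.
  have -> : (\int[mu0]_x ((t * K) * (1 + mZ))%:E = ((t * K) * (1 + mZ))%:E * mu0 setT)%E.
    by rewrite -integral_cst.
  by rewrite probability_setT mule1 lte_add_pinfty ?ltry// lte_mul_pinfty.
have -> : (fun n => (n.+1%:R%:E * \int[mu0]_x \int[@gauss R d]_z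
    `|balance_error V sigma0 (t / n.+1%:R) x
        (euler_step V sigma0 (t / n.+1%:R) x z)|%:E)%E) =
    (fun n => \int[mu0 \x @gauss R d]_p f_ n p)%E.
  apply/funext => n; rewrite fubini_tonelli1// -ge0_integralZl//; last 2 first.
  - have mabE : measurable_fun setT (fun p : E * E => (`|balance_error V sigma0
      (t / n.+1%:R) p.1 (euler_step V sigma0 (t / n.+1%:R) p.1 p.2)|)%:E).
      by apply/measurable_EFinP; exact: mab.
    by apply: (measurable_fun_fubini_tonelli_F _ mabE) => p; rewrite lee_fin.
  - by move=> x _; apply: integral_ge0.
  apply: eq_integral => x _; rewrite -ge0_integralZl//; last first.
    by apply/measurable_EFinP; exact: (measurableT_comp (mab n) (measurable_pair1 x)).
have -> : 0%E = (\int[mu0 \x @gauss R d]_p (cst 0 p))%E :> \bar R by rewrite integral0.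
apply: (@dominated_cvg _ _ _ _ setT measurableT f_ (cst 0) G) => //.
- move=> [x z] _; apply: cvg_EFin; first exact: nearW.
  exact: balance_error_cvg.
- apply/integrableP; split => //.
  by under eq_integral do rewrite gee0_abs//.
- move=> n [x z] _; rewrite gee0_abs// lee_fin.
  have h0 : 0 < t / n.+1%:R <= t.
    by rewrite divr_gt0//= ler_pdivrMr// ler_peMr ?(ltW t0) ?ler1n.
  have := balance_error_bound x z h0.
  set B := `|_| => HB.
  rewrite (@le_trans _ _ (t * (c1 * enorm (grad V x) ^+ 2 + c2 * enorm z ^+ 2)))//.
    rewrite (le_trans (ler_wpM2l _ HB))//.
    by apply: eq_ler; rewrite mulrA mulrCA divff ?mulr1.
  rewrite -mulrA ler_wpM2l ?(ltW t0)// -!sqr_enorm.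
  have gx : enorm (grad V x) ^+ 2 <= 2 * enorm (grad V 0) ^+ 2 + 2 * LV ^+ 2 * enorm x ^+ 2.
    have H := enorm_grad_le VL x; have H0 := enorm_ge0 (grad V x).
    rewrite (@le_trans _ _ ((enorm (grad V 0) + LV * enorm x) ^+ 2))//.
      by rewrite ler_pXn2r// nnegrE (le_trans H0 H).
    by have := sqr_ge0 (enorm (grad V 0) - LV * enorm x); rewrite !sqrrD !exprMn sqrrN mulrN mulNrn; lra.
  have := ler_wpM2l c10 gx => {}gx.
  have X0 := sqr_ge0 (enorm x); have Z0 := sqr_ge0 (enorm z).
  rewrite (le_trans (lerD gx (lexx _)))//.
  pose A := c1 * (2 * enorm (grad V 0) ^+ 2).
  pose B' := c1 * (2 * LV ^+ 2).
  have A0 : 0 <= A by rewrite /A; nonneg.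
  have B0 : 0 <= B' by rewrite /B'; nonneg.
  have -> : c1 * (2 * enorm (grad V 0) ^+ 2 + 2 * LV ^+ 2 * enorm x ^+ 2) = A + B' * enorm x ^+ 2.
    by rewrite /A /B'; ring.
  rewrite /K -/A -/B'.
  have := mulr_ge0 A0 X0; have := mulr_ge0 A0 Z0; have := mulr_ge0 B0 X0.
  have := mulr_ge0 B0 Z0; have := mulr_ge0 c20 X0; have := mulr_ge0 c20 Z0.
  by have := c20; nra.
Qed.

End balance_limit.

(** * Convergence of the Euler scheme *)

Section euler_scheme.
Context {R : realType} {d : nat}.
Local Notation E := 'rV[R]_d.
Local Notation mu := (@lebesgue_measure R).

(** Deterministic scheme for z_t = z_0 + integral of (F (z_s) + c_s) + w_t: [c] is a forcing known
    in advance, and [w] is the path of the noise, whose increments are added exactly. *)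
Fixpoint euler (F : E -> E) (c w : R -> E) (h : R) (z0 : E) (k : nat) : E :=
  if k is k'.+1 then
    let e := euler F c w h z0 k' in
    e + h *: (F e + c (k'%:R * h)) + (w (k'.+1%:R * h) - w (k'%:R * h))
  else z0.

Lemma integrable_cst_itv (a b r : R) : mu.-integrable `]a, b] (EFin \o cst r).
Proof.
apply/integrableP; split; first by apply/measurable_EFinP.
rewrite [X in (X < _)%E](_ : _ = (`|r|%:E * mu `]a, b])%E); last first.
  by rewrite -integral_cst.
rewrite lebesgue_measure_itv/=.
by case: ifP => _; rewrite -?EFinD ?mule0 ?ltry// -EFinM ltry.
Qed.

(** Uniform continuity on [0, t], from the near-covering form of compactness. *)
Lemma within_continuous_unif (f : R -> E) (t : R) :
  {within `[0, +oo[, continuous f} -> forall e, 0 < e ->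
  exists2 r : R, 0 < r & forall x y, 0 <= x <= t -> 0 <= y <= t ->
    `|x - y| < r -> `|f x - f y| <= e.
Proof.
move=> cf e e0.
have e20 : 0 < e / 2 by rewrite divr_gt0.
have cfe x : 0 <= x -> exists2 r : R, 0 < r &
    forall y, 0 <= y -> `|x - y| < r -> `|f x - f y| <= e / 2.
  move=> x0; have xI : (`[0, +oo[%classic : set R) x by rewrite /= in_itv/= x0.
  have /subspace_continuousP/(_ x xI)/cvgrPdist_le/(_ _ e20) := cf.
  rewrite near_withinE => /nbhs_ballP[r /= r0 rP]; exists r => // y y0 xy.
  by apply: (rP y) => //; rewrite /= in_itv/= y0.
have /compact_near_coveringP/near_covering_withinP := @segment_compact R 0 t.
move=> /(_ R 0^'+ (fun r x => forall y, 0 <= y <= t -> `|x - y| < r -> `|f x - f y| <= e)).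
case.
- move=> x /=; rewrite in_itv/= => /andP[x0 xt].
  have [r r0 rP] := cfe x x0.
  have r20 : 0 < r / 2 by rewrite divr_gt0.
  exists (ball x (r / 2), [set s | 0 < s < r / 2]) => /=.
    split; first exact: nbhsx_ballx.
    near=> s; apply/andP; split; near: s; [exact: nbhs_right_gt|exact: nbhs_right_lt].
  move=> [x' s] /= [xx' /andP[s0 sr]]; rewrite in_itv/= => /andP[x'0 x't] y /andP[y0 yt] x'y.
  have h1 := rP x' x'0 (lt_trans xx' _).
  have h2 : `|f x - f y| <= e / 2.
    apply: rP => //; rewrite -(subrKA x') (le_lt_trans (ler_normD _ _))//.
    by rewrite [ltRHS]splitr ltrD// (lt_trans x'y).
  rewrite -(subrKA (f x)) (le_trans (ler_normD _ _))// [leRHS]splitr lerD//.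
  by rewrite distrC h1// ltr_pdivrMr// ltr_pMr// ltr1n.
- move=> r0 /= r00 rP.
  have r20 : 0 < r0 / 2 by rewrite divr_gt0.
  exists (r0 / 2) => // x y xt yt xy.
  apply: (rP (r0 / 2)) => //=.
  by rewrite sub0r normrN gtr0_norm// ltr_pdivrMr// ltr_pMr// ltr1n.
Unshelve. all: by end_near. Qed.

Variables (F : E -> E) (L : R) (c w z : R -> E).
Hypotheses (L0 : 0 <= L) (FL : forall x y, `|F x - F y| <= L * `|x - y|)
  (cz : {within `[0, +oo[, continuous z})
  (cc : {within `[0, +oo[, continuous c})
  (zE : forall t, 0 <= t -> forall i,
    mu.-integrable `[0, t] (EFin \o (fun s => (F (z s) + c s) 0 i)) /\
    z t 0 i = z 0 0 i + Rintegral mu `[0, t] (fun s => (F (z s) + c s) 0 i) + w t 0 i).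

Let beta s := F (z s) + c s.

Let beta_unif (t : R) e : 0 < e -> exists2 r : R, 0 < r &
  forall x y, 0 <= x <= t -> 0 <= y <= t -> `|x - y| < r -> `|beta x - beta y| <= e.
Proof.
move=> e0; have e20 : 0 < e / 2 by rewrite divr_gt0.
have e30 : 0 < e / 2 / (L + 1) by rewrite divr_gt0// ltr_pwDr.
have [r1 r10 r1P] := within_continuous_unif t cz e30.
have [r2 r20 r2P] := within_continuous_unif t cc e20.
exists (Num.min r1 r2); first by rewrite lt_min r10.
move=> x y xt yt; rewrite lt_min => /andP[xy1 xy2].
rewrite /beta opprD addrACA (le_trans (ler_normD _ _))// [leRHS]splitr.
apply: lerD; last exact: r2P.
rewrite (le_trans (FL _ _))// (le_trans (ler_wpM2l L0 (r1P _ _ xt yt xy1)))//.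
by rewrite mulrCA ler_piMr ?(ltW e20)// ler_pdivrMr ?mul1r ?lerDl// ltr_pwDr.
Qed.

Let increment (a b e : R) : 0 <= a -> a <= b ->
  (forall s, a <= s <= b -> `|beta s - beta a| <= e) -> 0 <= e ->
  `|z b - z a - (b - a) *: beta a - (w b - w a)| <= (b - a) * e.
Proof.
move=> a0 ab be e0; apply: norm_le_coord.
  by rewrite mulr_ge0// subr_ge0.
move=> i.
have [_ za] := zE a0 i; have [ib zb] := zE (le_trans a0 ab) i.
have iab : mu.-integrable `]a, b] (EFin \o (fun s => beta s 0 i)).
  apply: integrableS ib => //; apply: subset_itvr; by rewrite bnd_simp.
have iz : mu.-integrable `]a, b] (EFin \o cst (beta a 0 i)).
  exact: integrable_cst_itv.
have iB : mu.-integrable `]a, b] (EFin \o (fun s => beta s 0 i - beta a 0 i)).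
  by have := @integrableB _ _ _ mu `]a, b] (measurable_itv _) _ _ iab iz.
have lab : fine (mu `]a, b]) = b - a.
  rewrite lebesgue_measure_itv/= lte_fin; case: ltP => //= ba.
  by apply/esym/eqP; rewrite subr_eq0 eq_le ba ab.
have E1 : (z b - z a - (b - a) *: beta a - (w b - w a)) 0 i =
    Rintegral mu `]a, b] (fun s => beta s 0 i - beta a 0 i).
  rewrite RintegralB// Rintegral_cst// lab.
  rewrite -(@Rintegral_itvB _ _ (BLeft 0) (BRight b) a)//.
  by rewrite !mxE za zb; ring.
rewrite E1 (le_trans (le_normr_Rintegral _ _))//.
apply: (@le_trans _ _ (Rintegral mu `]a, b] (cst e))).
  apply: le_Rintegral => //.
  - exact: (integrable_abse iB).
  - exact: integrable_cst_itv.
  move=> s /=; rewrite in_itv/= => /andP[as_ sb].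
  have := coord_le_norm (beta s - beta a) i; rewrite !mxE => /le_trans; apply.
  by apply: be; rewrite (ltW as_).
by rewrite Rintegral_cst// lab mulrC.
Qed.

(** The exact path z is given, and its drift is uniformly continuous on [0, t]. Freezing the drift
    at the start of a step costs at most h eta, and the Lipschitz constant propagates these local
    errors to t eta exp (L t) in total. *)
Lemma euler_cvg t : 0 <= t ->
  euler F c w (t / n.+1%:R) (z 0) n.+1 @[n --> \oo] --> z t.
Proof.
move=> t0; apply/cvgrPdist_le => e e0.
(* Chosen so that t eta exp (L t) <= e; the added 1 covers t = 0. *)
pose eta := e / (t * expR (L * t) + 1).
have D0 : 0 < t * expR (L * t) + 1 by rewrite ltr_pwDr// mulr_ge0// expR_ge0.
have eta0 : 0 < eta by rewrite divr_gt0.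
have [r r0 rP] := beta_unif t eta0.
near=> n.
pose h := t / n.+1%:R.
have h0 : 0 <= h by rewrite divr_ge0.
have hr : h < r.
  rewrite /h ltr_pdivrMr// -ltr_pdivrMl// (lt_trans (truncnS_gt _))// ltr_nat ltnS.
  by near: n; exact: nbhs_infty_gt.
have hn : n.+1%:R * h = t by rewrite /h mulrCA divff ?mulr1.
have kt k : (k <= n.+1)%N -> k%:R * h <= t.
  by move=> kn; rewrite -hn ler_wpM2r// ler_nat.
(* Discrete Gronwall inequality: the amplification 1 + h L of one step is at most exp (h L), which
   the exponential on the right gains from k to k+1. *)
have rec k : (k <= n.+1)%N ->
    `|z (k%:R * h) - euler F c w h (z 0) k| <= k%:R * h * eta * expR (L * (k%:R * h)).
  elim: k => [_|k IH kn]; first by rewrite !mul0r /= subrr normr0.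
  have {}IH := IH (ltnW kn).
  set e_k := euler F c w h (z 0) k in IH *.
  have kh0 : 0 <= k%:R * h by rewrite mulr_ge0.
  have kS : k.+1%:R * h - k%:R * h = h by rewrite -mulrBl -natrB// subSnn mul1r.
  have kkS : k%:R * h <= k.+1%:R * h by rewrite ler_wpM2r// ler_nat.
  have := @increment (k%:R * h) (k.+1%:R * h) eta kh0 kkS.
  rewrite kS => inc.
  have {}inc := inc _ (ltW eta0).
  rewrite [euler _ _ _ _ _ _]/= -/e_k.
  set zS := z (k.+1%:R * h) in inc *; set zk := z (k%:R * h) in inc IH *.
  have -> : zS - (e_k + h *: (F e_k + c (k%:R * h)) + (w (k.+1%:R * h) - w (k%:R * h))) =
     (zS - zk - h *: beta (k%:R * h) - (w (k.+1%:R * h) - w (k%:R * h))) +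
     (zk - e_k) + h *: (F zk - F e_k).
    rewrite /beta -/zk; apply/rowP => i; rewrite !mxE; ring.
  rewrite (le_trans (ler_normD _ _))//.
  rewrite (le_trans (lerD (ler_normD _ _) (lexx _)))//.
  have FE : `|h *: (F zk - F e_k)| <= h * L * `|zk - e_k|.
    by rewrite normrZ (ger0_norm h0) -mulrA ler_wpM2l.
  have {}inc : `|zS - zk - h *: beta (k%:R * h) - (w (k.+1%:R * h) - w (k%:R * h))| <= h * eta.
    apply: inc => s /andP[s1 s2]; apply: rP.
    - by rewrite (le_trans kh0 s1) (le_trans s2 (kt _ kn)).
    - by rewrite kh0 (kt _ (ltnW kn)).
    - rewrite ger0_norm ?subr_ge0// (le_lt_trans _ hr)//.
      by rewrite -[leRHS]kS lerB.
  rewrite (le_trans (lerD (lerD inc (lexx _)) FE))//.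
  set D := `|zk - e_k| in IH *.
  have ex1 : 1 <= expR (L * (k%:R * h)).
    by rewrite -[leLHS]expR0 ler_expR mulr_ge0.
  have exS : (1 + h * L) * expR (L * (k%:R * h)) <= expR (L * (k.+1%:R * h)).
    have -> : L * (k.+1%:R * h) = h * L + L * (k%:R * h).
      by rewrite -natr1; ring.
    by rewrite expRD ler_wpM2r ?expR_ge0// expR_ge1Dx.
  have ex2 : 1 <= expR (L * (k.+1%:R * h)).
    by rewrite -[leLHS]expR0 ler_expR mulr_ge0// mulr_ge0.
  have hL : 0 <= h * L by rewrite mulr_ge0.
  have HD : (1 + h * L) * D <= k%:R * h * eta * expR (L * (k.+1%:R * h)).
    rewrite (le_trans (ler_wpM2l _ IH)) ?addr_ge0//.
    rewrite mulrCA ler_wpM2l// mulr_ge0// ltW//.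
  have he : h * eta <= h * eta * expR (L * (k.+1%:R * h)).
    by rewrite ler_peMr// mulr_ge0// ltW.
  have -> : k.+1%:R * h * eta * expR (L * (k.+1%:R * h)) =
     h * eta * expR (L * (k.+1%:R * h)) + k%:R * h * eta * expR (L * (k.+1%:R * h)).
    by rewrite -natr1; ring.
  move: HD he; rewrite mulrDl mul1r; lra.
have := rec n.+1 (leqnn _); rewrite hn -/h => /le_trans; apply.
rewrite mulrAC /eta mulrA ler_pdivrMr// mulrC ler_wpM2l ?(ltW e0)//.
by rewrite lerDl.
Unshelve. all: by end_near. Qed.

End euler_scheme.

(** * Borel structure of the Wasserstein space *)

Section wasserstein_theory.
Context {R : realType} {d : nat}.
Local Notation E := 'rV[R]_d.
Local Notation P2 := (P2 R d).

Lemma measurable_sqr_enorm : measurable_fun setT (fun x : E => enorm x ^+ 2).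
Proof. by apply: measurable_funX; exact: measurable_enorm. Qed.

Lemma measurable_cost : measurable_fun setT (fun z : E * E => (enorm (z.1 - z.2) ^+ 2)%:E).
Proof.
apply/measurable_EFinP; apply: (measurableT_comp measurable_sqr_enorm).
apply: measurable_rV_add; first exact: measurable_fst.
by apply: measurable_rV_opp; exact: measurable_snd.
Qed.

Section coupling_integral.
Variables (m n : probability E R) (pi : probability (E * E)%type R).
Hypothesis pimn : coupling m n pi.

Lemma coupling_fst A : measurable A -> pushforward pi fst A = m A.
Proof.
move=> mA; rewrite -(pimn mA).1; congr (pi _).
by apply/seteqP; split => [x /=|x []].
Qed.

Lemma coupling_snd A : measurable A -> pushforward pi snd A = n A.
Proof.
move=> mA; rewrite -(pimn mA).2; congr (pi _).
by apply/seteqP; split => [x /=|x []].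
Qed.

Lemma ge0_coupling_fst (f : E -> \bar R) : measurable_fun setT f ->
  (forall x, 0 <= f x)%E -> (\int[m]_x f x = \int[pi]_z f z.1)%E.
Proof.
move=> mf f0.
have := ge0_integral_pushforward measurable_fst pi measurableT mf (fun x _ => f0 x).
rewrite preimage_setT => <-.
by apply: eq_measure_integral => A mA _; apply/esym/coupling_fst.
Qed.

Lemma ge0_coupling_snd (f : E -> \bar R) : measurable_fun setT f ->
  (forall x, 0 <= f x)%E -> (\int[n]_x f x = \int[pi]_z f z.2)%E.
Proof.
move=> mf f0.
have := ge0_integral_pushforward measurable_snd pi measurableT mf (fun x _ => f0 x).
rewrite preimage_setT => <-.
by apply: eq_measure_integral => A mA _; apply/esym/coupling_snd.
Qed.

Lemma coupling_integrable_fst (f : E -> R) : m.-integrable setT (EFin \o f) ->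
  pi.-integrable setT (fun z => (f z.1)%:E).
Proof.
move=> /integrableP[mf foo]; apply/integrableP; split.
  exact: (measurableT_comp mf measurable_fst).
rewrite -(ge0_coupling_fst (f := abse \o (EFin \o f)))//.
  exact: (measurableT_comp (@abse_measurable R setT) mf).
by move=> x; exact: abse_ge0.
Qed.

Lemma coupling_integrable_snd (f : E -> R) : n.-integrable setT (EFin \o f) ->
  pi.-integrable setT (fun z => (f z.2)%:E).
Proof.
move=> /integrableP[mf foo]; apply/integrableP; split.
  exact: (measurableT_comp mf measurable_snd).
rewrite -(ge0_coupling_snd (f := abse \o (EFin \o f)))//.
  exact: (measurableT_comp (@abse_measurable R setT) mf).
by move=> x; exact: abse_ge0.
Qed.

Lemma Rintegral_coupling_fst (f : E -> R) : m.-integrable setT (EFin \o f) ->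
  Rintegral m setT f = Rintegral pi setT (fun z => f z.1).
Proof.
move=> fi; have [mf _] := integrableP _ _ _ fi.
have := integral_pushforward measurable_fst mf (coupling_integrable_fst fi) measurableT.
rewrite preimage_setT /Rintegral /comp => <-; congr fine.
by apply: eq_measure_integral => A mA _; apply/esym/coupling_fst.
Qed.

Lemma Rintegral_coupling_snd (f : E -> R) : n.-integrable setT (EFin \o f) ->
  Rintegral n setT f = Rintegral pi setT (fun z => f z.2).
Proof.
move=> fi; have [mf _] := integrableP _ _ _ fi.
have := integral_pushforward measurable_snd mf (coupling_integrable_snd fi) measurableT.
rewrite preimage_setT /Rintegral /comp => <-; congr fine.
by apply: eq_measure_integral => A mA _; apply/esym/coupling_snd.
Qed.

End coupling_integral.

Lemma product_coupling (m n : probability E R) : coupling m n (m \x n)%E.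
Proof.
move=> A mA; split.
  by rewrite -[RHS]mule1 -(probability_setT n); exact: product_measure1E.
by rewrite -[RHS]mul1e -(probability_setT m); exact: product_measure1E.
Qed.

(** The product coupling has finite cost, so the infimum in [W2] is a real number and [fine] does
    not fall back on its default value. *)
Lemma product_cost (m n : P2) :
  (\int[m \x n]_z (enorm (z.1 - z.2) ^+ 2)%:E < +oo)%E.
Proof.
have mm : measurable_fun setT (fun x : E => (enorm x ^+ 2)%:E).
  by apply/measurable_EFinP; exact: measurable_sqr_enorm.
have m1 := measurableT_comp mm (@measurable_fst _ _ E E).
have m2 := measurableT_comp mm (@measurable_snd _ _ E E).
apply: (@le_lt_trans _ _ (\int[m \x n]_z ((2%:E * (enorm z.1 ^+ 2)%:E) +
   (2%:E * (enorm z.2 ^+ 2)%:E)))%E).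
  apply: ge0_le_integral => //.
  - by move=> z _; rewrite lee_fin sqr_ge0.
  - exact: measurable_cost.
  - by apply: emeasurable_funD; apply: measurable_funeM.
  move=> z _; rewrite -!EFinM -EFinD lee_fin.
  by rewrite (le_trans (sqr_enormD _ _))// enormN.
rewrite ge0_integralD//; last 4 first.
- by move=> z _; rewrite mule_ge0// lee_fin sqr_ge0.
- exact: measurable_funeM.
- by move=> z _; rewrite mule_ge0// lee_fin sqr_ge0.
- exact: measurable_funeM.
rewrite !ge0_integralZl//; last 2 first.
- by move=> z _; rewrite lee_fin sqr_ge0.
- by move=> z _; rewrite lee_fin sqr_ge0.
have mn := @product_coupling m n.
rewrite -(ge0_coupling_fst mn (f := fun x => (enorm x ^+ 2)%:E))//; last first.
  by move=> x; rewrite lee_fin sqr_ge0.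
rewrite -(ge0_coupling_snd mn (f := fun x => (enorm x ^+ 2)%:E))//; last first.
  by move=> x; rewrite lee_fin sqr_ge0.
by rewrite lte_add_pinfty// lte_mul_pinfty// ?lee_fin// P2_moment.
Qed.

Let costs (m n : P2) :=
  [set (\int[pi]_z (enorm (z.1 - z.2) ^+ 2)%:E)%E | pi in coupling m n].

Let costs_ge0 (m n : P2) : (0 <= ereal_inf (costs m n))%E.
Proof.
by apply: le_ereal_inf_tmp => _ [pi _ <-]; apply: integral_ge0 => z _; rewrite lee_fin sqr_ge0.
Qed.

Let costs_fin (m n : P2) : ereal_inf (costs m n) \is a fin_num.
Proof.
rewrite ge0_fin_numE ?costs_ge0//; apply: le_lt_trans (product_cost m n).
by apply: ereal_inf_lbound; exists (m \x n)%E => //; exact: product_coupling.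
Qed.

Lemma W2_lt_coupling (m n : P2) (e : R) : W2 m n < e ->
  exists2 pi, coupling m n pi &
    (\int[pi]_z (enorm (z.1 - z.2) ^+ 2)%:E < (e ^+ 2)%:E)%E.
Proof.
move=> mne.
have e0 : 0 < e by rewrite (le_lt_trans _ mne)// sqrtr_ge0.
have inf0 : 0 <= fine (ereal_inf (costs m n)) by rewrite fine_ge0// costs_ge0.
have : (ereal_inf (costs m n) < (e ^+ 2)%:E)%E.
  rewrite -(fineK (costs_fin m n)) lte_fin -[ltLHS]sqr_sqrtr//.
  by rewrite ltr_pXn2r// ?nnegrE ?sqrtr_ge0// ltW.
by move=> /ereal_inf_lt[_ [pi mnpi <-] pie]; exists pi.
Qed.

Lemma W2_le_coupling (m n : P2) (e : R) (pi : probability (E * E)%type R) :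
  0 <= e -> coupling m n pi ->
  (\int[pi]_z (enorm (z.1 - z.2) ^+ 2)%:E <= (e ^+ 2)%:E)%E -> W2 m n <= e.
Proof.
move=> e0 mnpi pie; rewrite -(ger0_norm e0) -sqrtr_sqr ler_sqrt ?sqr_ge0//.
rewrite -lee_fin fineK ?costs_fin// (le_trans _ pie)//.
by apply: ereal_inf_lbound; exists pi.
Qed.

Definition lipschitz (K : R) (f : E -> R) :=
  forall x y, `|f x - f y| <= K * enorm (x - y).

Lemma lipschitz_measurable K f : lipschitz K f -> measurable_fun setT f.
Proof.
move=> fK; apply: continuous_measurable_rV1 => x.
apply/(@cvgrPdist_le _ _ _ (nbhs x)) => e e0.
pose L := `|K| * d%:R + 1.
have L0 : 0 < L by rewrite ltr_pwDr// mulr_ge0.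
have eL : 0 < e / L by rewrite divr_gt0.
have /cvgrPdist_le/(_ _ eL) := @cvg_id _ (nbhs x).
apply: filterS => y xy.
rewrite (le_trans (fK _ _))// (le_trans (ler_norm _))// normrM.
rewrite (ger0_norm (enorm_ge0 _)).
rewrite (@le_trans _ _ (`|K| * (d%:R * `|x - y|)))//.
  by rewrite ler_wpM2l// enorm_le_norm.
rewrite mulrA (@le_trans _ _ (L * `|x - y|))//.
  by rewrite ler_wpM2r// lerDl.
by rewrite -ler_pdivlMl// mulrC.
Qed.

Lemma lipschitz_integrable K f (m : P2) : 0 <= K -> lipschitz K f ->
  m.-integrable setT (EFin \o f).
Proof.
move=> K0 fK; have mf := lipschitz_measurable fK.
apply/integrableP; split; first exact/measurable_EFinP.
have mm : measurable_fun setT (fun x : E => (enorm x ^+ 2)%:E).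
  by apply/measurable_EFinP; exact: measurable_sqr_enorm.
pose A := `|f 0| + K.
have A0 : 0 <= A by rewrite addr_ge0.
apply: (@le_lt_trans _ _ (\int[m]_x (A%:E + K%:E * (enorm x ^+ 2)%:E))%E).
  apply: ge0_le_integral => //.
  - by apply: measurableT_comp => //; exact/measurable_EFinP.
  - by apply: emeasurable_funD => //; exact: measurable_funeM.
  move=> x _; rewrite -EFinM -EFinD lee_fin.
  have := fK x 0; rewrite subr0 => fx.
  have -> : f x = f 0 + (f x - f 0) by rewrite addrC subrK.
  rewrite (le_trans (ler_normD _ _))// /A -addrA lerD2l (le_trans fx)//.
  rewrite -[X in X + _]mulr1 -mulrDr ler_wpM2l//.
  by have := sqr_ge0 (enorm x - 1); have := sqr_ge0 (enorm x); rewrite sqrrB1; lra.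
rewrite ge0_integralD//; last 2 first.
- by move=> x _; rewrite mule_ge0// lee_fin sqr_ge0.
- exact: measurable_funeM.
rewrite ge0_integralZl//; last by move=> x _; rewrite lee_fin sqr_ge0.
have -> : (\int[m]_x A%:E = A%:E * (m : probability E R) setT)%E by rewrite -integral_cst.
rewrite probability_setT mule1 lte_add_pinfty ?ltry// lte_mul_pinfty ?lee_fin//.
exact: P2_moment.
Qed.

(** Integrating f z.1 - f z.2 against a coupling of cost below e^2 compares the two integrals. *)
Lemma lipschitz_W2 K f (m n : P2) (e : R) : 0 <= K -> lipschitz K f -> W2 m n < e ->
  `|Rintegral m setT f - Rintegral n setT f| <= K * e.
Proof.
move=> K0 fK mne.
have e0 : 0 < e by rewrite (le_lt_trans _ mne)// sqrtr_ge0.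
have [pi mnpi pie] := W2_lt_coupling mne.
have fm := lipschitz_integrable m K0 fK; have fn := lipschitz_integrable n K0 fK.
have f1 := coupling_integrable_fst mnpi fm; have f2 := coupling_integrable_snd mnpi fn.
rewrite (Rintegral_coupling_fst mnpi fm) (Rintegral_coupling_snd mnpi fn).
rewrite -RintegralB//.
have f12 : pi.-integrable setT (EFin \o (fun z : E * E => f z.1 - f z.2)).
  by have := @integrableB _ _ _ pi setT measurableT _ _ f1 f2.
rewrite (le_trans (le_normr_Rintegral _ _))//.
(* The bound x <= e/2 + x^2/(2 e) plays the part of Cauchy-Schwarz: the integral of [g] is at most K
   e, as the coupling costs less than e^2. *)
pose g (z : E * E) := K / 2 * e + K / 2 / e * enorm (z.1 - z.2) ^+ 2.
have gi : (\int[pi]_z (g z)%:E <= (K * e)%:E)%E.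
  rewrite (_ : \int[pi]_z (g z)%:E = (K / 2 * e)%:E + (K / 2 / e)%:E *
      \int[pi]_z (enorm (z.1 - z.2) ^+ 2)%:E)%E; last first.
    rewrite -ge0_integralZl//; last 3 first.
    - exact: measurable_cost.
    - by move=> z _; rewrite lee_fin sqr_ge0.
    - by rewrite lee_fin !divr_ge0// ltW.
    have -> : ((K / 2 * e)%:E = \int[pi]_z (K / 2 * e)%:E)%E.
      rewrite -[LHS]mule1 -(probability_setT pi).
      by rewrite -integral_cst.
    rewrite -ge0_integralD//.
    - by move=> z _; rewrite lee_fin !mulr_ge0 ?invr_ge0// ltW.
    - by move=> z _; rewrite mule_ge0// lee_fin ?sqr_ge0// !divr_ge0// ltW.
    - by apply: measurable_funeM; exact: measurable_cost.
  have h : (0 <= (K / 2 / e)%:E)%E by rewrite lee_fin !divr_ge0// ltW.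
  apply: le_trans (leeD2l _ (lee_wpmul2l h (ltW pie))) _.
  rewrite -EFinM -EFinD lee_fin; apply: eq_ler.
  by field; rewrite gt_eqF.
have f12g : (\int[pi]_z `|f z.1 - f z.2|%:E <= (K * e)%:E)%E.
  apply: le_trans gi; apply: ge0_le_integral => //.
  - by have /integrableP[/(measurableT_comp (@abse_measurable R setT))] := f12.
  - apply/measurable_EFinP; apply: measurable_funD => //; apply: measurable_funM => //.
    by apply/measurable_EFinP; exact: measurable_cost.
  move=> z _; rewrite lee_fin (le_trans (fK _ _))// /g.
  set x := enorm _.
  rewrite (_ : K / 2 * e + K / 2 / e * x ^+ 2 = K * ((e ^+ 2 + x ^+ 2) / (2 * e))); last first.
    by field; rewrite gt_eqF.
  rewrite ler_wpM2l// ler_pdivlMr ?mulr_gt0//.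
  by have := sqr_ge0 (e - x); rewrite sqrrB; lra.
rewrite -lee_fin /Rintegral fineK// ge0_fin_numE ?integral_ge0//.
by rewrite (le_lt_trans f12g)// ltry.
Qed.

Lemma P2_continuous (f : P2 -> R) :
  (forall m e, 0 < e -> exists2 r : R, 0 < r & forall n, W2 m n < r -> `|f m - f n| < e) ->
  continuous f.
Proof.
move=> fP; apply/continuousP => U oU; have : W2_open (f @^-1` U); last by [].
move=> m fm.
have /nbhs_ballP[e /= e0 eU] : nbhs (f m) U by exact: open_nbhs_nbhs.
by have [r r0 rP] := fP m e e0; exists r => // n mn; apply: eU; exact: rP.
Qed.

Lemma P2_measurable (f : P2 -> R) : continuous f -> measurable_fun setT f.
Proof.
move=> /continuousP cf; apply: (measurability _ (RGenOInfty.measurableE R)) => _ [_ [a ->] <-].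
by rewrite setTI; apply: sub_sigma_algebra; apply: cf; exact: interval_open.
Qed.

Lemma lipschitz_continuous K f : 0 <= K -> lipschitz K f ->
  continuous (fun m : P2 => Rintegral m setT f).
Proof.
move=> K0 fK; apply: P2_continuous => m e e0.
have K10 : 0 < K + 1 by rewrite ltr_pwDr.
exists (e / (K + 1)); first by rewrite divr_gt0.
move=> n mn; rewrite (le_lt_trans (lipschitz_W2 K0 fK mn))//.
by rewrite mulrCA gtr_pMr// ltr_pdivrMr// mul1r ltrDl.
Qed.

Definition mean (m : P2) : E := \row_i Rintegral m setT (fun x : E => x 0 i).

Lemma lipschitz_coord i : lipschitz 1 (fun x : E => x 0 i).
Proof.
by move=> x y; rewrite mul1r; have := coord_le_enorm (x - y) i; rewrite !mxE.
Qed.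

Lemma mean_coord_continuous i : continuous (fun m : P2 => mean m 0 i).
Proof.
have -> : (fun m : P2 => mean m 0 i) = (fun m : P2 => Rintegral m setT (fun x : E => x 0 i)).
  by apply/funext => m; rewrite mxE.
exact: lipschitz_continuous ler01 (lipschitz_coord i).
Qed.

Lemma measurable_mean : measurable_fun setT mean.
Proof.
by apply: measurable_fun_rV => i; apply: P2_measurable; exact: mean_coord_continuous.
Qed.

End wasserstein_theory.

Lemma ae_forall_count d (T : measurableType d) (R : realType)
    (mu : {measure set T -> \bar R}) (I : countType) (P : I -> T -> Prop) :
  (forall i, {ae mu, forall x, P i x}) -> {ae mu, forall x i, P i x}.
Proof.
move=> aeP.
have : {ae mu, forall x (n : nat), if unpickle n is Some i then P i x else True}.
  by apply: ae_foralln => n; case: unpickle => [i|]; [exact: aeP|exact: aeW].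
by apply: filterS => x xP i; have := xP (pickle i); rewrite pickleK.
Qed.

Lemma rat_between (R : realType) (a b : R) :
  a < b -> exists2 q : rat, a < ratr q & ratr q < b.
Proof.
move=> ab; have [] := @dense_rat R (`]a, b[%classic).
- by exists ((a + b) / 2); rewrite /= in_itv/= !midf_lt.
- exact: interval_open.
by move=> y [/= + [q _ qE]]; rewrite in_itv/= -qE => /andP[aq qb]; exists q.
Qed.

(** Reduces x = a to countably many conditions, each of which confronts a half-space condition on a
    with an open half-space for x; almost sure equality can then be proved one condition at a
    time. *)
Lemma rat_separation (R : realType) d (x a : 'rV[R]_d) :
  (forall p : 'I_d * rat,
    ~ (a 0 p.1 <= ratr p.2 < x 0 p.1) /\ ~ (x 0 p.1 < ratr p.2 <= a 0 p.1)) ->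
  x = a.
Proof.
move=> xP; apply/rowP => i; apply/eqP; rewrite eq_le !leNgt.
apply/andP; split; apply/negP => /rat_between[q q1 q2].
- by have [+ _] := xP (i, q); apply; rewrite /= (ltW q1).
- by have [_] := xP (i, q); apply; rewrite /= q1 ltW.
Qed.

(** * Dirac masses as a Borel subset of the Wasserstein space *)

Section halfspaces.
Context {R : realType} {d : nat}.
Local Notation E := 'rV[R]_d.
Local Notation P2 := (P2 R d).

(** Lipschitz functions that increase with k to the indicator of {g > 0}. *)
Let ramp (k : nat) (g : E -> R) (x : E) : R := Num.min 1 (Num.max 0 (k%:R * g x)).

Let ramp_ge0 k g x : 0 <= ramp k g x.
Proof. by rewrite le_min ler01 le_max lexx. Qed.

Let ramp_lipschitz k g : lipschitz 1 g -> lipschitz k%:R (ramp k g).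
Proof.
move=> g1 x y.
have : `|k%:R * g x - k%:R * g y| <= k%:R * enorm (x - y).
  rewrite -mulrBr normrM ger0_norm// ler_wpM2l//.
  by rewrite (le_trans (g1 x y))// mul1r.
rewrite /ramp; apply: le_trans.
move: (k%:R * g x) (k%:R * g y) => a b.
apply: (@le_trans _ _ `|Num.max 0 a - Num.max 0 b|).
  move: (Num.max 0 a) (Num.max 0 b) => {}a {}b.
  have h1 := ler_norm (a - b); have h2 := ler_norm (b - a).
  rewrite distrC in h2; rewrite ler_norml.
  by case: (leP 1 a); case: (leP 1 b) => *; apply/andP; split; lra.
have h1 := ler_norm (a - b); have h2 := ler_norm (b - a).
rewrite distrC in h2; rewrite ler_norml.
by case: (leP 0 a); case: (leP 0 b) => *; apply/andP; split; lra.
Qed.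

(** The mass of {g > 0} is the limit of the integrals of [ramp k g], which are W2-continuous in m
    because the ramps are Lipschitz. *)
Lemma measurable_P2_positive (g : E -> R) : lipschitz 1 g ->
  measurable_fun setT (fun m : P2 => m [set x | 0 < g x]).
Proof.
move=> g1; have mg := lipschitz_measurable g1.
have rk k := ramp_lipschitz k g1.
apply: (emeasurable_fun_cvg (fun k (m : P2) => (Rintegral m setT (ramp k g))%:E)).
- move=> k; apply/measurable_EFinP; apply: P2_measurable.
  exact: (@lipschitz_continuous _ _ k%:R).
- move=> m _.
  have -> : (fun k => (Rintegral m setT (ramp k g))%:E) =
      (fun k => \int[m]_x (ramp k g x)%:E)%E.
    apply/funext => k; rewrite fineK//.
    apply: integrable_fin_num => //; exact: (lipschitz_integrable m _ (rk k)).
  have mU : measurable [set x | 0 < g x].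
    rewrite (_ : [set x | _] = g @^-1` `]0, +oo[).
      by rewrite -[X in measurable X]setTI; apply: mg.
    by apply/seteqP; split => x /=; rewrite in_itv/= andbT.
  have -> : m [set x | 0 < g x] = (\int[m]_x (\1_[set x | 0 < g x] x)%:E)%E.
    by rewrite integral_indic// setIT.
  have rcvg x : (ramp k g x)%:E @[k --> \oo] --> (\1_[set x | 0 < g x] x : R)%:E.
    apply: cvg_EFin; first exact: nearW.
    have [g0|g0] := ltP 0 (g x); last first.
      rewrite indicE memNset /=; last by apply/negP; rewrite -leNgt.
      rewrite (_ : (fun _ => _) = cst 0); first exact: cvg_cst.
      apply/funext => k; rewrite /ramp max_l ?mulr_ge0_le0//.
      by rewrite min_r// ler01.
    rewrite indicE mem_set//=.
    apply: cvg_near_cst; near=> k.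
    have kg : 1 <= k%:R * g x.
      rewrite -ler_pdivrMr// (le_trans (ltW (truncnS_gt _)))// ler_nat.
      by near: k; exact: nbhs_infty_ge.
    by rewrite /= /ramp max_r ?min_l// (le_trans ler01).
  rewrite (_ : (\int[m]_x (\1_[set x | 0 < g x] x)%:E)%E =
      (\int[m]_x limn (fun k => (ramp k g x)%:E))%E); last first.
    by apply: eq_integral => x _; apply/esym/cvg_lim => //; exact: rcvg.
  apply: (@cvg_monotone_convergence _ _ _ (m : probability E R) setT measurableT
    (fun k x => (ramp k g x)%:E)) => //.
  - by move=> k; apply/measurable_EFinP; exact: lipschitz_measurable (rk k).
  - by move=> k x _; rewrite lee_fin.
  - move=> x _ k l kl; rewrite lee_fin /ramp.
    have [g0|g0] := leP (g x) 0.
      rewrite !max_l//; rewrite mulr_ge0_le0//.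
    rewrite !max_r ?mulr_ge0 ?(ltW g0)// le_min ge_min lexx/= ge_min.
    by rewrite ler_wpM2r ?orbT ?(ltW g0)// ler_nat.
Unshelve. all: by end_near. Qed.

Lemma measurable_P2_gt i (q : R) :
  measurable_fun setT (fun m : P2 => m [set x | q < x 0 i]).
Proof.
have := @measurable_P2_positive (fun x => x 0 i - q).
rewrite (_ : [set x : E | 0 < x 0 i - q] = [set x | q < x 0 i]).
  apply; move=> x y; rewrite opprB addrA subrK; exact: lipschitz_coord.
by apply/funext => x /=; rewrite subr_gt0.
Qed.

Lemma measurable_P2_lt i (q : R) :
  measurable_fun setT (fun m : P2 => m [set x | x 0 i < q]).
Proof.
have := @measurable_P2_positive (fun x => q - x 0 i).
rewrite (_ : [set x : E | 0 < q - x 0 i] = [set x | x 0 i < q]).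
  apply; move=> x y; rewrite opprB addrC addrA subrK distrC.
  exact: lipschitz_coord.
by apply/funext => x /=; rewrite subr_gt0.
Qed.

(* [m] is the Dirac mass at [a], expressed by countably many conditions that are
   Borel in [m] and [a] *)
Definition concentrated (m : P2) (a : E) := forall (p : 'I_d * rat),
  (a 0 p.1 <= ratr p.2 -> m [set x : E | ratr p.2 < x 0 p.1] = 0%E) /\
  (ratr p.2 <= a 0 p.1 -> m [set x : E | x 0 p.1 < ratr p.2] = 0%E).

Lemma measurable_halfspace_gt i (q : R) : measurable [set x : E | q < x 0 i].
Proof.
rewrite (_ : [set x : E | q < x 0 i] = (fun x => x 0 i) @^-1` `]q, +oo[).
  by rewrite -[X in measurable X]setTI; apply: measurable_coord.
by apply/seteqP; split => x /=; rewrite in_itv/= andbT.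
Qed.

Lemma measurable_halfspace_lt i (q : R) : measurable [set x : E | x 0 i < q].
Proof.
rewrite (_ : [set x : E | x 0 i < q] = (fun x => x 0 i) @^-1` `]-oo, q[).
  by rewrite -[X in measurable X]setTI; apply: measurable_coord.
by apply/seteqP; split => x /=; rewrite in_itv/=.
Qed.

Lemma concentrated_dirac (m : P2) a : concentrated m a ->
  forall A, measurable A -> m A = \d_a A.
Proof.
move=> ma.
have ae_a : {ae m, forall x : E, x = a}.
  have : {ae m, forall (x : E) (p : 'I_d * rat),
      ~ (a 0 p.1 <= ratr p.2 < x 0 p.1) /\ ~ (x 0 p.1 < ratr p.2 <= a 0 p.1)}.
    apply: ae_forall_count => p; have [m1 m2] := ma p.
    have h1 : {ae m, forall x : E, ~ (a 0 p.1 <= ratr p.2 < x 0 p.1)}.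
      have [ap|ap] := boolP (a 0 p.1 <= ratr p.2); last by apply: aeW => x /andP[].
      exists [set x : E | ratr p.2 < x 0 p.1]; split.
      + exact: measurable_halfspace_gt.
      + exact: m1.
      + by move=> x /= /contrapT.
    have h2 : {ae m, forall x : E, ~ (x 0 p.1 < ratr p.2 <= a 0 p.1)}.
      have [ap|ap] := boolP (ratr p.2 <= a 0 p.1); last by apply: aeW => x /andP[].
      exists [set x : E | x 0 p.1 < ratr p.2]; split.
      + exact: measurable_halfspace_lt.
      + exact: m2.
      + by move=> x /= /contrapT /andP[].
    by apply: filterS2 h1 h2 => x.
  by apply: filterS => x; exact: rat_separation.
have sub B : measurable B -> ~ B a -> m B = 0%E.
  move=> mB Ba; apply: measure_negligible => //.
  case: ae_a => N [mN N0 aN]; exists N; split => //.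
  by move=> x Bx; apply: aN => /= xa; rewrite xa in Bx.
move=> A mA; rewrite diracE; case: (boolP (a \in A)) => [/set_mem Aa|/negP aA]; last first.
  by apply: sub => // Aa; apply: aA; rewrite inE.
have := probability_setC m (measurableC mA).
rewrite setCK (sub (~` A)) ?sube0//; exact: measurableC.
Qed.

Lemma dirac_coupling (m : P2) (a b : E) : (forall A, measurable A -> m A = \d_a A) ->
  coupling m (diracP2 b) (dirac (a, b)).
Proof.
move=> ma A mA; rewrite ma// /= !diracE; split; congr (_%:R%:E); congr nat_of_bool.
  by apply/idP/idP; rewrite !inE => //= -[].
by apply/idP/idP; rewrite !inE => //= -[].
Qed.

Lemma dirac_cost (a b : E) :
  (\int[dirac (a, b)]_z (enorm (z.1 - z.2) ^+ 2)%:E = (enorm (a - b) ^+ 2)%:E)%E.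
Proof.
rewrite integral_dirac//; last exact: measurable_cost.
by rewrite diracT mul1e.
Qed.

Lemma W2_dirac (m : P2) (a b : E) : (forall A, measurable A -> m A = \d_a A) ->
  W2 m (diracP2 b) <= enorm (a - b).
Proof.
move=> ma; apply: W2_le_coupling (enorm_ge0 _) (dirac_coupling b ma) _.
by rewrite dirac_cost.
Qed.

Lemma diracP2_continuous : continuous (@diracP2 R d).
Proof.
apply/continuousP => U oU; rewrite openE => a Ua.
have [e e0 eU] := oU _ Ua.
have e10 : 0 < e / d.+1%:R by rewrite divr_gt0.
have /cvgrPdist_lt/(_ _ e10) := @cvg_id _ (nbhs a).
apply: filterS => b ab; apply: eU.
rewrite (le_lt_trans (@W2_dirac _ a b _))//.
rewrite (le_lt_trans (enorm_le_norm _))//.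
rewrite (@le_lt_trans _ _ (d.+1%:R * `|a - b|))// ?ler_wpM2r ?ler_nat//.
by rewrite -ltr_pdivlMl// mulrC.
Qed.

Lemma measurable_diracP2 : measurable_fun setT (@diracP2 R d).
Proof.
apply: (@measurability _ _ _ _ setT _ (@open P2)) => // _ [U oU <-].
rewrite setTI; apply: open_measurable_rV.
by have /continuousP := diracP2_continuous; apply.
Qed.

(** m and [diracP2 a] may differ on sets that are not Borel, but they are at W2-distance 0, and a
    continuous function cannot tell them apart. *)
Lemma P2_continuous_dirac (phi : P2 -> R) (m : P2) (a : E) : continuous phi ->
  (forall A, measurable A -> m A = \d_a A) -> phi m = phi (diracP2 a).
Proof.
move=> cphi ma; apply/eqP; rewrite -subr_eq0 -normr_le0 leNgt; apply/negP => e0.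
set e := `|_| in e0.
have /continuousP/(_ (ball (phi m) e) (ball_open _ _)) := cphi.
move=> oU.
have [|r r0 rP] := (oU : W2_open _) m; first exact: ballxx.
have := rP (diracP2 a); rewrite /= /ball/= ltxx => h.
suff : false by []; apply: h.
by rewrite (le_lt_trans (W2_dirac a ma))// subrr enorm0.
Qed.

Lemma mean_dirac (a : E) : mean (diracP2 a) = a.
Proof.
apply/rowP => i; rewrite mxE /Rintegral integral_dirac// ?diracT ?mul1e//.
by apply/measurable_EFinP; exact: measurable_coord.
Qed.

Lemma dirac_concentrated (a : E) : concentrated (diracP2 a) a.
Proof.
move=> p; split => ap /=; rewrite diracE memNset//=; apply/negP; rewrite -leNgt//.
Qed.

(** The atom of a Dirac mass is its mean, which is a continuous function of m. Taking the mean as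
    the candidate atom turns being a Dirac mass into countably many Borel conditions on m. *)
Lemma measurable_concentrated_mean :
  measurable [set m : P2 | concentrated m (mean m)].
Proof.
pose S (p : 'I_d * rat) := [set m : P2 |
  (mean m 0 p.1 <= ratr p.2 -> m [set x : E | ratr p.2 < x 0 p.1] = 0%E) /\
  (ratr p.2 <= mean m 0 p.1 -> m [set x : E | x 0 p.1 < ratr p.2] = 0%E)].
rewrite (_ : [set m : P2 | _] = ~` \bigcup_p ~` S p); last first.
  apply/seteqP; split => m /= H; first by move=> [p _]; apply; exact: H.
  by move=> p; apply: contrapT => Sp; apply: H; exists p.
apply: measurableC; apply: countable_bigcupT_measurable => // p.
apply: measurableC.
have mm := P2_measurable (@mean_coord_continuous R d p.1).
rewrite (_ : S p =
   ((fun m : P2 => mean m 0 p.1) @^-1` `]ratr p.2, +oo[ `|`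
    (fun m : P2 => m [set x : E | ratr p.2 < x 0 p.1]) @^-1` [set 0%E]) `&`
   ((fun m : P2 => mean m 0 p.1) @^-1` `]-oo, ratr p.2[ `|`
    (fun m : P2 => m [set x : E | x 0 p.1 < ratr p.2]) @^-1` [set 0%E])); last first.
  apply/seteqP; split => m /=; rewrite !in_itv/= andbT.
    move=> [H1 H2]; split.
    - case: (leP (mean m 0 p.1) (ratr p.2)) => h; [right; exact: H1|by left].
    - case: (leP (ratr p.2) (mean m 0 p.1)) => h; [right; exact: H2|by left].
  move=> [H1 H2]; split.
  - by case: H1 => // h; rewrite leNgt h.
  - by case: H2 => // h; rewrite leNgt h.
apply: measurableI; apply: measurableU.
- by rewrite -[X in measurable X]setTI; apply: mm.
- by rewrite -[X in measurable X]setTI; apply: measurable_P2_gt.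
- by rewrite -[X in measurable X]setTI; apply: mm.
- by rewrite -[X in measurable X]setTI; apply: measurable_P2_lt.
Qed.

End halfspaces.

(** * Invariance for the Langevin equation *)

Section null_sets.
Context {R : realType} {d0 d1 : measure_display} {T0 : measurableType d0}
  {T1 : measurableType d1}.

(** Turns the outer-measure statements of [cond_law] into almost sure ones: intersect measurable
    covers of measure below 1/(n+1). *)
Lemma mu_ext0_negligible (mu : {measure set T0 -> \bar R}) (X : set T0) :
  ((mu^*)%mu X = 0)%E -> mu.-negligible X.
Proof.
move=> X0.
have /choice[A AP] (n : nat) : exists A : set T0,
    [/\ measurable A, X `<=` A & (mu A < (n.+1%:R^-1)%:E)%E].
  have : ((mu^*)%mu X < (n.+1%:R^-1)%:E)%E by rewrite X0 lte_fin invr_gt0.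
  move=> /ereal_inf_lt[_ [F [mF XF] <-] Fn].
  have mF' k : measurable (F k) by exact: mF.
  exists (\bigcup_k F k); split => //; first exact: bigcup_measurable.
  by apply: le_lt_trans Fn; apply: measure_sigma_subadditive => //; exact: bigcup_measurable.
exists (\bigcap_n A n); split.
- by apply: bigcapT_measurable => n; have [] := AP n.
- apply/eqP; rewrite eq_le measure_ge0 andbT; apply/lee_addgt0Pr => e e0.
  pose n := Num.truncn e^-1.
  rewrite add0e (@le_trans _ _ (mu (A n)))//.
    apply: le_measure; rewrite ?inE//.
    + by apply: bigcapT_measurable => k; have [] := AP k.
    + by have [] := AP n.
    + exact: bigcap_inf.
  have [_ _ /ltW/le_trans] := AP n; apply.
  by rewrite lee_fin invf_ple ?posrE// ltW// truncnS_gt.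
- by move=> x Xx n _; have [_ + _] := AP n; exact.
Qed.

Lemma negligible_mu_ext0 (mu : {measure set T0 -> \bar R}) (X : set T0) :
  mu.-negligible X -> ((mu^*)%mu X = 0)%E.
Proof.
move=> [A [mA A0 XA]]; apply/eqP; rewrite eq_le mu_ext_ge0 ?andbT//.
by rewrite -A0 -[leRHS]measurable_mu_extE//; exact: le_mu_ext.
Qed.

Variables (P0 : probability T0 R) (P1 : probability T1 R).
Local Notation Q := (P0 \x P1)%E.

Lemma ae_fst (P : T0 -> Prop) : {ae P0, forall x, P x} -> {ae Q, forall z, P z.1}.
Proof.
move=> [N [mN N0 PN]]; exists (N `*` setT); split.
- exact: measurableX.
- by rewrite -[RHS](mul0e (P1 setT)) -N0; exact: product_measure1E.
- by move=> z zP; split => //; exact: PN.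
Qed.

(** By Tonelli, almost every section of a null set of the product is null. With [ae_exists], this
    fixes one point of T1 for almost every point of T0. *)
Lemma ae_section (P : T0 -> T1 -> Prop) : {ae Q, forall z, P z.1 z.2} ->
  {ae P0, forall x, {ae P1, forall y, P x y}}.
Proof.
move=> [N [mN N0 PN]].
have mf := measurable_fun_xsection P1 mN.
have /(ae_eq_integral_abs P0 measurableT mf) :
    (\int[P0]_x `|(P1 \o xsection N) x| = 0)%E.
  rewrite -[RHS]N0; apply: eq_integral => x _; rewrite gee0_abs//.
apply: filterS => x /(_ Logic.I) Nx; exists (xsection N x); split => //.
  exact: measurable_xsection.
by move=> y yP; rewrite /xsection/= inE; apply: PN.
Qed.

Lemma ae_exists (P : T1 -> Prop) : {ae P1, forall y, P y} -> exists y, P y.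
Proof.
move=> [N [mN N0 PN]]; apply: contrapT => /forallNP nP.
have : P1 setT = 0%E.
  by apply: measure_negligible => //; exists N; split => // y _; apply: PN; exact: nP.
by rewrite probability_setT => /eqP; rewrite onee_eq0.
Qed.

End null_sets.

Section integral_le.
Import HBNNSimple.

(* no measurability is assumed of [f] *)
Lemma ge0_integral_pushforward_le d d' (T : measurableType d)
    (T' : measurableType d') (R : realType) (mu : {measure set T -> \bar R})
    (phi : T -> T') (f : T' -> \bar R) (g : T -> \bar R) :
  measurable_fun setT phi -> measurable_fun setT g ->
  (forall y, 0 <= f y)%E -> (forall x, f (phi x) <= g x)%E ->
  (\int[pushforward mu phi]_y f y <= \int[mu]_x g x)%E.
Proof.
move=> mphi mg f0 fg; rewrite [leLHS]ge0_integralTE//=.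
apply: ge_ereal_sup => _ [h hf <-].
rewrite -integralT_nnsfun.
have hphi : measurable_fun setT (fun x => (h (phi x))%:E).
  by apply/measurable_EFinP; exact: measurableT_comp.
rewrite (ge0_integral_pushforward mphi)//; last 2 first.
- exact/measurable_EFinP.
- by move=> y _; rewrite lee_fin.
rewrite preimage_setT; apply: ge0_le_integral => //.
- by move=> x _; rewrite lee_fin.
- by move=> x _; exact: le_trans (hf _) (fg x).
Qed.

End integral_le.

Section sub_sigma_algebra.
Context {d0 dU} {T : measurableType d0} {U : measurableType dU}.

(** Gives access to the closure properties of measurable functions for the sub-sigma-algebras of the
    filtration. *)
Lemma measurable_wrtP (G : set (set T)) (f : T -> U) : sigma_algebra setT G ->
  measurable_wrt G f <-> measurable_fun setT (f : g_sigma_algebraType G -> U).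
Proof.
move=> sG; split => [mf _ A mA|mf A mA].
  by rewrite setTI /measurable/= sigma_algebra_id//; exact: mf.
by have := mf measurableT A mA; rewrite setTI /measurable/= sigma_algebra_id.
Qed.

End sub_sigma_algebra.

Section quadratic_drift.
Context {R : realType} {d : nat}.
Local Notation E := 'rV[R]_d.

Lemma grad_quadratic (W : E -> R) (alpha : R) :
  (forall x, W x = alpha * enorm x ^+ 2 / 2) -> forall x, grad W x = alpha *: x.
Proof.
move=> WE x; apply/rowP => i; rewrite !mxE.
pose e : E := delta_mx 0 i.
have ee : dotv e e = 1.
  rewrite /dotv (bigD1 i)//= big1 ?addr0 ?mxE ?eqxx ?mulr1// => j ji.
  by rewrite !mxE eqxx (negbTE ji) mulr0.
have ex : dotv e x = x 0 i.
  rewrite /dotv (bigD1 i)//= big1 ?addr0 ?mxE ?eqxx ?mul1r// => j ji.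
  by rewrite !mxE eqxx (negbTE ji) mul0r.
apply: cvg_lim => //.
(* For h != 0 the difference quotient is exactly alpha x_i + (alpha / 2) h. *)
have -> : alpha * x 0 i = alpha * x 0 i + alpha / 2 * 0 by rewrite mulr0 addr0.
apply: (@cvg_trans _ ((alpha * x 0 i + alpha / 2 * h) @[h --> (0 : R)^'])).
  apply: near_eq_cvg; near=> h.
  have h0 : h != 0 by near: h; exact: nbhs_dnbhs_neq.
  rewrite /= !WE !sqr_enorm -/e dotvDl !dotvDr !dotvZl !dotvZr (dotvC x e) -/e ee ex.
  by rewrite /GRing.scale/=; field.
apply: cvgD; first exact: cvg_cst.
by apply: cvgM; [exact: cvg_cst|exact: cvg_within].
Unshelve. all: by end_near. Qed.

(** As grad W is linear, the convolution sees only the mean of m. The drift splits into a function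
    of the position and a forcing that depends on m alone, the form that [euler] expects. *)
Lemma drift_quadratic (V W : E -> R) (alpha : R) (m : P2 R d) (x : E) :
  (forall x, W x = alpha * enorm x ^+ 2 / 2) ->
  drift V W m x = (- grad V x - alpha *: x) + alpha *: mean m.
Proof.
move=> WE; rewrite /drift -addrA; congr (_ + _).
apply/rowP => i; rewrite !mxE.
under eq_Rintegral do rewrite (grad_quadratic WE) !mxE.
have mi := lipschitz_integrable m ler01 (@lipschitz_coord R d i).
have ci : (m : probability E R).-integrable setT (EFin \o cst (x 0 i)).
  exact: finite_measure_integrable_cst.
have di : (m : probability E R).-integrable setT (EFin \o (fun y : E => x 0 i - y 0 i)).
  by have := @integrableB _ _ _ (m : probability E R) setT measurableT _ _ ci mi.
rewrite RintegralZl// RintegralB// Rintegral_cst//.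
rewrite [fine _](_ : _ = 1); first by ring.
exact: (congr1 fine (probability_setT (m : probability E R))).
Qed.

End quadratic_drift.

Section adapted.
Context {R : realType} {d : nat} {d0 : measure_display} {T0 : measurableType d0}.
Local Notation E := 'rV[R]_d.
Variable F0 : R -> set (set T0).
Hypothesis F0f : filtration F0.

Lemma filtration_le s t (f : T0 -> E) : 0 <= s -> s <= t ->
  measurable_wrt (F0 s) f -> measurable_wrt (F0 t) f.
Proof. by move=> s0 st mf A mA; apply: (F0f.2 s t) => //; exact: mf. Qed.

Lemma filtration_measurable dU (U : measurableType dU) t (f : T0 -> U) : 0 <= t ->
  measurable_wrt (F0 t) f -> measurable_fun setT f.
Proof. by move=> t0 mf _ A mA; rewrite setTI; apply: (F0f.1 t t0).2; exact: mf. Qed.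

Lemma euler_adapted (F : E -> E) (c b : R -> T0 -> E) (a : T0 -> E) (h t : R) k :
  measurable_fun setT F ->
  (forall s, 0 <= s -> measurable_wrt (F0 s) (c s)) ->
  (forall s, 0 <= s -> measurable_wrt (F0 s) (b s)) ->
  measurable_wrt (F0 0) a -> 0 <= h -> k%:R * h <= t ->
  measurable_wrt (F0 t) (fun w => euler F (c ^~ w) (b ^~ w) h (a w) k).
Proof.
move=> mF mc mb ma h0; elim: k => [|k IH] kt /=.
  by apply: filtration_le ma => //; rewrite mul0r in kt.
have kh : 0 <= k%:R * h by rewrite mulr_ge0.
have k1h : 0 <= k.+1%:R * h by rewrite mulr_ge0.
have kt' : k%:R * h <= t by rewrite (le_trans _ kt)// ler_wpM2r// ler_nat.
have t0 : 0 <= t by rewrite (le_trans kh).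
have sF := (F0f.1 t t0).1.
have mw s f : 0 <= s -> s <= t -> measurable_wrt (F0 s) f ->
    measurable_fun setT (f : g_sigma_algebraType (F0 t) -> E).
  by move=> s0 st mf; apply/(measurable_wrtP _ sF); exact: filtration_le mf.
apply/(measurable_wrtP _ sF).
have {}IH : measurable_fun setT
    ((fun w => euler F (c ^~ w) (b ^~ w) h (a w) k) : g_sigma_algebraType (F0 t) -> E).
  by apply/(measurable_wrtP _ sF); exact: IH.
apply: measurable_rV_add.
  apply: measurable_rV_add; first exact: IH.
  apply: measurable_rV_scale; apply: measurable_rV_add.
    exact: (measurableT_comp mF IH).
  exact: mw (mc _ kh).
apply: measurable_rV_add; first exact: mw (mb _ k1h).
by apply: measurable_rV_opp; exact: mw (mb _ kh).
Qed.

End adapted.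

Lemma probability_affine d (T : measurableType d) (R : realType)
    (P : probability T R) (a b : R) (g : T -> R) :
  measurable_fun setT g -> (forall x, 0 <= g x <= 1) ->
  (\int[P]_x (a * g x + b)%:E = (a * Rintegral P setT g + b)%:E)%E.
Proof.
move=> mg g01.
have ci c : P.-integrable setT (EFin \o cst c).
  exact: finite_measure_integrable_cst.
have gi : P.-integrable setT (EFin \o g).
  apply: (le_integrable measurableT _ _ (ci 1)); first exact/measurable_EFinP.
  by move=> x _ /=; rewrite lee_fin normr1; have /andP[g0 g1] := g01 x; rewrite ger0_norm.
have agi : P.-integrable setT (EFin \o (fun x => a * g x)).
  by have := @integrableZl _ _ _ P setT measurableT a _ gi.
have si : P.-integrable setT (EFin \o (fun x => a * g x + b)).
  by have := @integrableD _ _ _ P setT measurableT _ _ agi (ci b).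
have -> : a * Rintegral P setT g + b = Rintegral P setT (fun x => a * g x + b).
  rewrite RintegralD//; last exact: ci.
  rewrite RintegralZl// Rintegral_cst// [fine _](_ : _ = 1) ?mulr1//.
  exact: (congr1 fine (probability_setT P)).
by rewrite fineK//; apply: integrable_fin_num.
Qed.

Section langevin_law.
Context {R : realType} {d : nat} {d0 : measure_display} {T0 : measurableType d0}.
Local Notation E := 'rV[R]_d.
Variables (P0 : probability T0 R) (F0 : R -> set (set T0)) (B : R -> T0 -> E)
  (V : E -> R) (sigma0 LV : R) (mu0 : probability E R) (a : T0 -> E).
Hypotheses (F0f : filtration F0) (B0 : brownian P0 F0 B)
  (dV : forall x, differentiable V x) (dgV : forall x, differentiable (grad V) x)
  (s0 : 0 < sigma0) (LV0 : 0 <= LV)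
  (VL : forall x y, enorm (grad V x - grad V y) <= LV * enorm (x - y))
  (mu0V : gibbs V sigma0 mu0) (mu0_moment : (\int[mu0]_x (dotv x x)%:E < +oo)%E)
  (ma : measurable_wrt (F0 0) a)
  (alaw : forall f : E -> R, measurable_fun setT f -> (forall x, 0 <= f x) ->
    (\int[P0]_w (f (a w))%:E = \int[mu0]_x (f x)%:E)%E).

Definition langevin_euler (h : R) (k : nat) (w : T0) : E :=
  euler (fun x => - grad V x) (fun=> 0) (fun s => sigma0 *: B s w) h (a w) k.

Let mg : measurable_fun setT (grad V).
Proof. by apply: continuous_measurable_rV; exact: grad_continuous. Qed.

Lemma langevin_euler_adapted (h t : R) k : 0 <= h -> k%:R * h <= t ->
  measurable_wrt (F0 t) (langevin_euler h k).
Proof.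
move=> h0 kt.
apply: (@euler_adapted _ _ _ _ _ F0f (fun x => - grad V x) (fun _ _ => 0)
  (fun s w => sigma0 *: B s w)) => //.
- exact: measurable_rV_opp.
- move=> s ss; apply/(measurable_wrtP _ (F0f.1 s ss).1); exact: measurable_cst.
- move=> s ss; apply/(measurable_wrtP _ (F0f.1 s ss).1); apply: measurable_rV_scale.
  by apply/(measurable_wrtP _ (F0f.1 s ss).1); exact: (brownian_adapted B0).
Qed.

Let eps (h : R) : \bar R := (\int[mu0]_x \int[@gauss R d]_z
  `|balance_error V sigma0 h x (euler_step V sigma0 h x z)|%:E)%E.

(** The induction hypothesis is applied to [Pf], the test function averaged over the last step,
    which still has values in [0, 1]. Each step error is thus an integral under mu0, and not under
    the law reached by the scheme. *)
Lemma langevin_euler_law (h : R) : 0 < h -> forall k (f : E -> R),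
  measurable_fun setT f -> (forall x, 0 <= f x <= 1) ->
  (\int[P0]_w (f (langevin_euler h k w))%:E <=
   \int[mu0]_x (f x)%:E + k%:R%:E * eps h)%E.
Proof.
move=> h0; elim => [|k IH] f mf f01.
  by rewrite alaw// ?mul0e ?adde0// => x; case/andP: (f01 x).
have f0 x : 0 <= f x by case/andP: (f01 x).
have sh : 0 < Num.sqrt h by rewrite sqrtr_gt0.
have kh : 0 <= k%:R * h by rewrite mulr_ge0// ltW.
have k1h : 0 <= k.+1%:R * h by rewrite mulr_ge0// ltW.
have kkh : k%:R * h < k.+1%:R * h by rewrite ltr_pM2r// ltr_nat.
have hE : k.+1%:R * h - k%:R * h = h by rewrite -mulrBl -natrB// subSnn mul1r.
pose D w := B (k.+1%:R * h) w - B (k%:R * h) w.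
have mB s : 0 <= s -> measurable_fun setT (B s).
  by move=> ss; apply: (filtration_measurable F0f ss); exact: (brownian_adapted B0).
have mD : measurable_fun setT D.
  by apply: measurable_rV_add; [exact: mB|apply: measurable_rV_opp; exact: mB].
have := @ge0_integral_joint_law _ _ _ _ P0 (F0 (k%:R * h)) (Num.sqrt h)
  (langevin_euler h k) D sh (F0f.1 _ kh).2.
have adk := @langevin_euler_adapted h (k%:R * h) k (ltW h0) (lexx _).
move=> /(_ adk mD).
have PD (G : set T0) (A : 'I_d -> set R) : F0 (k%:R * h) G ->
    (forall i, measurable (A i)) ->
    P0 (G `&` [set w | forall i, A i (D w 0 i)]) =
    (P0 G * \prod_i normal_prob 0 (Num.sqrt h) (A i))%E.
  by move=> FG mA; have := brownian_incr B0 kh kkh FG mA; rewrite hE.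
move=> /(_ PD) {PD}.
(* The second variable is the raw increment of B, with standard deviation sqrt h; [euler_step] takes
   a standard Gaussian and carries the factor sqrt h itself. *)
pose Phi (p : E * E) := p.1 - h *: grad V p.1 + sigma0 *: p.2.
have mPhi : measurable_fun setT Phi.
  apply: measurable_rV_add; last by apply: measurable_rV_scale; exact: measurable_snd.
  apply: measurable_rV_add; first exact: measurable_fst.
  apply/measurable_rV_opp/measurable_rV_scale.
  exact: (measurableT_comp mg measurable_fst).
move=> /(_ (fun p => (f (Phi p))%:E)).
have mfP : measurable_fun setT (fun p => (f (Phi p))%:E).
  by apply/measurable_EFinP; exact: measurableT_comp.
move=> /(_ mfP (fun p => f0 _)) law.
pose Pf (x : E) : R := fine (\int[@gauss R d]_z (f (euler_step V sigma0 h x z))%:E)%E.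
have mstep x : measurable_fun setT (fun z => (f (euler_step V sigma0 h x z))%:E).
  apply/measurable_EFinP; apply: (measurableT_comp mf).
  exact: (measurableT_comp (measurable_euler_step sigma0 dgV h) (measurable_pair1 x)).
have P01 x : (0 <= \int[@gauss R d]_z (f (euler_step V sigma0 h x z))%:E <= 1)%E.
  rewrite integral_ge0/=; last by move=> z _; rewrite lee_fin.
  apply: (@le_trans _ _ (\int[@gauss R d]_z (cst 1%:E z))%E); last first.
    by rewrite integral_cst// mul1e probability_le1.
  apply: ge0_le_integral => //.
  - by move=> z _; rewrite lee_fin.
  - by move=> z _ /=; rewrite lee_fin; case/andP: (f01 (euler_step V sigma0 h x z)).
have PfE x : ((Pf x)%:E = \int[@gauss R d]_z (f (euler_step V sigma0 h x z))%:E)%E.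
  rewrite fineK// ge0_fin_numE; first by case/andP: (P01 x) => _ /le_lt_trans; apply; rewrite ltry.
  by case/andP: (P01 x).
have Pf01 x : 0 <= Pf x <= 1 by have := P01 x; rewrite -PfE !lee_fin.
have mPf : measurable_fun setT Pf.
  apply: (@measurableT_comp _ _ _ _ _ _ (@fine R)) => //.
  have mff : measurable_fun setT (fun p : E * E => (f (euler_step V sigma0 h p.1 p.2))%:E).
    apply/measurable_EFinP; apply: (measurableT_comp mf).
    exact: measurable_euler_step.
  by apply: (measurable_fun_fubini_tonelli_F _ mff) => p; rewrite lee_fin.
have -> : (\int[P0]_w (f (langevin_euler h k.+1 w))%:E =
   \int[P0]_w (Pf (langevin_euler h k w))%:E)%E.
  transitivity (\int[P0]_w (f (Phi (langevin_euler h k w, D w)))%:E)%E.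
    apply: eq_integral => w _; rewrite /langevin_euler [euler _ _ _ _ _ k.+1]/=.
    congr (f _)%:E; rewrite /Phi /D /= addr0 scalerN scalerBr.
    by [].
  rewrite law; apply: eq_integral => w _; rewrite PfE.
  by apply: eq_integral => z _; rewrite /Phi /= scalerA.
apply: (le_trans (IH _ mPf Pf01)).
have := one_step_le dV dgV s0 mu0V h0 mf f01.
rewrite -/(eps h) => step.
rewrite -natr1 EFinD ge0_muleDl ?lee_fin// mul1e [(k%:R%:E * _ + _)%E]addeC addeA.
apply: leeD2r; apply: le_trans step.
by under eq_integral do rewrite PfE.
Qed.

Variables (t : R) (Z : T0 -> E).
Hypotheses (t0 : 0 < t) (mZ : measurable_fun setT Z)
  (cZ : {ae P0, forall w, langevin_euler (t / n.+1%:R) n.+1 w @[n --> \oo] --> Z w}).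

Lemma langevin_law_le (psi : E -> R) : continuous psi ->
  (forall x, 0 <= psi x <= 1) ->
  (\int[P0]_w (psi (Z w))%:E <= \int[mu0]_x (psi x)%:E)%E.
Proof.
move=> cpsi psi01; have mpsi := continuous_measurable_rV1 cpsi.
have psi0 x : 0 <= psi x by case/andP: (psi01 x).
have h0 n : 0 < t / n.+1%:R by rewrite divr_gt0.
pose f_ n w := (psi (langevin_euler (t / n.+1%:R) n.+1 w))%:E.
have mem n : measurable_fun setT (langevin_euler (t / n.+1%:R) n.+1).
  apply: (filtration_measurable F0f (ltW t0)).
  by apply: langevin_euler_adapted; rewrite ?(ltW (h0 n))// mulrCA divff ?mulr1.
have [] := @dominated_convergence _ _ _ P0 setT measurableT f_
  (fun w => (psi (Z w))%:E) (cst 1%:E).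
- by move=> n; apply/measurable_EFinP; exact: measurableT_comp (mem n).
- by apply/measurable_EFinP; exact: measurableT_comp.
- apply: filterS cZ => w wZ _; apply: cvg_EFin; first exact: nearW.
  exact: (cvg_comp _ _ wZ (cpsi (Z w))).
- exact: finite_measure_integrable_cst.
- apply: aeW => w n _; rewrite gee0_abs ?lee_fin//.
  by case/andP: (psi01 (langevin_euler (t / n.+1%:R) n.+1 w)).
move=> _ _ cvgf.
have cvge := balance_error_cvg0 dV dgV s0 LV0 VL t0 mu0_moment.
have fin : (\int[mu0]_x (psi x)%:E)%E \is a fin_num.
  rewrite ge0_fin_numE; last by apply: integral_ge0 => x _; rewrite lee_fin.
  apply: (@le_lt_trans _ _ (\int[mu0]_x (cst 1%:E x))%E).
    apply: ge0_le_integral => //.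
    - by move=> x _; rewrite lee_fin.
    - by apply/measurable_EFinP.
    - by move=> x _; rewrite lee_fin; case/andP: (psi01 x).
  by rewrite integral_cst// mul1e (le_lt_trans (probability_le1 _ _)) ?ltry.
have cvgr : (\int[mu0]_x (psi x)%:E + n.+1%:R%:E * eps (t / n.+1%:R))%E @[n --> \oo]
    --> (\int[mu0]_x (psi x)%:E + 0)%E.
  by apply: cvgeD => //; [exact: fin_num_adde_defr|exact: cvg_cst].
rewrite -[leRHS]adde0; apply: (lee_cvg_to cvgf cvgr).
by apply: nearW => n; exact: langevin_euler_law.
Qed.

Lemma langevin_law (psi : E -> R) (M : R) : continuous psi ->
  (forall x, `|psi x| <= M) ->
  (\int[P0]_w (psi (Z w))%:E = \int[mu0]_x (psi x)%:E)%E.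
Proof.
move=> cpsi psiM; have M0 : 0 <= M by exact: le_trans (normr_ge0 _) (psiM 0).
(* Rescaling constant that sends the values of psi into [0, 1]; the added 1 keeps it positive when M
   = 0. *)
pose K := M + 1; have K0 : 0 < K by rewrite ltr_pwDr.
pose g x := (psi x + K) / (2 * K).
have cg : continuous g.
  move=> x; apply: (@continuous_comp _ _ _ psi (fun y : R => (y + K) / (2 * K))).
    exact: cpsi.
  by apply: cvgM; [apply: cvgD; [exact: cvg_id|exact: cvg_cst]|exact: cvg_cst].
have g01 x : 0 <= g x <= 1.
  have := psiM x; rewrite ler_norml => /andP[p1 p2].
  have K20 : 0 < 2 * K by rewrite mulr_gt0.
  rewrite divr_ge0 ?(ltW K20)//=; last by rewrite /K; lra.
  by rewrite ler_pdivrMr// mul1r /K; lra.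
have g01' x : 0 <= 1 - g x <= 1 by have := g01 x; lra.
have cg' : continuous (fun x => 1 - g x).
  move=> x; apply: (@continuous_comp _ _ _ g (fun y : R => 1 - y)); first exact: cg.
  by apply: cvgB; [exact: cvg_cst|exact: cvg_id].
have mg' := continuous_measurable_rV1 cg.
have mgZ : measurable_fun setT (g \o Z) by exact: measurableT_comp.
have psiE x : psi x = 2 * K * g x + - K.
  by rewrite /g; field; rewrite gt_eqF.
have le1 := langevin_law_le cg g01.
have le2 := langevin_law_le cg' g01'.
have E1 (a b : R) := probability_affine P0 a b mgZ (fun w => g01 (Z w)).
have E2 (a b : R) := probability_affine mu0 a b mg' g01.
have E3 : Rintegral P0 setT (g \o Z) = Rintegral mu0 setT g.
  apply/eqP; rewrite eq_le; apply/andP; split.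
    move: le1; have := E1 1 0; have := E2 1 0.
    under eq_integral do rewrite mul1r addr0; move=> ->.
    under eq_integral do rewrite mul1r addr0; move=> ->.
    by rewrite lee_fin !mul1r !addr0.
  move: le2; have := E1 (-1) 1; have := E2 (-1) 1.
  under eq_integral do rewrite mulN1r addrC; move=> ->.
  under eq_integral do rewrite mulN1r addrC; move=> ->.
  by rewrite lee_fin; lra.
under eq_integral do rewrite psiE.
under [RHS]eq_integral do rewrite psiE.
by rewrite E2 E1 E3.
Qed.

End langevin_law.

(** * Solutions started from Dirac masses *)

Lemma mean_continuous (R : realType) d : continuous (@mean R d).
Proof.
apply/continuousP => U oU; have : W2_open (@mean R d @^-1` U); last by [].
move=> m mU; have /nbhs_ballP[e /= e0 eU] : nbhs (mean m) U by exact: open_nbhs_nbhs.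
have e20 : 0 < e / 2 by rewrite divr_gt0.
exists (e / 2) => // n mn; apply: eU; rewrite -ball_normE/=.
apply: (@le_lt_trans _ _ (e / 2)); last by rewrite ltr_pdivrMr// ltr_pMr// ltr1n.
apply: norm_le_coord => [|i]; first exact: ltW.
rewrite !mxE -[leRHS]mul1r.
exact: (lipschitz_W2 ler01 (@lipschitz_coord R d i) mn).
Qed.

Lemma concentrated_mean (R : realType) d (m : P2 R d) z : concentrated m z -> mean m = z.
Proof.
move=> mz; rewrite -[RHS]mean_dirac; apply/rowP => i; rewrite !mxE /Rintegral.
by congr fine; apply: eq_measure_integral => A mA _; exact: concentrated_dirac.
Qed.

(** Upgrades an almost sure equality at each rational time to one at all times, outside a single
    null set. *)
Lemma within_continuous_eq_rat (R : realType) d (f g : R -> 'rV[R]_d) :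
  {within `[0, +oo[, continuous f} -> {within `[0, +oo[, continuous g} ->
  (forall q : rat, 0 <= ratr q :> R -> f (ratr q) = g (ratr q)) ->
  forall t, 0 <= t -> f t = g t.
Proof.
move=> cf cg fg t t0; apply/eqP; rewrite -subr_eq0 -normr_le0.
apply/ler_addgt0Pr => e e0; rewrite add0r.
have e20 : 0 < e / 2 by rewrite divr_gt0.
have [r1 r10 r1P] := within_continuous_unif (t + 1) cf e20.
have [r2 r20 r2P] := within_continuous_unif (t + 1) cg e20.
have : t < t + Num.min 1 (Num.min r1 r2) by rewrite ltrDl !lt_min ltr01 r10.
move=> /rat_between[q tq].
rewrite -ltrBlDl !lt_min => /and3P[q1 qr1 qr2].
have q0 : 0 <= ratr q :> R by rewrite (le_trans t0)// ltW.
have tt : 0 <= t <= t + 1 by rewrite t0 lerDl ler01.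
have qq : 0 <= (ratr q : R) <= t + 1.
  by rewrite q0/=; lra.
have tqE : `|t - ratr q| = ratr q - t by rewrite distrC gtr0_norm// subr_gt0.
have -> : f t - g t = (f t - f (ratr q)) - (g t - g (ratr q)).
  by rewrite (fg _ q0) opprB addrA subrK.
rewrite (le_trans (ler_normB _ _))// [leRHS]splitr lerD//.
  by apply: r1P => //; rewrite tqE.
by apply: r2P => //; rewrite tqE.
Qed.

Section solution_analysis.
Context {R : realType} {d : nat} {d0 d1 : measure_display} {T0 : measurableType d0}
  {T1 : measurableType d1}.
Local Notation E := 'rV[R]_d.
Variables (P0 : probability T0 R) (P1 : probability T1 R)
  (F0 : R -> set (set T0)) (F1 : R -> set (set T1)) (B : R -> T0 -> E)
  (V W : E -> R) (sigma0 alpha LV : R)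
  (X : R -> T0 * T1 -> E) (m : R -> T0 -> P2 R d).
Hypotheses (WE : forall x, W x = alpha * enorm x ^+ 2 / 2)
  (dV : forall x, differentiable V x) (dgV : forall x, differentiable (grad V) x)
  (LV0 : 0 <= LV) (VL : forall x y, enorm (grad V x - grad V y) <= LV * enorm (x - y))
  (F0f : filtration F0) (B0 : brownian P0 F0 B)
  (sol : solution P0 P1 F0 F1 B V W sigma0 X m)
  (m0 : {ae P0, forall w, concentrated (m 0 w) (mean (m 0 w))}).
Local Notation Q := (P0 \x P1)%E.
Local Notation mu := (@lebesgue_measure R).

Let a w := mean (m 0 w).
Let force x : E := - grad V x - alpha *: x.
Let interaction s w : E := alpha *: mean (m s w).
Let approx (t : R) n w :=
  euler force (interaction ^~ w) (fun s => sigma0 *: B s w) (t / n.+1%:R) (a w) n.+1.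

Let mF0 t A : 0 <= t -> F0 t A -> measurable A.
Proof. by move=> t0; exact: (F0f.1 t t0).2. Qed.

Let m_adapted t : 0 <= t -> measurable_wrt (F0 t) (m t).
Proof. by move=> t0; exact: (solution_law sol t0).1. Qed.

Let mean_adapted t : 0 <= t -> measurable_wrt (F0 t) (fun w => mean (m t w)).
Proof.
move=> t0; apply/(measurable_wrtP _ (F0f.1 t t0).1).
apply: (measurableT_comp measurable_mean).
by apply/(measurable_wrtP _ (F0f.1 t t0).1); exact: m_adapted.
Qed.

Let wrt_le t i (Y : T0 -> E) (q : R) : 0 <= t -> measurable_wrt (F0 t) Y ->
  F0 t [set w | Y w 0 i <= q].
Proof.
move=> t0 mY; rewrite (_ : [set w | _] = Y @^-1` (~` [set x : E | q < x 0 i])).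
  by apply: mY; apply: measurableC; exact: measurable_halfspace_gt.
by apply/seteqP; split => w /=; [rewrite leNgt => /negP|move/negP; rewrite -leNgt].
Qed.

Let wrt_ge t i (Y : T0 -> E) (q : R) : 0 <= t -> measurable_wrt (F0 t) Y ->
  F0 t [set w | q <= Y w 0 i].
Proof.
move=> t0 mY; rewrite (_ : [set w | _] = Y @^-1` (~` [set x : E | x 0 i < q])).
  by apply: mY; apply: measurableC; exact: measurable_halfspace_lt.
by apply/seteqP; split => w /=; [rewrite leNgt => /negP|move/negP; rewrite -leNgt].
Qed.

Lemma initial_condition : {ae Q, forall w, X 0 w = a w.1}.
Proof.
have [_ law0] := solution_law sol (lexx 0).
have ma := mean_adapted (lexx 0).
(* On A the initial law is the Dirac mass at [a w], which does not charge H; [cond_law] then makes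
   the event that A holds and X_0 lies in H null. It is used with [a] on one side of a rational
   threshold and H on the other. *)
have zero (A : set T0) (H : set E) : F0 0 A -> measurable H ->
    measurable_fun setT (fun n : P2 R d => n H) ->
    (forall w, A w -> concentrated (m 0 w) (a w) -> m 0 w H = 0%E) ->
    {ae Q, forall w, ~ (A w.1 /\ H (X 0 w))}.
  move=> FA mH mev AH.
  have : (Q^*)%mu ((A `*` setT) `&` X 0 @^-1` H) = 0%E.
    rewrite law0//.
    have mA := mF0 (lexx 0) FA.
    rewrite -(integral0 P0 A); apply: ae_eq_integral => //.
    + apply: measurable_funTS; apply: (measurableT_comp mev).
      exact: (filtration_measurable F0f (lexx 0) (m_adapted (lexx 0))).
    + by apply: filterS m0 => w mw Aw; exact: AH.
  move=> /mu_ext0_negligible[N [mN N0 HN]]; exists N; split => //.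
  by move=> w /= /contrapT[Aw Hw]; apply: HN.
have : {ae Q, forall w (p : 'I_d * rat),
    ~ (a w.1 0 p.1 <= ratr p.2 < X 0 w 0 p.1) /\
    ~ (X 0 w 0 p.1 < ratr p.2 <= a w.1 0 p.1)}.
  apply: ae_forall_count => p.
  have h1 := zero _ _ (wrt_le p.1 (ratr p.2) (lexx 0) ma)
    (measurable_halfspace_gt p.1 (ratr p.2)) (measurable_P2_gt p.1 (ratr p.2)) (fun w aw mw => (mw p).1 aw).
  have h2 := zero _ _ (wrt_ge p.1 (ratr p.2) (lexx 0) ma)
    (measurable_halfspace_lt p.1 (ratr p.2)) (measurable_P2_lt p.1 (ratr p.2)) (fun w aw mw => (mw p).2 aw).
  apply: filterS2 h1 h2 => w h1 h2; split; first by move=> /andP[]*; apply: h1.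
  by move=> /andP[]*; apply: h2.
by apply: filterS => w; exact: rat_separation.
Qed.

Let within_mean w : {within `[0, +oo[, continuous (fun t => m t w)} ->
  {within `[0, +oo[, continuous (fun t => mean (m t w))}.
Proof. by move=> cm x; apply: continuous_comp; [exact: cm|exact: mean_continuous]. Qed.

Let grad_norm x y : `|grad V x - grad V y| <= LV * d%:R * `|x - y|.
Proof.
rewrite (le_trans (norm_le_enorm _))// (le_trans (VL _ _))// -mulrA.
by rewrite ler_wpM2l// enorm_le_norm.
Qed.

Lemma approx_cvg : {ae Q, forall w, forall t, 0 <= t ->
  approx t n w.1 @[n --> \oo] --> X t w}.
Proof.
have mc := @ae_fst R _ _ _ _ P0 P1 _ (solution_law_cont sol).
have h1 : {ae Q, forall w, X 0 w = a w.1 /\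
    {within `[0, +oo[, continuous (fun t => m t w.1)}}.
  by apply: filterS2 initial_condition mc => w.
have h2 : {ae Q, forall w, (X 0 w = a w.1 /\
    {within `[0, +oo[, continuous (fun t => m t w.1)}) /\
    {within `[0, +oo[, continuous (fun t => X t w)}}.
  by apply: filterS2 h1 (solution_cont sol) => w.
apply: filterS2 h2 (solution_sde sol) => -[w0 w1] /= [[x0 mw] cX] sde t t0.
rewrite /approx /= -x0.
(* [euler_cvg] is stated in the sup norm, whence the factor d on LV; alpha comes from the linear
   part of the interaction, and the mean of m enters as the forcing. *)
apply: (@euler_cvg R d force (LV * d%:R + `|alpha|) (interaction ^~ w0)
  (fun s => sigma0 *: B s w0) (fun s => X s (w0, w1))) => //.
- by rewrite addr_ge0// mulr_ge0.
- move=> x y.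
  have -> : force x - force y = - (grad V x - grad V y) - alpha *: (x - y).
    by apply/rowP => i; rewrite !mxE; ring.
  rewrite (le_trans (ler_normB _ _))// normrN mulrDl lerD ?grad_norm//.
  by rewrite normrZ.
- move=> s; apply: continuous_comp; first exact: within_mean.
  exact: scaler_continuous.
- move=> s s0 i; have [bi bE] := sde s s0 i.
  have E1 : (fun r => drift V W (m r w0) (X r (w0, w1)) 0 i) =
            (fun r => (force (X r (w0, w1)) + interaction r w0) 0 i).
    by apply/funext => r; rewrite (drift_quadratic _ _ _ WE).
  rewrite -E1; split => //; by rewrite bE !mxE.
Qed.

(* The limit superior makes [Z t] measurable for [F0 t] even where [approx] does
   not converge. *)
Let Z (t : R) (w : T0) : E := \row_i fine (limn_esup (fun n => (approx t n w 0 i)%:E)).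

Let Z_lim t w x : approx t n w @[n --> \oo] --> x -> Z t w = x.
Proof.
move=> cx; apply/rowP => i; rewrite mxE.
have cxi : (approx t n w 0 i)%:E @[n --> \oo] --> (x 0 i)%:E.
  apply: cvg_EFin; first exact: nearW.
  exact: (@cvg_comp _ _ _ (fun n => approx t n w) (fun v : E => v 0 i) _ _ _ cx
    (@coord_continuous R 1 d 0 i x)).
rewrite is_cvg_limn_esupE; first by rewrite (cvg_lim _ cxi).
by apply/cvg_ex; exists (x 0 i)%:E.
Qed.

Let Z_adapted t : 0 <= t -> measurable_wrt (F0 t) (Z t).
Proof.
move=> t0; have sF := (F0f.1 t t0).1; apply/(measurable_wrtP _ sF).
apply: measurable_fun_rV => i; under eq_fun do rewrite mxE.
apply: (@measurableT_comp _ _ _ _ _ _ (@fine R)) => //.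
apply: measurable_fun_limn_esup => n; apply/measurable_EFinP.
apply: (measurableT_comp (measurable_coord i)).
apply/(measurable_wrtP _ sF); apply: euler_adapted => //.
- apply: measurable_rV_add.
    by apply: measurable_rV_opp; apply: continuous_measurable_rV; exact: grad_continuous.
  by apply: measurable_rV_opp; apply: measurable_rV_scale.
- move=> s ss; apply/(measurable_wrtP _ (F0f.1 s ss).1).
  apply: measurable_rV_scale.
  by apply/(measurable_wrtP _ (F0f.1 s ss).1); exact: mean_adapted.
- move=> s ss; apply/(measurable_wrtP _ (F0f.1 s ss).1); apply: measurable_rV_scale.
  by apply/(measurable_wrtP _ (F0f.1 s ss).1); exact: (brownian_adapted B0).
- exact: mean_adapted.
- by rewrite divr_ge0.
- by rewrite mulrCA divff ?mulr1.
Qed.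

Let solution_Z : {ae Q, forall w, forall t, 0 <= t -> X t w = Z t w.1}.
Proof. by apply: filterS approx_cvg => w cw t t0; apply/esym/Z_lim; exact: cw. Qed.

(** [cond_law] read in the other direction: on an event A of F0 t where [Z t] avoids a half-space H,
    so does X_t almost surely, hence the integral of m_t(H) over A is zero and m_t(H) = 0 almost
    everywhere on A. *)
Lemma law_concentrated t : 0 <= t ->
  {ae P0, forall w, concentrated (m t w) (Z t w)}.
Proof.
move=> t0; have [_ lawt] := solution_law sol t0.
have zero (A : set T0) (H : set E) : F0 t A -> measurable H ->
    measurable_fun setT (fun n : P2 R d => n H) ->
    (forall w, A w -> ~ H (Z t w)) ->
    {ae P0, forall w, A w -> m t w H = 0%E}.
  move=> FA mH mev AH; have mA := mF0 t0 FA.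
  have ext0 : (Q^*)%mu ((A `*` setT) `&` X t @^-1` H) = 0%E.
    apply: negligible_mu_ext0.
    case: solution_Z => N [mN N0 HN]; exists N; split => //.
    move=> w [[Aw _] /= Hw]; apply: HN => /= /(_ t t0) XZ.
    by apply: (AH _ Aw); rewrite -XZ.
  have mmH : measurable_fun A (fun w => m t w H).
    apply: measurable_funTS; apply: (measurableT_comp mev).
    exact: (filtration_measurable F0f t0 (m_adapted t0)).
  have := lawt A H FA mH; rewrite ext0 => /esym int0.
  have : (\int[P0]_(w in A) `|m t w H| = 0)%E.
    by rewrite -[RHS]int0; apply: eq_integral => w _; rewrite gee0_abs.
  by move=> /(ae_eq_integral_abs P0 mA mmH).
apply: ae_forall_count => p.
have h1 := zero _ _ (wrt_le p.1 (ratr p.2) t0 (Z_adapted t0))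
    (measurable_halfspace_gt p.1 (ratr p.2)) (measurable_P2_gt p.1 (ratr p.2)).
have h2 := zero _ _ (wrt_ge p.1 (ratr p.2) t0 (Z_adapted t0))
    (measurable_halfspace_lt p.1 (ratr p.2)) (measurable_P2_lt p.1 (ratr p.2)).
apply: filterS2 (h1 _) (h2 _) => //.
- by move=> w /= ?; apply/negP; rewrite -leNgt.
- by move=> w /= ?; apply/negP; rewrite -leNgt.
Qed.

(** X_s = Z_s = mean (m s) holds at all rational times outside one null set, hence at all times
    since both X and the mean are continuous. The interaction then cancels inside the time integral,
    and X solves the equation with drift - grad V, to which the scheme without forcing converges. *)
Lemma langevin_euler_cvg : {ae P0, forall w, forall t, 0 <= t ->
  langevin_euler B V sigma0 a (t / n.+1%:R) n.+1 w @[n --> \oo] --> Z t w}.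
Proof.
have conc : {ae P0, forall w (q : rat), 0 <= ratr q :> R ->
    concentrated (m (ratr q) w) (Z (ratr q) w)}.
  apply: ae_forall_count => q.
  have [q0|q0] := leP 0 (ratr q : R); last by apply: aeW.
  by apply: filterS (law_concentrated q0) => w.
have h1 : {ae Q, forall w, X 0 w = a w.1 /\ (forall t, 0 <= t -> X t w = Z t w.1)}.
  by apply: filterS2 initial_condition solution_Z => w.
have h2 : {ae Q, forall w, (X 0 w = a w.1 /\ (forall t, 0 <= t -> X t w = Z t w.1)) /\
    {within `[0, +oo[, continuous (fun t => X t w)}}.
  by apply: filterS2 h1 (solution_cont sol) => w.
pose G (x : T0) (y : T1) := ((X 0 (x, y) = a x /\
      (forall t, 0 <= t -> X t (x, y) = Z t x)) /\
      {within `[0, +oo[, continuous (fun t => X t (x, y))}) /\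
    (forall t, 0 <= t -> forall i,
      let b s := drift V W (m s x) (X s (x, y)) 0 i in
      mu.-integrable `[0, t] (EFin \o b) /\
      X t (x, y) 0 i = X 0 (x, y) 0 i + Rintegral mu `[0, t] b
                + sigma0 * B t x 0 i).
have h3 : {ae Q, forall w, G w.1 w.2}.
  by apply: filterS2 h2 (solution_sde sol) => -[w0 w1].
have h4 := ae_section h3.
have h5 : {ae P0, forall w, (forall q : rat, 0 <= ratr q :> R ->
    concentrated (m (ratr q) w) (Z (ratr q) w)) /\
    {within `[0, +oo[, continuous (fun t => m t w)}}.
  by apply: filterS2 conc (solution_law_cont sol) => w.
(* The claim involves w0 only, so a single good point w1 of the second space is enough. *)
apply: filterS2 h5 h4 => w0 [qw mw] /ae_exists[w1 [[[x0 XZ] cX] sde]] t t0.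
have Xmean s : 0 <= s -> X s (w0, w1) = mean (m s w0).
  apply: (@within_continuous_eq_rat _ _ (fun s => X s (w0, w1))
    (fun s => mean (m s w0))) => //; first exact: within_mean.
  by move=> q q0; rewrite (concentrated_mean (qw q q0)) XZ.
rewrite -XZ// /langevin_euler -x0.
apply: (@euler_cvg R d (fun x => - grad V x) (LV * d%:R) (fun=> 0)
  (fun s => sigma0 *: B s w0) (fun s => X s (w0, w1))) => //.
- by rewrite mulr_ge0.
- by move=> x y; rewrite -opprD normrN.
- by move=> s; exact: cst_continuous.
- move=> s s0 i; have [bi bE] := sde s s0 i.
  have E1 : {in `[0, s]%classic, (fun r => drift V W (m r w0) (X r (w0, w1)) 0 i) =1
            (fun r => (- grad V (X r (w0, w1)) + 0) 0 i)}.
    move=> r; rewrite inE/= in_itv/= => /andP[r0 _].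
    rewrite (drift_quadratic _ _ _ WE) -Xmean// addr0.
    by rewrite !mxE addrAC -addrA subrr addr0.
  split.
    apply: eq_integrable bi => //.
    by move=> r rI /=; congr EFin; exact: E1.
  by rewrite bE !mxE; congr (_ + _ + _); exact: eq_Rintegral.
Qed.

Variable mu0 : probability E R.
Hypotheses (s0 : 0 < sigma0) (mu0V : gibbs V sigma0 mu0)
  (mu0_moment : (\int[mu0]_x (dotv x x)%:E < +oo)%E)
  (alaw : forall f : E -> R, measurable_fun setT f -> (forall x, 0 <= f x) ->
    (\int[P0]_w (f (mean (m 0 w)))%:E = \int[mu0]_x (f x)%:E)%E).

Lemma solution_law_invariant (t : R) (phi : P2 R d -> R) (M : R) : 0 < t ->
  continuous phi -> (forall n, `|phi n| <= M) ->
  (\int[P0]_w (phi (m t w))%:E = \int[mu0]_x (phi (diracP2 x))%:E)%E.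
Proof.
move=> t0 cphi phiM.
pose psi := phi \o @diracP2 R d.
have cpsi : continuous psi.
  by move=> x; apply: continuous_comp; [exact: diracP2_continuous|exact: cphi].
have mZ := filtration_measurable F0f (ltW t0) (Z_adapted (ltW t0)).
rewrite -(langevin_law F0f B0 dV dgV s0 LV0 VL mu0V mu0_moment
  (mean_adapted (lexx 0)) alaw t0 mZ _ cpsi (M := M)) => [||x]; last 2 first.
- by apply: filterS langevin_euler_cvg => w /(_ t (ltW t0)).
- exact: phiM.
apply: ae_eq_integral => //.
- apply/measurable_EFinP; apply: (measurableT_comp (P2_measurable cphi)).
  exact: (filtration_measurable F0f (ltW t0) (m_adapted (ltW t0))).
- by apply/measurable_EFinP; exact: (measurableT_comp (continuous_measurable_rV1 cpsi)).
- apply: filterS (law_concentrated (ltW t0)) => w mw _; congr EFin.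
  exact: P2_continuous_dirac cphi (concentrated_dirac mw).
Qed.

End solution_analysis.

(** * The mixture of Dirac masses and the conclusion *)

Lemma limf_esup_pinfty_gt0 (R : realType) (kappa : R -> R) :
  (0 < limf_esup (EFin \o kappa) +oo%R)%E -> exists2 r, 0 < r & 0 < kappa r.
Proof.
move=> /lt_le_trans/(_ (ereal_inf_lbound _)) k0.
have /k0 : [set ereal_sup ((EFin \o kappa) @` V) | V in +oo%R]
    (ereal_sup ((EFin \o kappa) @` `]0, +oo[%classic)).
  (* The limit superior is an infimum over neighbourhoods of infinity; this one makes the point
     found positive. *)
  exists `]0, +oo[%classic => //.
  by exists 0; split => // x x0; rewrite /= in_itv/= x0.
move=> /ereal_sup_gt[_ [r + <-]]; rewrite /= in_itv/= andbT => r0 kr.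
by exists r.
Qed.

Section dirac_mixture.
Context {R : realType} {d : nat} (mu0 : probability 'rV[R]_d R).
Local Notation P2 := (P2 R d).

Definition dirac_mixture : probability P2 R :=
  distribution mu0 (to_mfun (@measurable_diracP2 R d)).

Lemma dirac_mixtureE A : measurable A ->
  dirac_mixture A = (\int[mu0]_a \d_(diracP2 a) A)%E.
Proof.
move=> mA; have mdA : measurable (@diracP2 R d @^-1` A).
  by rewrite -[X in measurable X]setTI; apply: measurable_diracP2.
transitivity (\int[mu0]_a (\1_(@diracP2 R d @^-1` A) a)%:E)%E.
  by rewrite integral_indic// setIT.
by apply: eq_integral => a _; rewrite diracE indicE.
Qed.

Lemma dirac_mixture_dirac : dirac_mixture dirac_measures = 1%E.
Proof.
transitivity (mu0 setT); last exact: probability_setT.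
rewrite /dirac_mixture /distribution /pushforward; congr (mu0 _).
by apply/seteqP; split => // a _; exists a.
Qed.

Lemma dirac_mixture_P2P2 : (\int[mu0]_x (dotv x x)%:E < +oo)%E -> P2P2 dirac_mixture.
Proof.
move=> mu0_moment; apply: le_lt_trans mu0_moment.
(* Along Dirac masses the distance to [diracP2 0] is at most |a|, so the second moment of mu0 bounds
   that of the mixture. *)
apply: (@ge0_integral_pushforward_le _ _ _ _ _ mu0 (@diracP2 R d)
  (fun m => (W2 m (diracP2 0) ^+ 2)%:E) _ measurable_diracP2).
- by apply/measurable_EFinP; exact: measurable_dotv.
- by move=> m; rewrite lee_fin sqr_ge0.
move=> a; rewrite lee_fin -sqr_enorm ler_pXn2r ?nnegrE ?enorm_ge0 ?sqrtr_ge0//.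
by rewrite -[in leRHS](subr0 a); exact: W2_dirac.
Qed.

End dirac_mixture.

Theorem proposition6 (R : realType) (d : nat) (sigma0 alpha LV : R)
    (V W : 'rV[R]_d -> R) (kappa : R -> R) :
  (1 <= d)%N -> 0 < sigma0 -> 0 < alpha ->
  (forall x, W x = alpha * enorm x ^+ 2 / 2) ->
  (forall x, differentiable V x) -> (forall x, differentiable (grad V) x) ->
  (forall x y, kappa (enorm (x - y)) * enorm (x - y) ^+ 2 <=
               dotv (grad V x - grad V y) (x - y)) ->
  (0 < limf_esup (EFin \o kappa) +oo%R)%E ->
  lebesgue_measure.-integrable `[0%R, 1%R]
    (fun r : R => (r * Num.max 0 (- kappa r))%:E) ->
  0 < LV ->
  (forall x y, enorm (grad V x - grad V y) <= LV * enorm (x - y)) ->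
  exists mu0 : probability 'rV[R]_d R, gibbs V sigma0 mu0 /\
    exists Pbar : probability (P2 R d) R,
      [/\ forall A, measurable A ->
             Pbar A = (\int[mu0]_a \d_(diracP2 a) A)%E,
          invariant_measure V W sigma0 Pbar &
          Pbar dirac_measures = 1%E].
Proof.
move=> _ s0 _ WE dV dgV Vkappa kappa_oo _ LV0 VL.
have [r0 r00 k0] := limf_esup_pinfty_gt0 kappa_oo.
have Vr0 x y : enorm (x - y) = r0 ->
    kappa r0 * r0 ^+ 2 <= dotv (grad V x - grad V y) (x - y).
  by move=> <-; exact: Vkappa.
have [C VC] := potential_ge dV (ltW LV0) VL r00 k0 Vr0.
have k40 : 0 < kappa r0 / 4 by rewrite divr_gt0.
have cV := potential_continuous dV.
have [mu0 mu0V] := gibbs_exists cV s0 k40 VC.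
have mu0_moment := gibbs_moment cV s0 k40 VC mu0V.
exists mu0; split => //; exists (dirac_mixture mu0); split.
- exact: dirac_mixtureE.
- split; first exact: dirac_mixture_P2P2.
  move=> d0 d1 T0 T1 P0 P1 F0 F1 B X m F0f F1f B0 sol law0 t phi t0 cphi [M phiM].
  have mm0 : measurable_fun setT (m 0).
    exact: (filtration_measurable F0f (lexx 0) (solution_law sol (lexx 0)).1).
  (* The law of m_0 is the mixture, which ignores this exceptional set: [diracP2 a] is concentrated
     at its mean a, so no a is sent into the set. *)
  have ae0 : {ae P0, forall w, concentrated (m 0 w) (mean (m 0 w))}.
    have mD := @measurable_concentrated_mean R d.
    exists (m 0 @^-1` ~` [set n : P2 R d | concentrated n (mean n)]); split => //.
    + by rewrite -[X in measurable X]setTI; apply: mm0 => //; exact: measurableC.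
    + rewrite law0; last exact: measurableC.
      transitivity (mu0 (@diracP2 R d @^-1`
        ~` [set n : P2 R d | concentrated n (mean n)])) => //.
      rewrite (_ : _ @^-1` _ = set0) ?measure0//.
      apply/seteqP; split => // a /=; apply.
      by rewrite mean_dirac; exact: dirac_concentrated.
  (* [mean] inverts [diracP2], so the image under [mean] of the law of m_0 is mu0. *)
  have alaw (f : 'rV[R]_d -> R) : measurable_fun setT f -> (forall x, 0 <= f x) ->
      (\int[P0]_w (f (mean (m 0 w)))%:E = \int[mu0]_x (f x)%:E)%E.
    move=> mf f0.
    have mfm : measurable_fun setT (fun n : P2 R d => (f (mean n))%:E).
      by apply/measurable_EFinP; exact: (measurableT_comp mf measurable_mean).
    have f00 (n : P2 R d) : (0 <= (f (mean n))%:E)%E by rewrite lee_fin.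
    have := ge0_integral_pushforward mm0 P0 measurableT mfm (fun n _ => f00 n).
    have := ge0_integral_pushforward measurable_diracP2 mu0 measurableT mfm (fun n _ => f00 n).
    rewrite !preimage_setT.
    under [X in _ = X -> _]eq_integral do rewrite /= mean_dirac.
    move=> <- <-; apply: eq_measure_integral => [|? A mA _]; first exact: measurable_diracP2.
    exact: law0 A mA.
  rewrite unlock.
  rewrite [LHS](solution_law_invariant WE dV dgV (ltW LV0) VL F0f B0 sol ae0 s0 mu0V
    mu0_moment alaw t0 cphi phiM).
  apply/esym.
  have mphi : measurable_fun setT (EFin \o phi).
    by apply/measurable_EFinP; exact: P2_measurable.
  have := @integral_pushforward _ _ _ _ _ _ measurable_diracP2 mu0 setT (EFin \o phi) mphi.
  rewrite preimage_setT; apply => //.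
  apply: (le_integrable measurableT _ _ (finite_measure_integrable_cst mu0 M measurableT)).
  + exact: (measurableT_comp mphi measurable_diracP2).
  + by move=> x _ /=; rewrite lee_fin (le_trans (phiM _))// ler_norm.
- exact: dirac_mixture_dirac.
Qed.
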